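(* Suppose that for some $\mu>0$ there is an efficient online algorithm for the $k$-server problem that has regret $\mathrm{poly}(n)\,T^{1-\mu}$. Then for every $\epsilon>0$ there is a polynomial-time algorithm that achieves a $(2+\epsilon)$-approximation for the $k$-median problem.
   Context: Online $k$-server problem, as a metrical task system. $X$ is a set of $n$ locations with metric $d$, $d(x_1,x_2)\le1$ for all $x_1,x_2$. The states are the configurations $C\in X^k$ of the $k$ servers; the distance $d(C_1,C_2)$ between configurations is the minimum weight of a perfect matching between the $k$ locations of $C_1$ and those of $C_2$, where matching $x_1$ to $x_2$ has weight $d(x_1,x_2)$. There is one possible loss function $\ell_x$ for each $x\in X$ (a request for location $x$): $\ell_x(C)=2\min_{y\in C}d(y,x)$. At each step $t=1,\dots,T$ the online algorithm (possibly randomized) is given the request, i.e. $l_t\in\{\ell_x:x\in X\}$, then chooses a configuration $C_t$, and pays $l_t(C_t)$ plus, for $t\ge2$, $d(C_t,C_{t-1})$. The request sequence is fixed in advance by an oblivious adversary and $T$ is known. The regret is the smallest $R(T)$ such that for every request sequence $\mathbb{E}[\sum_{t=1}^Tl_t(C_t)+\sum_{t=2}^Td(C_t,C_{t-1})]\le\min_{C\in X^k}\sum_{t=1}^Tl_t(C)+R(T)$, the expectation being over the randomness of the online algorithm. Efficient (for the $k$-server algorithm): each step runs in time polynomial in $n$, $T$ and the bit-length of the representation of the underlying metric space. $k$-median problem: given a finite metric space $(X,d)$ and $k$, find $A\subseteq X$ with $|A|=k$ minimizing $\sum_{x\in X}d(x,A)$, where $d(x,A)=\min_{a\in A}d(x,a)$.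 An algorithm achieves a $\rho$-approximation if the cost of its output is at most $\rho$ times the minimum cost. *)

(* Defs.v *)
From mathcomp Require Import all_boot all_order all_algebra perm.
From mathcomp Require Import reals exp.

Set Implicit Arguments.
Unset Strict Implicit.
Unset Printing Implicit Defensive.

Import Order.TTheory GRing.Theory Num.Theory.
Local Open Scope ring_scope.

(** A finite experiment with fair coin flips, as the tree of its outcomes. *)
Inductive rdist (A : Type) : Type :=
| Ret of A
| Flip of rdist A & rdist A.

Arguments Ret {A} _.

Fixpoint dbind (A B : Type) (m : rdist A) (f : A -> rdist B) : rdist B :=
  match m with
  | Ret a => f a
  | Flip m0 m1 => Flip (dbind m0 f) (dbind m1 f)
  end.

Definition dmap (A B : Type) (f : A -> B) (m : rdist A) : rdist B :=
  dbind m (fun a => Ret (f a)).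

Fixpoint always (A : Type) (P : A -> Prop) (m : rdist A) : Prop :=
  match m with
  | Ret a => P a
  | Flip m0 m1 => always P m0 /\ always P m1
  end.

Fixpoint expect (R : realType) (A : Type) (f : A -> R) (m : rdist A) : R :=
  match m with
  | Ret a => f a
  | Flip m0 m1 => (expect f m0 + expect f m1) / 2
  end.

Definition prob (R : realType) (A : Type) (E : A -> bool) (m : rdist A) : R :=
  expect (fun a => (E a)%:R) m.

(** Model of computation: randomized while-programs transforming values built from natural numbers
  by pairing.  Numbers are measured by their binary length, and every
  executed instruction is charged the size of the value it reads plus the
  size of the value it writes (logarithmic cost).  In particular no run can
  produce a value larger than its running time, and running times are
  polynomially related to those of probabilistic Turing machines. *)

Inductive data : Type :=
| DNum of nat
| DPair of data & data.

Fixpoint dsize (x : data) : nat :=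
  match x with
  | DNum n => (trunc_log 2 n).+1
  | DPair a b => (dsize a + dsize b).+1
  end.

Inductive arith : Type := OpAdd | OpSub | OpMul | OpDiv.

Definition arith_op (o : arith) : nat -> nat -> nat :=
  match o with
  | OpAdd => addn
  | OpSub => subn
  | OpMul => muln
  | OpDiv => divn
  end.

Inductive prog : Type :=
| PId
| PConst of nat
| PFst
| PSnd
| PIsNum
| PArith of arith
| PCoin
| PPair of prog & prog
| PSeq of prog & prog
| PIf of prog & prog & prog
| PWhile of prog & prog.

(** An outcome is [Some (output, running time)]; [None] means that some loop
    was cut off. *)
Definition outcome : Type := option (data * nat).

Definition out (y : data) : rdist outcome := Ret (Some (y, dsize y)).

Definition add_time (c : nat) (m : rdist outcome) : rdist outcome :=
  dmap (omap (fun r => (r.1, (c + r.2)%N))) m.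

Definition andthen (m : rdist outcome) (f : data -> rdist outcome) :
    rdist outcome :=
  dbind m (fun o => if o is Some (y, c) then add_time c (f y) else Ret None).

(** [run cap p x] executes [p] on [x], cutting off every loop after [cap]
    evaluations of its guard. *)
Fixpoint run (cap : nat) (p : prog) (x : data) {struct p} : rdist outcome :=
  add_time (dsize x).+1
    match p with
    | PId => out x
    | PConst c => out (DNum c)
    | PFst => out (if x is DPair a _ then a else DNum 0)
    | PSnd => out (if x is DPair _ b then b else DNum 0)
    | PIsNum => out (if x is DNum _ then DNum 1 else DNum 0)
    | PArith o =>
        out (if x is DPair (DNum a) (DNum b) then DNum (arith_op o a b)
             else DNum 0)
    | PCoin => Flip (out (DNum 0)) (out (DNum 1))
    | PPair p1 p2 =>
        andthen (run cap p1 x) (fun y =>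
        andthen (run cap p2 x) (fun z => out (DPair y z)))
    | PSeq p1 p2 => andthen (run cap p1 x) (run cap p2)
    | PIf b p1 p2 =>
        andthen (run cap b x) (fun c =>
          if c is DNum 0 then run cap p2 x else run cap p1 x)
    | PWhile b p1 =>
        (fix loop (i : nat) (y : data) {struct i} : rdist outcome :=
           if i is j.+1 then
             add_time (dsize y).+1
               (andthen (run cap b y) (fun c =>
                  if c is DNum 0 then out y
                  else andthen (run cap p1 y) (loop j)))
           else Ret None) cap x
    end.

(** Output of [p] on [x] if it halts within time [t], and [None] otherwise.
    Every guard evaluation costs more than one unit of time, so the loop cap
    [t] never cuts off a run that halts within time [t]. *)
Definition exec (t : nat) (p : prog) (x : data) : rdist (option data) :=
  dmap (obind (fun r => if (r.2 <= t)%N then Some r.1 else None)) (run t p x).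

Definition elist (s : seq data) : data := foldr DPair (DNum 0) s.

(** Lists of points of ['I_n] as lists of numbers. *)
Fixpoint dec_points (n : nat) (y : data) : option (seq 'I_n) :=
  match y with
  | DNum 0 => Some [::]
  | DPair (DNum i) y' =>
      if insub i is Some x then omap (cons x) (dec_points n y') else None
  | _ => None
  end.

(** Minimum of [f] over a nonempty list ([0] on the empty list). *)
Definition minover (R : realType) (I : Type) (s : seq I) (f : I -> R) : R :=
  if s is a :: s' then \big[Num.min/f a]_(b <- s') f b else 0.

Definition is_metric (R : realType) (n : nat) (d : 'I_n -> 'I_n -> R) : Prop :=
  [/\ forall x y, 0 <= d x y,
      forall x y, d x y = 0 <-> x = y,
      forall x y, d x y = d y x &
      forall x y z, d x z <= d x y + d y z].

Definition fracdist (R : realType) (n : nat) (D : 'M[nat]_n) (q : nat)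
    (x y : 'I_n) : R := (D x y)%:R / q%:R.

(** A rational metric on ['I_n], represented by its matrix of distances over
    a common denominator. *)
Record metric (R : realType) (n : nat) : Type := Metric {
  mnum : 'M[nat]_n;
  mden : nat;
  mden_gt0 : (0 < mden)%N;
  metricP : is_metric (fracdist R mnum mden)
}.

Definition mdist (R : realType) (n : nat) (X : metric R n) : 'I_n -> 'I_n -> R :=
  fracdist R (mnum X) (mden X).

Definition enc_metric (R : realType) (n : nat) (X : metric R n) : data :=
  DPair (DNum (mden X))
    (elist [seq elist [seq DNum (mnum X x y) | y <- enum 'I_n]
           | x <- enum 'I_n]).

Definition config (n k : nat) : Type := k.-tuple 'I_n.

Definition config_dist (R : realType) (n k : nat) (X : metric R n)
    (C1 C2 : config n k) : R :=
  minover (enum 'S_k) (fun s =>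
    \sum_(i < k) mdist X (tnth C1 i) (tnth C2 (s i))).

Definition loss (R : realType) (n k : nat) (X : metric R n)
    (x : 'I_n) (C : config n k) : R :=
  2 * minover C (fun y => mdist X y x).

Definition online_cost (R : realType) (n k : nat) (X : metric R n)
    (xs : seq 'I_n) (Cs : seq (config n k)) : R :=
  \sum_(r <- zip xs Cs) loss X r.1 r.2 +
  \sum_(r <- zip (behead Cs) Cs) config_dist X r.1 r.2.

Definition offline_opt (R : realType) (n k : nat) (X : metric R n)
    (xs : seq 'I_n) : R :=
  minover (enum {: k.-tuple 'I_n}) (fun C => \sum_(x <- xs) loss X x C).

Definition dec_config (n k : nat) (y : data) : option (config n k) :=
  obind insub (dec_points n y).

(** An online algorithm is a program turning (memory, request) into
    (new memory, configuration).  [play tau A m xs] serves the requests [xs]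
    from memory [m], allowing time [tau] for each step; it yields [None] if a
    step exceeds its time or does not output a configuration. *)
Fixpoint play (n k tau : nat) (A : prog) (m : data) (xs : seq 'I_n) :
    rdist (option (seq (config n k))) :=
  if xs is x :: xs' then
    dbind (exec tau A (DPair m (DNum x))) (fun o =>
      if o is Some (DPair m' y) then
        if dec_config n k y is Some C then
          dmap (omap (cons C)) (play k tau A m' xs')
        else Ret None
      else Ret None)
  else Ret (Some [::]).

(** The memory before the first step: the whole instance, including the
    horizon, but no request. *)
Definition server_input (R : realType) (n k T : nat) (X : metric R n) : data :=
  DPair (DNum n) (DPair (DNum k) (DPair (DNum T) (enc_metric X))).

Definition server_run (R : realType) (A : prog) (p : {poly nat})
    (n k T : nat) (X : metric R n) (xs : seq 'I_n) :
    rdist (option (seq (config n k))) :=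
  play k p.[(n + T + dsize (enc_metric X))%N] A (server_input k T X) xs.

Definition server_instance (R : realType) (n k T : nat) (X : metric R n) : Prop :=
  [/\ (0 < k <= n)%N, (0 < T)%N & forall x y, mdist X x y <= 1].

(** Worst case over the coin flips. A polynomial in the sum of the three
    parameters is as general a bound as a polynomial in the parameters. *)
Definition efficient_online (R : realType) (A : prog) (p : {poly nat}) : Prop :=
  forall (n k T : nat) (X : metric R n) (xs : T.-tuple 'I_n),
    server_instance k T X -> always isSome (server_run A p k T X xs).

Definition has_regret (R : realType) (A : prog) (p : {poly nat})
    (r : nat -> nat -> R) : Prop :=
  forall (n k T : nat) (X : metric R n) (xs : T.-tuple 'I_n),
    server_instance k T X ->
    expect (fun o => if o is Some Cs then online_cost X xs Cs else 0)
           (server_run A p k T X xs)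
      <= offline_opt k X xs + r n T.

Definition median_cost (R : realType) (n : nat) (X : metric R n)
    (A : {set 'I_n}) : R :=
  \sum_(x : 'I_n) minover (enum A) (fun a => mdist X x a).

Definition median_opt (R : realType) (n k : nat) (X : metric R n) : R :=
  minover (enum [set A : {set 'I_n} | #|A| == k]) (median_cost X).

Definition median_input (R : realType) (n k : nat) (X : metric R n) : data :=
  DPair (DNum n) (DPair (DNum k) (enc_metric X)).

(** The set of [k] points output by a k-median algorithm, as a list in any
    order; [None] if the output is not of this form. *)
Definition median_output (n k : nat) (o : option data) : option {set 'I_n} :=
  if obind (dec_points n) o is Some s then
    let A := [set x in s] in if #|A| == k then Some A else None
  else None.

Definition median_run (R : realType) (B : prog) (p : {poly nat})
    (n k : nat) (X : metric R n) : rdist (option {set 'I_n}) :=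
  let x := median_input k X in
  dmap (median_output n k) (exec p.[dsize x] B x).

Definition polytime_median (R : realType) (B : prog) (p : {poly nat}) : Prop :=
  forall (n k : nat) (X : metric R n), (0 < k <= n)%N ->
    always isSome (median_run B p k X).

(** The k-median algorithm is allowed coin flips, hence an error probability
    [delta], because the online algorithm is randomized and its guarantee
    holds only in expectation. *)
Definition achieves_approx (R : realType) (B : prog) (p : {poly nat})
    (rho delta : R) : Prop :=
  forall (n k : nat) (X : metric R n), (0 < k <= n)%N ->
    1 - delta <=
    prob R (fun o => if o is Some A then median_cost X A <= rho * median_opt k X
                     else false)
         (median_run B p k X).

(* Main.v *)
(** Feed the online algorithm independent random requests, nearly uniform on the points.  The
    configuration held before a request is independent of it, and by the triangle inequality
    serving a request [x] and moving cost at least [d(x, C)], where [C] is the previous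
    configuration (this is what the factor 2 in the loss is for).  Hence the average k-median
    cost of the configurations visited is at most twice the optimum, up to the regret divided by
    the horizon, and the best configuration visited is good with probability bounded below.

    The regret is negligible only if the optimum is not tiny compared with the diameter.  So
    the metric is first truncated at a level [L] of order [n * d], where [d] is the largest
    distance from a point to the optimal medians: the optimum lies between [d] and [n * d], so
    it is unchanged, while solutions of cost below [L] cost the same in both metrics.  As [d] is
    unknown, all pairs of points are tried, a constant number of times each, and the cheapest
    configuration seen, padded to exactly [k] points, is returned.

    Uniform samples are drawn modulo [n] from [n + kappa] random bits, so every point has the
    right probability up to a factor [1 + 1 / kappa].

    The programs themselves are never written down: polynomial-time computability of functions
    of an environment is closed under pairing, arithmetic, branching and bounded loops, so
    that a program is obtained by composing closure lemmas. *)

Require Import Defs.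
From mathcomp Require Import all_boot all_order all_algebra perm.
From mathcomp Require Import reals exp.
From mathcomp Require Import zify ring lra.

Set Implicit Arguments.
Unset Strict Implicit.
Unset Printing Implicit Defensive.

Import Order.TTheory GRing.Theory Num.Theory.

(** * Trees of outcomes and runs of programs *)

(** The horizon must be polynomial in [n], which limits how small the optimum may be. With level
    [L = c n d], the optimum rescaled to diameter one is at least [1 / (c n)], that is
    [1 / (c n ^ 2)] per request. A regret [alpha n ^ beta T ^ (1 - mu)] is thus negligible once
    [T ^ mu] exceeds a constant times [n ^ (beta + 2)]. The constant [c >= 2 + eps] makes any
    solution that leaves a point farther than [L] still look bad after truncation.

    If all configurations visited are bad, each step costs about [2 + eps] times the optimum,
    against an expected factor of about [2]. By Markov's inequality a trial at the right level fails
    with probability at most [eta = (2 + eps / 2) / (2 + eps)], and [m] such trials all fail with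
    probability at most [eta ^ m <= delta].

    As a subroutine, the online program is known to be fast only on memories reached in legal plays,
    so loop invariants must record that the play can go on. Every guess of the level yields a legal
    instance, hence a wrong guess cannot break the time bound. *)

Section Trees.
Variables A B C : Type.

Lemma dbindA (m : rdist A) (f : A -> rdist B) (g : B -> rdist C) :
  dbind (dbind m f) g = dbind m (fun a => dbind (f a) g).
Proof. by elim: m => [a|m0 IH0 m1 IH1] //=; rewrite IH0 IH1. Qed.

Lemma dmap_dbind (m : rdist A) (f : A -> rdist B) (g : B -> C) :
  dmap g (dbind m f) = dbind m (fun a => dmap g (f a)).
Proof. exact: dbindA. Qed.

Lemma dmap_comp (m : rdist A) (f : A -> B) (g : B -> C) :
  dmap g (dmap f m) = dmap (fun a => g (f a)) m.
Proof. exact: dbindA. Qed.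

Lemma always_true (P : A -> Prop) (m : rdist A) : (forall a, P a) -> always P m.
Proof. by move=> HP; elim: m => [a|m0 IH0 m1 IH1] /=. Qed.

Lemma always_imp (P Q : A -> Prop) (m : rdist A) :
  always P m -> (forall a, P a -> Q a) -> always Q m.
Proof.
move=> HP HPQ; elim: m HP => [a|m0 IH0 m1 IH1] /=; first exact: HPQ.
by case=> /IH0 ? /IH1 ?.
Qed.

Lemma always_and (P Q : A -> Prop) (m : rdist A) :
  always P m -> always Q m -> always (fun a => P a /\ Q a) m.
Proof. by elim: m => [a|m0 IH0 m1 IH1] //= [? ?] [? ?]; split; auto. Qed.

Lemma always_dbind (Q : B -> Prop) (m : rdist A) (f : A -> rdist B) :
  always Q (dbind m f) <-> always (fun a => always Q (f a)) m.
Proof.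
elim: m => [a|m0 IH0 m1 IH1] //=.
by split=> -[/IH0 ? /IH1 ?].
Qed.

Lemma always_dmap (Q : B -> Prop) (m : rdist A) (f : A -> B) :
  always Q (dmap f m) <-> always (fun a => Q (f a)) m.
Proof. exact: always_dbind. Qed.

Lemma eq_dbind_in (P : A -> Prop) (m : rdist A) (f g : A -> rdist B) :
  always P m -> (forall a, P a -> f a = g a) -> dbind m f = dbind m g.
Proof.
move=> + fg; elim: m => [a|m0 IH0 m1 IH1] /=; first exact: fg.
by case=> /IH0 -> /IH1 ->.
Qed.

Lemma eq_dbind (m : rdist A) (f g : A -> rdist B) :
  (forall a, f a = g a) -> dbind m f = dbind m g.
Proof. by move=> fg; apply: (@eq_dbind_in xpredT) => //; apply: always_true. Qed.

Fixpoint foldD (F : A -> B -> rdist A) (s : A) (l : seq B) : rdist A :=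
  if l is v :: l' then dbind (F s v) (fun s' => foldD F s' l') else Ret s.

End Trees.

Lemma dmap_id (A : Type) (m : rdist A) : dmap id m = m.
Proof. by elim: m => [a|m0 IH0 m1 IH1] //=; rewrite {1}/dmap /= -!/(dmap _ _) IH0 IH1. Qed.

Lemma foldD_Ret (A B : Type) (f : A -> B -> A) (F : A -> B -> rdist A) s l :
  (forall s v, F s v = Ret (f s v)) -> foldD F s l = Ret (foldl f s l).
Proof. by move=> FE; elim: l s => [|v l IHl] s //=; rewrite FE /= IHl. Qed.

(** The invariant sees the items still to come, so that it can express progress and the validity of
    later items. *)
Lemma foldD_always (A B : Type) (Inv : seq B -> A -> Prop) (F : A -> B -> rdist A)
    (s : A) (l : seq B) :
  (forall v r s, Inv (v :: r) s -> always (Inv r) (F s v)) ->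
  Inv l s -> always (Inv [::]) (foldD F s l).
Proof.
move=> HF; elim: l s => [|v l IHl] s //= Hs.
by apply/always_dbind; apply: always_imp (HF _ _ _ Hs) _ => s'; apply: IHl.
Qed.

(* [r] is the tree [m], every leaf being reached within time [c]. *)
Fixpoint rmatch (c : nat) (r : rdist outcome) (m : rdist data) : Prop :=
  match r, m with
  | Ret (Some (y, c')), Ret z => y = z /\ c' <= c
  | Flip r0 r1, Flip m0 m1 => rmatch c r0 m0 /\ rmatch c r1 m1
  | _, _ => False
  end.

Lemma rmatch_le c c' r m : c <= c' -> rmatch c r m -> rmatch c' r m.
Proof.
move=> cc'; elim: r m => [[[y d]|]|r0 IH0 r1 IH1] [z|m0 m1] //=.
  by case=> -> /leq_trans; split=> //; auto.
by case=> ? ?; split; auto.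
Qed.

Lemma rmatch_add d c r m : rmatch c r m -> rmatch (d + c) (add_time d r) m.
Proof.
elim: r m => [[[y e]|]|r0 IH0 r1 IH1] [z|m0 m1] //=.
  by case=> -> ?; rewrite leq_add2l.
by case=> /IH0 ? /IH1 ?.
Qed.

(** The tree ranges over abstract values encoded by [e], so that [P] and the continuation [g] speak
    of values rather than of their codes. *)
Lemma rmatch_andthen (S : Type) (P : S -> Prop) (e : S -> data) c1 c2 r m f g :
  rmatch c1 r (dmap e m) -> always P m ->
  (forall s, P s -> rmatch c2 (f (e s)) (g s)) ->
  rmatch (c1 + c2) (andthen r f) (dbind m g).
Proof.
move=> + + Hf; elim: r m => [[[y d]|]|r0 IH0 r1 IH1] [z|m0 m1] //=.
  case=> -> ec Pz; apply: (@rmatch_le (d + c2)); first by rewrite leq_add2r.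
  exact/rmatch_add/Hf.
by case=> /IH0 h0 /IH1 h1 [/h0 ? /h1 ?].
Qed.

Lemma rmatch_andthen1 c1 c2 r y f m :
  rmatch c1 r (Ret y) -> rmatch c2 (f y) m -> rmatch (c1 + c2) (andthen r f) m.
Proof.
move=> hr hf; rewrite -[m]/(dbind (Ret tt) (fun=> m)).
exact: (@rmatch_andthen unit xpredT (fun=> y)).
Qed.

(** Names the anonymous loop inside [run]; its counter [i] is separate from the cap of the
    subprograms, which stays fixed during the induction on [i]. *)
Definition wloop (cap : nat) (b p1 : prog) :=
  fix loop (i : nat) (y : data) {struct i} : rdist outcome :=
    if i is j.+1 then
      add_time (dsize y).+1
        (andthen (run cap b y) (fun c =>
           if c is DNum 0 then out y
           else andthen (run cap p1 y) (loop j)))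
    else Ret None.

Lemma run_while cap b p1 x :
  run cap (PWhile b p1) x = add_time (dsize x).+1 (wloop cap b p1 cap x).
Proof. by []. Qed.

(** A bound on the running time of a subprogram thereby bounds the data that it passes on, which
    spares a separate analysis of sizes. *)
Definition costly (o : outcome) : Prop := if o is Some (y, c) then dsize y <= c else True.

Lemma costly_add d m : always costly m -> always costly (add_time d m).
Proof.
move=> H; apply/always_dmap; apply: always_imp H _ => -[[y c]|] //=; lia.
Qed.

Lemma costly_andthen m f :
  (forall y, always costly (f y)) -> always costly (andthen m f).
Proof.
move=> H; apply/always_dbind; apply: always_true => -[[y c]|] //.
exact: costly_add.
Qed.

Lemma run_costly cap p x : always costly (run cap p x).
Proof.
elim: p x => [|n||||o||p1 IH1 p2 IH2|p1 IH1 p2 IH2|b IHb p1 IH1 p2 IH2|b IHb p IHp] x;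
  try exact: leq_addl.
- by split; exact: leq_addl.
- apply: costly_add; apply: costly_andthen => y; apply: costly_andthen => z.
  exact: leqnn.
- by apply: costly_add; apply: costly_andthen.
- by apply: costly_add; apply: costly_andthen => -[[|c]|c1 c2].
- rewrite run_while; apply: costly_add; move: {2}cap => i.
  elim: i x => [|i IHi] x; first exact: I.
  apply: costly_add; apply: costly_andthen.
  case=> [[|c]|c1 c2]; [exact: leqnn|by apply: costly_andthen..].
Qed.

Lemma rmatch_costly c r m :
  rmatch c r m -> always costly r -> always (fun y => dsize y <= c) m.
Proof.
elim: r m => [[[y d]|]|r0 IH0 r1 IH1] [z|m0 m1] //=.
  by case=> -> dc /leq_trans; apply.
by case=> /IH0 h0 /IH1 h1 [/h0 ? /h1 ?].
Qed.

(* [None] lies below every tree: a run cut off by a small cap may go on under a larger one. *)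
Fixpoint tree_le (r r' : rdist outcome) : Prop :=
  match r, r' with
  | Ret None, _ => True
  | Ret (Some o), Ret (Some o') => o = o'
  | Flip r0 r1, Flip r0' r1' => tree_le r0 r0' /\ tree_le r1 r1'
  | _, _ => False
  end.

Lemma tree_le_refl r : tree_le r r.
Proof. by elim: r => [[o|]|r0 IH0 r1 IH1] /=. Qed.

Lemma tree_le_add d r r' : tree_le r r' -> tree_le (add_time d r) (add_time d r').
Proof.
elim: r r' => [[o|]|r0 IH0 r1 IH1] [[o'|]|r0' r1'] //=; first by move=> ->.
by case=> /IH0 ? /IH1 ?.
Qed.

Lemma tree_le_andthen r r' f f' : tree_le r r' ->
  (forall y, tree_le (f y) (f' y)) -> tree_le (andthen r f) (andthen r' f').
Proof.
move=> + ff'; elim: r r' => [[[y c]|]|r0 IH0 r1 IH1] [[o'|]|r0' r1'] //=.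
  by move=> <-; apply: tree_le_add.
by case=> /IH0 ? /IH1 ?.
Qed.

Lemma run_mono cap cap' p x : cap <= cap' -> tree_le (run cap p x) (run cap' p x).
Proof.
move=> cc'.
elim: p x => [|n||||o||p1 IH1 p2 IH2|p1 IH1 p2 IH2|b IHb p1 IH1 p2 IH2|b IHb p IHp] x;
  try exact: tree_le_refl.
- apply: tree_le_add; apply: tree_le_andthen => // y.
  by apply: tree_le_andthen => // z; exact: tree_le_refl.
- by apply: tree_le_add; apply: tree_le_andthen.
- by apply: tree_le_add; apply: tree_le_andthen => // -[[|c]|c1 c2].
- rewrite !run_while; apply: tree_le_add.
  move: {1 3}cap {1 3}cap' cc' => i j; elim: i j x => [|i IHi] [|j] x //= ij.
  apply: tree_le_add; apply: tree_le_andthen => // -[[|c]|c1 c2].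
  + exact: tree_le_refl.
  + by apply: tree_le_andthen => // z; apply: IHi.
  + by apply: tree_le_andthen => // z; apply: IHi.
Qed.

Lemma tree_le_rmatch c r r' m : tree_le r r' -> rmatch c r m -> rmatch c r' m.
Proof.
elim: r r' m => [[[y d]|]|r0 IH0 r1 IH1] [[[y' d']|]|r0' r1'] [z|m0 m1] //=.
  by case=> <- <-.
by case=> /IH0 h0 /IH1 h1 [/h0 ? /h1 ?].
Qed.

(** The cap is quantified because a subprogram runs under the cap of the program around it, while
    its outcomes and its time must not depend on that cap. *)
Definition runs (p : prog) (x : data) (m : rdist data) (c : nat) : Prop :=
  forall cap, c <= cap -> rmatch c (run cap p x) m.

Lemma runs_le p x m c c' : c <= c' -> runs p x m c -> runs p x m c'.
Proof. by move=> cc' H cap c'cap; apply/(rmatch_le cc')/H/(leq_trans cc'). Qed.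

Lemma runs_size p x m c : runs p x m c -> always (fun y => dsize y <= c) m.
Proof. by move=> /(_ c (leqnn c)) H; apply: rmatch_costly H (run_costly _ _ _). Qed.

Lemma runs_exec t p x m : runs p x m t -> exec t p x = dmap Some m.
Proof.
move=> /(_ t (leqnn t)); rewrite /exec.
elim: (run t p x) m => [[[y d]|]|r0 IH0 r1 IH1] [z|m0 m1] //=.
  by case=> -> dt; rewrite /dmap /= dt.
by rewrite /dmap /= -!/(dmap _ _) => -[/IH0 -> /IH1 ->].
Qed.

(** The guarantee on the online algorithm has the loop cap equal to the time limit; monotonicity in
    the cap makes it usable inside a larger program. *)
Lemma exec_runs t p x : always (@isSome _) (exec t p x) ->
  runs p x (dmap (odflt (DNum 0)) (exec t p x)) t.
Proof.
move=> H cap tcap; apply: tree_le_rmatch (run_mono p x tcap) _.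
move: H; rewrite /exec dmap_comp.
elim: (run t p x) => [[[y d]|]|r0 IH0 r1 IH1] //=; first by case: ifP.
by case=> /IH0 ? /IH1 ?.
Qed.

Lemma runs_out p x y : (forall cap, run cap p x = add_time (dsize x).+1 (out y)) ->
  runs p x (Ret y) ((dsize x).+1 + dsize y).
Proof. by move=> H cap _; rewrite H; apply: rmatch_add. Qed.

Lemma runs_coin x :
  runs PCoin x (dmap DNum (Flip (Ret 0) (Ret 1))) ((dsize x).+1 + 1).
Proof.
move=> cap _; apply: rmatch_add; split; split=> //.
Qed.

(** Only the first component may be random. The summand [(c1 + c2).+1] bounds the size of the pair,
    each component being no larger than its running time. *)
Lemma runs_pair (S : Type) (e : S -> data) p1 p2 x m z c1 c2 :
  runs p1 x (dmap e m) c1 -> runs p2 x (Ret z) c2 ->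
  runs (PPair p1 p2) x (dmap (fun s => DPair (e s) z) m)
    ((dsize x).+1 + (c1 + (c2 + (c1 + c2).+1))).
Proof.
move=> H1 H2 cap lecap; apply: rmatch_add.
have sz1 := proj1 (always_dmap _ _ _) (runs_size H1); have /= sz2 := runs_size H2.
apply: (@rmatch_andthen _ _ e _ _ _ m _ _ _ sz1) => [|s szs]; first by apply: H1; lia.
apply: rmatch_andthen1; first by apply: H2; lia.
by split=> //; rewrite /= ltnS leq_add.
Qed.

Lemma runs_seq (S : Type) (P : S -> Prop) (e : S -> data) p1 p2 x m f c1 c2 :
  runs p1 x (dmap e m) c1 -> always P m -> (forall s, P s -> runs p2 (e s) (f s) c2) ->
  runs (PSeq p1 p2) x (dbind m f) ((dsize x).+1 + (c1 + c2)).
Proof.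
move=> H1 HP H2 cap lecap; apply: rmatch_add.
apply: (@rmatch_andthen _ P e) => //; first by apply: H1; lia.
by move=> s /H2; apply; lia.
Qed.

Lemma runs_if b p1 p2 x (t : nat) m1 m2 c0 c :
  runs b x (Ret (DNum t)) c0 ->
  (t != 0 -> runs p1 x m1 c) -> (t = 0 -> runs p2 x m2 c) ->
  runs (PIf b p1 p2) x (if t == 0 then m2 else m1) ((dsize x).+1 + (c0 + c)).
Proof.
move=> H0 H1 H2 cap lecap; apply: rmatch_add.
apply: rmatch_andthen1; first by apply: H0; lia.
case: t {H0} H1 H2 => [|t] /= H1 H2; first by apply: H2 => //; lia.
by apply: H1 => //; lia.
Qed.

(** * Loops that process a list *)

Section While.
Variables (J S : Type) (st : seq J -> S -> data) (F : S -> J -> rdist S).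
Variables (Inv : seq J -> S -> Prop) (b p : prog) (cg cb : nat).

Hypothesis InvF : forall v r s, Inv (v :: r) s -> always (Inv r) (F s v).
Hypothesis guardT : forall v r s, Inv (v :: r) s ->
  runs b (st (v :: r) s) (Ret (DNum 1)) cg.
Hypothesis guardF : forall s, Inv [::] s -> runs b (st [::] s) (Ret (DNum 0)) cg.
Hypothesis sizeS : forall r s, Inv r s -> dsize (st r s) < cg.
Hypothesis body : forall v r s, Inv (v :: r) s ->
  runs p (st (v :: r) s) (dmap (st r) (F s v)) cb.

(** A round that continues pays for reading the state, the guard and the body; the third [cg] pays
    for writing the state out when the loop ends, as [cg] exceeds the size of every state. *)
Let w := cg + cg + cg + cb.

Lemma rmatch_wloop cap i r s : Inv r s -> (size r).+1 * w <= cap -> size r < i ->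
  rmatch ((size r).+1 * w) (wloop cap b p i (st r s)) (dmap (st [::]) (foldD F s r)).
Proof.
elim: i r s => [|i IHi] // [|v r] s Hs lecap ri; last first.
  apply: (@rmatch_le ((dsize (st (v :: r) s)).+1 + (cg + (cb + (size r).+1 * w)))).
    by move: (sizeS Hs); rewrite /w /=; lia.
  apply: rmatch_add.
  apply: (@rmatch_andthen1 _ _ _ (DNum 1)).
    by apply: guardT => //; move: lecap; rewrite /w /=; lia.
  rewrite [foldD _ _ _]/= dmap_dbind.
  apply: (@rmatch_andthen _ (Inv r) (st r)); last 2 first.
  - exact: InvF.
  - by move=> s' Hs'; apply: IHi => //; move: lecap; rewrite /w /=; lia.
  by apply: body => //; move: lecap; rewrite /w /=; lia.
apply: (@rmatch_le ((dsize (st [::] s)).+1 + (cg + dsize (st [::] s)))).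
  by move: (sizeS Hs); rewrite /w /=; lia.
apply: rmatch_add; apply: (@rmatch_andthen1 _ _ _ (DNum 0)); last by split.
by apply: guardF => //; move: lecap; rewrite /w /=; lia.
Qed.

Lemma runs_while r s : Inv r s ->
  runs (PWhile b p) (st r s) (dmap (st [::]) (foldD F s r)) (cg + (size r).+1 * w).
Proof.
move=> Hs cap lecap; rewrite run_while.
have szs := sizeS Hs.
apply: (@rmatch_le ((dsize (st r s)).+1 + (size r).+1 * w)); first by lia.
apply: rmatch_add; apply: rmatch_wloop => //; first by lia.
have : 0 < w by rewrite /w; lia.
nia.
Qed.

End While.

(* Powers of [sz i + 2] suffice: a constant [n] is at most [2 ^ n]. *)
Definition pbd (I : Type) (sz : I -> nat) (D : I -> Prop) (f : I -> nat) : Prop :=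
  exists e, forall i, D i -> f i <= (sz i).+2 ^ e.

(* The program is the same for all instances [i]; [env i] holds the values that it may read. *)
Definition ptime (I : Type) (sz : I -> nat) (D : I -> Prop) (env : I -> data)
    (m : I -> rdist data) : Prop :=
  exists p c, pbd sz D c /\ forall i, D i -> runs p (env i) (m i) (c i).

Section Bounds.
Variables (I : Type) (sz : I -> nat) (D : I -> Prop).
Implicit Types f g : I -> nat.

Lemma pbd_le f g : pbd sz D g -> (forall i, D i -> f i <= g i) -> pbd sz D f.
Proof. by case=> e He H; exists e => i Di; apply: leq_trans (H i Di) (He i Di). Qed.

Lemma pbd_cst n : pbd sz D (fun=> n).
Proof.
exists n => i _; apply: leq_trans (ltnW (ltn_expl n (isT : 1 < 2))) _.
by case: n => [|n] //; rewrite leq_exp2r.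
Qed.

Lemma pbd_sz : pbd sz D sz.
Proof. by exists 1 => i _; rewrite expn1; lia. Qed.

Lemma pbdM f g : pbd sz D f -> pbd sz D g -> pbd sz D (fun i => f i * g i).
Proof.
case=> a Ha [b Hb]; exists (a + b) => i Di.
by rewrite expnD; apply: leq_mul; [apply: Ha|apply: Hb].
Qed.

Lemma pbdD f g : pbd sz D f -> pbd sz D g -> pbd sz D (fun i => f i + g i).
Proof.
case=> a Ha [b Hb]; exists (a + b).+1 => i Di.
have := Ha i Di; have := Hb i Di; rewrite expnS expnD.
have : 0 < (sz i).+2 ^ a by rewrite expn_gt0.
have : 0 < (sz i).+2 ^ b by rewrite expn_gt0.
move: ((sz i).+2 ^ a) ((sz i).+2 ^ b) => x y; nia.
Qed.

Lemma pbdS f : pbd sz D f -> pbd sz D (fun i => (f i).+1).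
Proof. by move=> Hf; apply: pbd_le (pbdD (pbd_cst 1) Hf) _. Qed.

Lemma pbdX f k : pbd sz D f -> pbd sz D (fun i => f i ^ k).
Proof.
move=> Hf; elim: k => [|k IHk]; first exact: pbd_cst.
by apply: pbd_le (pbdM Hf IHk) _ => i _; rewrite expnS.
Qed.

Lemma pbd_horner (p : {poly nat}) f : pbd sz D f -> pbd sz D (fun i => (p.[f i])%R).
Proof.
move=> Hf; elim/poly_ind: p => [|p c IHp].
  by apply: pbd_le (pbd_cst 0) _ => i _; rewrite horner0.
apply: pbd_le (pbdD (pbdM IHp Hf) (pbd_cst c)) _ => i _.
by rewrite hornerMXaddC.
Qed.

End Bounds.

Lemma pbd_lift (I I' : Type) sz (D : I -> Prop) (D' : I' -> Prop) (h : I' -> I) f :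
  pbd sz D f -> (forall i, D' i -> D (h i)) ->
  pbd (fun i => sz (h i)) D' (fun i => f (h i)).
Proof. by case=> e He HD; exists e => i /HD; apply: He. Qed.

Lemma pbd_sub (I : Type) sz (D D' : I -> Prop) f :
  pbd sz D f -> (forall i, D' i -> D i) -> pbd sz D' f.
Proof. by case=> e He HD; exists e => i /HD; apply: He. Qed.

Lemma log_pbd (B x : nat) : trunc_log 2 x < B -> x < 2 ^ B.
Proof. by move=> H; apply: leq_trans (trunc_log_ltn x (isT : 1 < 2)) _; rewrite leq_exp2l. Qed.

Lemma trunc_log_lt2 (B x : nat) : x < 2 ^ B -> trunc_log 2 x <= B.
Proof.
case: x => [|x]; first by rewrite trunc_log0.
move=> H; rewrite -(leq_exp2l _ _ (isT : 1 < 2)).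
exact: leq_trans (trunc_logP _ _) (ltnW H).
Qed.

(** * Polynomial-time computability in an environment *)

Notation dptime sz D env f := (ptime sz D env (fun i => Ret (f i))).
Notation bounded sz D x := (pbd sz D (fun i => dsize (x i))).

Section CompBase.
Variables (I : Type) (sz : I -> nat) (D : I -> Prop).
Implicit Types (env f g : I -> data) (m : I -> rdist data).

Lemma eq_ptime env m m' : (forall i, D i -> m i = m' i) ->
  ptime sz D env m -> ptime sz D env m'.
Proof.
by move=> E [p [c [cb H]]]; exists p, c; split=> // i Di; rewrite -E //; apply: H.
Qed.

Lemma ptime_bounded (S : Type) (e : I -> S -> data) env (m : I -> rdist S) :
  ptime sz D env (fun i => dmap (e i) (m i)) ->
  exists2 B, pbd sz D B & forall i, D i -> always (fun s => dsize (e i s) <= B i) (m i).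
Proof.
case=> p [c [cb H]]; exists c => // i Di.
exact: (proj1 (always_dmap _ _ _) (runs_size (H i Di))).
Qed.

Lemma dptime_bounded env f : dptime sz D env f -> bounded sz D f.
Proof.
case/(@ptime_bounded unit (fun i _ => f i) _ (fun=> Ret tt)) => B HB H.
exact: pbd_le HB H.
Qed.

(** The continuation is a computation over enlarged instances [(i, s)], still measured by [i] alone:
    a random intermediate value becomes a parameter, and the polynomial bound is uniform in it. *)
Lemma ptime_seq (S : Type) (P : I -> S -> Prop) (e : I -> S -> data) env
    (m : I -> rdist S) (F : I -> S -> rdist data) :
  ptime sz D env (fun i => dmap (e i) (m i)) ->
  bounded sz D env ->
  (forall i, D i -> always (P i) (m i)) ->
  ptime (fun x : I * S => sz x.1) (fun x => D x.1 /\ P x.1 x.2)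
    (fun x => e x.1 x.2) (fun x => F x.1 x.2) ->
  ptime sz D env (fun i => dbind (m i) (F i)).
Proof.
case=> p1 [c1 [c1b H1]] envb HP [p2 [c2 [[k c2b] H2]]].
exists (PSeq p1 p2), (fun i => (dsize (env i)).+1 + (c1 i + (sz i).+2 ^ k)); split.
  by apply: pbdD (pbdS envb) (pbdD c1b _); exists k.
move=> i Di; apply: (runs_seq (H1 i Di) (HP i Di)) => s Ps.
exact: runs_le (c2b (i, s) (conj Di Ps)) (H2 (i, s) (conj Di Ps)).
Qed.

Lemma ptime_reindex (I' : Type) (h : I' -> I) (D' : I' -> Prop) env m :
  (forall i', D' i' -> D (h i')) -> ptime sz D env m ->
  ptime (fun i' => sz (h i')) D' (fun i' => env (h i')) (fun i' => m (h i')).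
Proof.
move=> HD [p [c [cb H]]]; exists p, (fun i' => c (h i')); split.
  exact: (pbd_lift cb HD).
by move=> i' /HD; apply: H.
Qed.

(** Changes the environment: a computation known to be efficient in [f] is efficient in any
    environment from which [f] can be computed. *)
Lemma ptime_dseq env f m :
  dptime sz D env f -> bounded sz D env -> ptime sz D f m -> ptime sz D env m.
Proof.
move=> Hf envb Hm.
apply: (@ptime_seq unit (fun _ _ => True) (fun i _ => f i) _ (fun=> Ret tt) (fun i _ => m i)) => //.
by apply: (ptime_reindex (h := fst) _ Hm) => -[i []] [].
Qed.

Lemma ptime_out p env f :
  (forall i cap, run cap p (env i) = add_time (dsize (env i)).+1 (out (f i))) ->
  bounded sz D env -> bounded sz D f -> dptime sz D env f.
Proof.
move=> E envb fb; exists p, (fun i => (dsize (env i)).+1 + dsize (f i)); split.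
  by apply: pbdD => //; apply: pbdS.
by move=> i _; apply: runs_out.
Qed.

Lemma ptime_id env : bounded sz D env -> dptime sz D env env.
Proof. by move=> envb; apply: (@ptime_out PId). Qed.

Lemma ptime_cst env n : bounded sz D env -> dptime sz D env (fun=> DNum n).
Proof. by move=> envb; apply: (@ptime_out (PConst n)) => //; apply: pbd_cst. Qed.

Lemma ptime_coin env : bounded sz D env ->
  ptime sz D env (fun=> dmap DNum (Flip (Ret 0) (Ret 1))).
Proof.
move=> envb; exists PCoin, (fun i => (dsize (env i)).+1 + 1); split.
  by apply: pbdD (pbd_cst _ _ _); apply: pbdS.
by move=> i _; apply: runs_coin.
Qed.

Lemma ptime_pairr (S : Type) (e : I -> S -> data) env (m : I -> rdist S) g :
  ptime sz D env (fun i => dmap (e i) (m i)) -> bounded sz D env -> dptime sz D env g ->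
  ptime sz D env (fun i => dmap (fun s => DPair (e i s) (g i)) (m i)).
Proof.
case=> p1 [c1 [c1b H1]] envb [p2 [c2 [c2b H2]]].
exists (PPair p1 p2).
exists (fun i => (dsize (env i)).+1 + (c1 i + (c2 i + (c1 i + c2 i).+1))); split.
  by apply: pbdD (pbdS envb) (pbdD c1b (pbdD c2b (pbdS (pbdD c1b c2b)))).
by move=> i Di; apply: runs_pair (H1 i Di) (H2 i Di).
Qed.

Lemma ptime_pair env f g : bounded sz D env ->
  dptime sz D env f -> dptime sz D env g -> dptime sz D env (fun i => DPair (f i) (g i)).
Proof.
move=> envb Hf Hg.
exact: (@ptime_pairr unit (fun i _ => f i) _ (fun=> Ret tt)).
Qed.

Lemma ptime_dfst env f : bounded sz D env ->
  dptime sz D env f -> dptime sz D env (fun i => if f i is DPair a _ then a else DNum 0).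
Proof.
move=> envb H; apply: (ptime_dseq H envb).
have Hb := dptime_bounded H.
apply: (@ptime_out PFst) => //.
by apply: pbd_le (pbdS Hb) _ => i _; case: (f i) => [n|a b] //=; lia.
Qed.

Lemma ptime_dsnd env f : bounded sz D env ->
  dptime sz D env f -> dptime sz D env (fun i => if f i is DPair _ b then b else DNum 0).
Proof.
move=> envb H; apply: (ptime_dseq H envb).
have Hb := dptime_bounded H.
apply: (@ptime_out PSnd) => //.
by apply: pbd_le (pbdS Hb) _ => i _; case: (f i) => [n|a b] //=; lia.
Qed.

Lemma ptime_fst env f g : bounded sz D env ->
  dptime sz D env (fun i => DPair (f i) (g i)) -> dptime sz D env f.
Proof. by move=> envb /(ptime_dfst envb). Qed.

Lemma ptime_snd env f g : bounded sz D env ->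
  dptime sz D env (fun i => DPair (f i) (g i)) -> dptime sz D env g.
Proof. by move=> envb /(ptime_dsnd envb). Qed.

Lemma ptime_isnum env f : bounded sz D env -> dptime sz D env f ->
  dptime sz D env (fun i => DNum (if f i is DNum _ then 1 else 0)).
Proof.
move=> envb H; apply: (ptime_dseq H envb).
have Hb := dptime_bounded H.
apply: (@ptime_out PIsNum) => //; first by move=> i cap /=; case: (f i).
by apply: pbd_le (pbd_cst _ _ 1) _ => i _; case: (f i).
Qed.

Lemma ptime_arith (o : arith) env (a b : I -> nat) : bounded sz D env ->
  dptime sz D env (fun i => DNum (a i)) -> dptime sz D env (fun i => DNum (b i)) ->
  dptime sz D env (fun i => DNum (arith_op o (a i) (b i))).
Proof.
move=> envb Ha Hb; have H := ptime_pair envb Ha Hb.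
apply: (ptime_dseq H envb).
have Bab := dptime_bounded H.
apply: (@ptime_out (PArith o)) => //.
apply: pbd_le (pbdS (pbdD (pbdD Bab Bab) (pbd_cst _ _ 1))) _ => i _ /=.
rewrite ltnS; apply: leq_trans (trunc_log_lt2 _) (leqnn _).
set la := trunc_log 2 (a i); set lb := trunc_log 2 (b i).
have Ha' : a i < 2 ^ la.+1 by apply: trunc_log_ltn.
have Hb' : b i < 2 ^ lb.+1 by apply: trunc_log_ltn.
have Ea : 0 < 2 ^ la.+1 by rewrite expn_gt0.
have Eb : 0 < 2 ^ lb.+1 by rewrite expn_gt0.
apply: (@leq_trans (2 ^ (la.+1 + lb.+1 + 1))); last by rewrite leq_exp2l //; lia.
rewrite !expnD expn1; move: (2 ^ la.+1) (2 ^ lb.+1) Ha' Hb' Ea Eb => A B Ha' Hb' Ea Eb.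
case: o => /=; [nia|nia|nia|].
have := leq_div (a i) (b i); nia.
Qed.

Lemma ptime_if env (t : I -> nat) m1 m2 : bounded sz D env ->
  dptime sz D env (fun i => DNum (t i)) ->
  ptime sz (fun i => D i /\ t i != 0) env m1 ->
  ptime sz (fun i => D i /\ t i = 0) env m2 ->
  ptime sz D env (fun i => if t i == 0 then m2 i else m1 i).
Proof.
move=> envb [p [c [cb H]]] [p1 [c1 [[k1 c1b] H1]]] [p2 [c2 [[k2 c2b] H2]]].
exists (PIf p p1 p2).
exists (fun i => (dsize (env i)).+1 + (c i + ((sz i).+2 ^ k1 + (sz i).+2 ^ k2))); split.
  by apply: pbdD (pbdS envb) (pbdD cb (pbdD _ _)); [exists k1|exists k2].
move=> i Di; apply: runs_if (H i Di) _ _ => ti.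
  by apply: runs_le (H1 i _) => //; apply: leq_trans (c1b i _) (leq_addr _ _).
by apply: runs_le (H2 i _) => //; apply: leq_trans (c2b i _) (leq_addl _ _).
Qed.

Lemma ptime_sub (D' : I -> Prop) env m : (forall i, D' i -> D i) ->
  ptime sz D env m -> ptime sz D' env m.
Proof. by move=> HD H; apply: (ptime_reindex (h := id)) H. Qed.

(** Environments are stacks, the value bound last being the left component. These lemmas read the
    top entry, which inside a fold is the pair of item and accumulator; [ptime_lift] skips it. *)
Lemma ptime_var1 env a : bounded sz D (fun i => DPair (a i) (env i)) ->
  dptime sz D (fun i => DPair (a i) (env i)) a.
Proof. by move=> b; apply: (ptime_fst (g := env)) => //; apply: ptime_id. Qed.

Lemma ptime_var2 env a a' : bounded sz D (fun i => DPair (DPair (a i) (a' i)) (env i)) ->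
  dptime sz D (fun i => DPair (DPair (a i) (a' i)) (env i)) a.
Proof. by move=> b; apply: (ptime_fst (g := a')) => //; apply: ptime_var1. Qed.

Lemma ptime_var2' env a a' : bounded sz D (fun i => DPair (DPair (a i) (a' i)) (env i)) ->
  dptime sz D (fun i => DPair (DPair (a i) (a' i)) (env i)) a'.
Proof. by move=> b; apply: (ptime_snd (f := a)) => //; apply: ptime_var1. Qed.

End CompBase.

Lemma ptime_lift (I J : Type) sz (D : I -> Prop) (D' : I * J -> Prop) env m (a : I * J -> data) :
  ptime sz D env m -> 
  bounded (fun x : I * J => sz x.1) D' (fun x => DPair (a x) (env x.1)) ->
  (forall x, D' x -> D x.1) ->
  ptime (fun x : I * J => sz x.1) D' (fun x => DPair (a x) (env x.1)) (fun x => m x.1).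
Proof.
move=> Hm b HD.
apply: (@ptime_dseq _ _ _ _ (fun x => env x.1)) => //.
  by apply: (ptime_snd (f := a)) => //; apply: ptime_id.
exact: (ptime_reindex HD Hm).
Qed.

(* [P] alone need not bound the sizes of the random values, hence the arbitrary subdomain [D'] on
   which the extended environment is bounded. *)
Lemma ptime_bind (I S : Type) (sz : I -> nat) (D : I -> Prop) (env : I -> data)
    (P : I -> S -> Prop) (e : I -> S -> data)
    (m : I -> rdist S) (F : I -> S -> rdist data) :
  ptime sz D env (fun i => dmap (e i) (m i)) ->
  bounded sz D env ->
  (forall i, D i -> always (P i) (m i)) ->
  (forall D' : I * S -> Prop, (forall x, D' x -> D x.1 /\ P x.1 x.2) ->
   let env' (x : I * S) := DPair (e x.1 x.2) (env x.1) in
   bounded (fun x => sz x.1) D' env' ->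
   ptime (fun x => sz x.1) D' env' (fun x => F x.1 x.2)) ->
  ptime sz D env (fun i => dbind (m i) (F i)).
Proof.
move=> Hm envb HP HF.
have [B Bb HB] := ptime_bounded Hm.
pose P' i s := P i s /\ dsize (e i s) <= B i.
apply: (@ptime_seq _ _ _ _ P' (fun i s => DPair (e i s) (env i))) => //.
- by apply: ptime_pairr => //; apply: ptime_id.
- by move=> i Di; apply: always_and; auto.
apply: HF => [x [Dx [Px _]]|] //.
pose D' (x : I * S) := D x.1 /\ P' x.1 x.2.
have DD : forall x, D' x -> D x.1 by move=> x [].
apply: pbd_le (pbdS (pbdD (pbd_lift Bb DD) (pbd_lift envb DD))) _.
by move=> x [_ [_ Bx]] /=; rewrite ltnS leq_add2r.
Qed.

(** * Loops and folds in polynomial time *)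

Section While.
Variables (I J S : Type) (sz : I -> nat) (D : I -> Prop).
Variables (st : I -> seq J -> S -> data) (ls : I -> seq J) (s0 : I -> S).
Variables (F : I -> S -> J -> rdist S) (Inv : I -> seq J -> S -> Prop).

Lemma ptime_while (B : I -> nat) :
  pbd sz D (fun i => size (ls i)) ->
  (forall i, D i -> Inv i (ls i) (s0 i)) ->
  (forall i v r s, D i -> Inv i (v :: r) s -> always (Inv i r) (F i s v)) ->
  pbd sz D B ->
  (forall i r s, D i -> Inv i r s -> dsize (st i r s) <= B i) ->
  dptime (fun x : I * (seq J * S) => sz x.1)
    (fun x => D x.1 /\ Inv x.1 x.2.1 x.2.2)
    (fun x => st x.1 x.2.1 x.2.2) (fun x => DNum (~~ nilp x.2.1)) ->
  ptime (fun x : I * (J * seq J * S) => sz x.1)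
    (fun x => D x.1 /\ Inv x.1 (x.2.1.1 :: x.2.1.2) x.2.2)
    (fun x => st x.1 (x.2.1.1 :: x.2.1.2) x.2.2)
    (fun x => dmap (st x.1 x.2.1.2) (F x.1 x.2.2 x.2.1.1)) ->
  ptime sz D (fun i => st i (ls i) (s0 i))
    (fun i => dmap (st i [::]) (foldD (F i) (s0 i) (ls i))).
Proof.
move=> lsb Inv0 InvF Bb HB [b [cg [[kg cgb] Hg]]] [p [cb [[kb cbb] Hp]]].
exists (PWhile b p).
pose G i := (sz i).+2 ^ kg + (B i).+1.
exists (fun i => G i + (size (ls i)).+1 * (G i + G i + G i + (sz i).+2 ^ kb)).
have Gb : pbd sz D G by apply: pbdD (pbdS Bb); exists kg.
split.
  apply: pbdD Gb (pbdM (pbdS lsb) (pbdD (pbdD (pbdD Gb Gb) Gb) _)); by exists kb.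
move=> i Di; apply: (@runs_while _ _ _ _ (Inv i)) => //.
- by move=> v r s; apply: InvF.
- move=> v r s H; apply: runs_le (Hg (i, (v :: r, s)) (conj Di H)).
  by apply: leq_trans (cgb (i, (v :: r, s)) (conj Di H)) _; apply: leq_addr.
- move=> s H; apply: runs_le (Hg (i, ([::], s)) (conj Di H)).
  by apply: leq_trans (cgb (i, ([::], s)) (conj Di H)) _; apply: leq_addr.
- by move=> r s /(HB _ _ _ Di); rewrite /G; lia.
- move=> v r s H; apply: runs_le (Hp (i, (v, r, s)) (conj Di H)).
  exact: (cbb (i, (v, r, s)) (conj Di H)).
- exact: Inv0.
Qed.

End While.

Lemma size_elist (s : seq data) : size s < dsize (elist s).
Proof. by elim: s => //= a s IHs; lia. Qed.

Lemma dsize_elist_suffix (pre s : seq data) : dsize (elist s) <= dsize (elist (pre ++ s)).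
Proof. by elim: pre => //= a pre; lia. Qed.

Lemma rev_iotaS q : rev (iota 0 q.+1) = q :: rev (iota 0 q).
Proof. by rewrite -{1}[q.+1]addn1 iotaD rev_cat add0n. Qed.

Section Folds.
Variables (I : Type) (sz : I -> nat) (D : I -> Prop) (env : I -> data).
Hypothesis envb : bounded sz D env.

(** A loop whose state holds the accumulator, the remaining list and the environment. Polynomially
    many rounds, each polynomial in its own input, could still let the accumulator grow
    exponentially; hence [Inv] must imply the bound [B] at every stage. The body may use that its
    item occurs in the list. *)
Lemma ptime_foldD (J S : Type) (g : J -> data) (h : S -> data) (ls : I -> seq J)
    (s0 : I -> S) (F : I -> S -> J -> rdist S) (Inv : I -> seq J -> S -> Prop)
    (B : I -> nat) :
  dptime sz D env (fun i => elist (map g (ls i))) ->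
  dptime sz D env (fun i => h (s0 i)) ->
  (forall i, D i -> Inv i (ls i) (s0 i)) ->
  (forall i v r s, D i -> Inv i (v :: r) s -> always (Inv i r) (F i s v)) ->
  pbd sz D B ->
  (forall i r s, D i -> Inv i r s -> dsize (h s) <= B i) ->
  (forall D' : I * (J * S) -> Prop,
    (forall x, D' x -> D x.1 /\
       exists pre r, ls x.1 = pre ++ x.2.1 :: r /\ Inv x.1 (x.2.1 :: r) x.2.2) ->
    let env' (x : I * (J * S)) := DPair (DPair (g x.2.1) (h x.2.2)) (env x.1) in
    bounded (fun x => sz x.1) D' env' ->
    ptime (fun x => sz x.1) D' env' (fun x => dmap h (F x.1 x.2.2 x.2.1))) ->
  ptime sz D env (fun i => dmap h (foldD (F i) (s0 i) (ls i))).
Proof.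
move=> Hls Hs0 Inv0 InvF Bb HB HF.
pose st i r s := DPair (h s) (DPair (elist (map g r)) (env i)).
pose Inv' i r s := Inv i r s /\ exists pre, ls i = pre ++ r.
pose B' i := (dsize (elist (map g (ls i))) + B i).+1 + dsize (env i).
have B'b : pbd sz D (fun i => (B' i).+1).
  by apply/pbdS/pbdD/envb/pbdS/pbdD/Bb; exact: dptime_bounded Hls.
have stb i r s : D i -> Inv' i r s -> dsize (st i r s) <= (B' i).+1.
  move=> Di [H [pre E]]; rewrite /B' E map_cat /=.
  have := dsize_elist_suffix (map g pre) (map g r).
  by have := HB _ _ _ Di H; lia.
have stb1 (I' : Type) (p : I' -> I) q1 q2 (D' : I' -> Prop) :
    (forall x, D' x -> D (p x) /\ Inv' (p x) (q1 x) (q2 x)) ->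
    bounded (fun x => sz (p x)) D' (fun x => st (p x) (q1 x) (q2 x)).
  move=> HD'; have Dp x : D' x -> D (p x) by case/HD'.
  by apply: pbd_le (pbd_lift B'b Dp) _ => x /HD' []; apply: stb.
have Hst : dptime sz D env (fun i => st i (ls i) (s0 i)).
  by do 2 apply: ptime_pair => //; apply: ptime_id.
apply: (ptime_dseq Hst envb).
pose P i s := Inv' i [::] s.
have InvF' i v r s : D i -> Inv' i (v :: r) s -> always (Inv' i r) (F i s v).
  move=> Di [H [pre E]]; apply: always_imp (InvF _ _ _ _ Di H) _ => s' Hs'.
  by split=> //; exists (rcons pre v); rewrite cat_rcons.
have Inv0' i : D i -> Inv' i (ls i) (s0 i).
  by move=> Di; split; [apply: Inv0|exists [::]].
apply: (@ptime_seq _ _ _ _ P (fun i => st i [::])).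
- apply: (@ptime_while _ _ _ _ _ _ _ _ _ Inv' (fun i => (B' i).+1)) => //.
  + apply: pbd_le (dptime_bounded Hls) _ => i _.
    by rewrite -(size_map g) ltnW // size_elist.
  + pose D1 (x : I * (seq J * S)) := D x.1 /\ Inv' x.1 x.2.1 x.2.2.
    have b := stb1 _ fst (fun x => x.2.1) (fun x => x.2.2) D1 (fun x => id).
    have Hid := ptime_id b.
    have H1 := ptime_fst b (ptime_snd b Hid).
    have H2 := ptime_isnum b H1.
    have C n (D2 : I * (seq J * S) -> Prop) (HD : forall x, D2 x -> D1 x) :=
      ptime_cst n (pbd_sub b HD).
    have H3 := ptime_if b H2 (C 0 _ (fun x => @proj1 _ _)) (C 1 _ (fun x => @proj1 _ _)).
    by apply: eq_ptime H3 => x _; case: (x.2.1).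
  + pose D1 (x : I * (J * seq J * S)) := D x.1 /\ Inv' x.1 (x.2.1.1 :: x.2.1.2) x.2.2.
    have b := stb1 _ fst (fun x => x.2.1.1 :: x.2.1.2) (fun x => x.2.2) D1 (fun x => id).
    have Hid := ptime_id b; have Hs := ptime_fst b Hid.
    have H1 := ptime_fst b (ptime_snd b Hid); have Henv := ptime_snd b (ptime_snd b Hid).
    have Hv := ptime_fst b H1; have Hr := ptime_snd b H1.
    have Harg := ptime_pair b (ptime_pair b Hv Hs) Henv.
    have argb := dptime_bounded Harg.
    have HD1 x : D1 x -> D x.1 /\ exists pre r, ls x.1 = pre ++ x.2.1.1 :: r /\
        Inv x.1 (x.2.1.1 :: r) x.2.2.
      by case=> Dx [Hx [pre E]]; split=> //; exists pre, x.2.1.2.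
    have HF' : ptime (fun x => sz x.1) D1
       (fun x => DPair (DPair (g x.2.1.1) (h x.2.2)) (env x.1))
       (fun x => dmap h (F x.1 x.2.2 x.2.1.1)).
      pose D2 (y : I * (J * S)) := D y.1 /\ (exists pre r, ls y.1 = pre ++ y.2.1 :: r /\
        Inv y.1 (y.2.1 :: r) y.2.2).
      have D2b : bounded (fun y : I * (J * S) => sz y.1) D2
         (fun y => DPair (DPair (g y.2.1) (h y.2.2)) (env y.1)).
        have DD2 y : D2 y -> D y.1 by case.
        apply: pbd_le (pbd_lift B'b DD2) _ => y [Dy [pre [r [E Hy]]]] /=.
        rewrite ltnS leq_add2r ltnS; apply: leq_add (HB _ _ _ Dy Hy).
        rewrite E; have := dsize_elist_suffix (map g pre) (map g (y.2.1 :: r)).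
        by rewrite -map_cat /=; lia.
      exact: (ptime_reindex (h := fun x => (x.1, (x.2.1.1, x.2.2))) HD1 (HF D2 (fun y => id) D2b)).
    by apply: ptime_pairr => //; [apply: ptime_dseq HF'|apply: ptime_pair].
- exact: dptime_bounded Hst.
- move=> i Di; exact: foldD_always (fun v r s => InvF' i v r s Di) (Inv0' i Di).
- apply: (ptime_fst (g := fun x => DPair (DNum 0) (env x.1))).
    by apply: (stb1 _ fst (fun=> [::]) snd) => x [].
  by apply: ptime_id; apply: (stb1 _ fst (fun=> [::]) snd) => x [].
Qed.

Lemma ptime_foldl (J S : Type) (g : J -> data) (h : S -> data) (ls : I -> seq J)
    (s0 : I -> S) (f : I -> S -> J -> S) (Inv : I -> seq J -> S -> Prop)
    (B : I -> nat) :
  dptime sz D env (fun i => elist (map g (ls i))) ->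
  dptime sz D env (fun i => h (s0 i)) ->
  (forall i, D i -> Inv i (ls i) (s0 i)) ->
  (forall i v r s, D i -> Inv i (v :: r) s -> Inv i r (f i s v)) ->
  pbd sz D B ->
  (forall i r s, D i -> Inv i r s -> dsize (h s) <= B i) ->
  (forall D' : I * (J * S) -> Prop,
    (forall x, D' x -> D x.1 /\
       exists pre r, ls x.1 = pre ++ x.2.1 :: r /\ Inv x.1 (x.2.1 :: r) x.2.2) ->
    let env' (x : I * (J * S)) := DPair (DPair (g x.2.1) (h x.2.2)) (env x.1) in
    bounded (fun x => sz x.1) D' env' ->
    dptime (fun x => sz x.1) D' env' (fun x => h (f x.1 x.2.2 x.2.1))) ->
  dptime sz D env (fun i => h (foldl (f i) (s0 i) (ls i))).
Proof.
move=> Hls Hs0 Inv0 InvF Bb HB HF.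
have := ptime_foldD (F := fun i s v => Ret (f i s v)) Hls Hs0 Inv0 InvF Bb HB HF.
by apply: eq_ptime => i _; rewrite (foldD_Ret (f := f i)).
Qed.

(** [ptime_foldD] needs its list as data, whereas here only a counter is available, and [ptime_iota]
    is derived from this lemma. Counting down while consing produces the list in the right order;
    the state stores [size r] in place of the index list [r]. *)
Lemma ptime_mkseq (N : I -> nat) (f : I -> nat -> data) :
  dptime sz D env (fun i => DNum (N i)) -> pbd sz D N ->
  (forall D' : I * nat -> Prop,
    (forall x, D' x -> D x.1 /\ x.2 < N x.1) ->
    let env' (x : I * nat) := DPair (DNum x.2) (env x.1) in
    bounded (fun x => sz x.1) D' env' ->
    dptime (fun x => sz x.1) D' env' (fun x => f x.1 x.2)) ->
  dptime sz D env (fun i => elist (mkseq (f i) (N i))).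
Proof.
move=> HN Nb Hf.
pose D0 (x : I * nat) := D x.1 /\ x.2 < N x.1.
have D0D x : D0 x -> D x.1 by case.
have D0b : bounded (fun x => sz x.1) D0 (fun x => DPair (DNum x.2) (env x.1)).
  have HNb := dptime_bounded HN.
  apply: pbd_le (pbdS (pbdD (pbd_lift HNb D0D) (pbd_lift envb D0D))) _ => x [_ xN].
  by rewrite /= ltnS leq_add2r ltnS leq_trunc_log // ltnW.
have Hf0 := Hf D0 (fun x => id) D0b.
case: (dptime_bounded Hf0) => k fb.
pose F (i : I) (s : data) (j : nat) := Ret (DPair (f i j) s).
pose ls i := rev (iota 0 (N i)).
pose st i (r : seq nat) (s : data) := DPair (DPair (DNum (size r)) s) (env i).
(* Each of the [N i - q] entries built so far has size at most [(sz i).+2 ^ k], plus one for its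
   pair node; the final [1] is the end marker [DNum 0]. *)
pose Inv i (r : seq nat) (s : data) := exists q, [/\ r = rev (iota 0 q), q <= N i &
  dsize s <= (N i - q) * ((sz i).+2 ^ k).+1 + 1].
pose B i := (dsize (DNum (N i)) + (N i * ((sz i).+2 ^ k).+1 + 1)).+1 + dsize (env i).
have Bb : pbd sz D (fun i => (B i).+1).
  apply/pbdS/pbdD/envb/pbdS/pbdD; first exact: dptime_bounded HN.
  apply: pbdD (pbd_cst _ _ _); apply: pbdM => //.
  by apply: pbdS; exists k.
have stB i r s : D i -> Inv i r s -> dsize (st i r s) <= (B i).+1.
  move=> Di [q [-> qN sB]]; rewrite /B [dsize _]/= ltnS leq_add2r ltnS.
  apply: leq_add; first by rewrite /= ltnS leq_trunc_log // size_rev size_iota.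
  apply: leq_trans sB _; rewrite leq_add2r; apply: leq_mul => //; exact: leq_subr.
have stb1 (I' : Type) (p : I' -> I) q1 q2 (D' : I' -> Prop) :
    (forall x, D' x -> D (p x) /\ Inv (p x) (q1 x) (q2 x)) ->
    bounded (fun x => sz (p x)) D' (fun x => st (p x) (q1 x) (q2 x)).
  move=> HD'; have Dp x : D' x -> D (p x) by case/HD'.
  by apply: pbd_le (pbd_lift Bb Dp) _ => x /HD' []; apply: stB.
have Hst : dptime sz D env (fun i => st i (ls i) (DNum 0)).
  apply: ptime_pair => //; last exact: ptime_id.
  apply: ptime_pair => //; last exact: ptime_cst.
  by apply: eq_ptime HN => i _; rewrite size_rev size_iota.
have Inv0 i : D i -> Inv i (ls i) (DNum 0).
  by move=> _; exists (N i); split => //; rewrite subnn.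
have InvF i v r s : D i -> Inv i (v :: r) s -> always (Inv i r) (F i s v).
  move=> Di [[|q] [Er qN sB]]; first by [].
  move: Er; rewrite rev_iotaS => -[-> ->].
  exists q; split=> //; first exact: ltnW.
  rewrite /=; have := fb (i, q) (conj Di qN); rewrite /=.
  have -> : N i - q = (N i - q.+1).+1 by lia.
  by move: sB; lia.
apply: (ptime_dseq Hst envb).
have Hfold : ptime sz D (fun i => st i (ls i) (DNum 0))
    (fun i => dmap (st i [::]) (foldD (F i) (DNum 0) (ls i))).
  apply: (ptime_while (Inv := Inv) (B := fun i => (B i).+1)) => //.
  - by apply: pbd_le Nb _ => i _; rewrite size_rev size_iota.
  - pose D1 (x : I * (seq nat * data)) := D x.1 /\ Inv x.1 x.2.1 x.2.2.
    have b := stb1 _ fst (fun x => x.2.1) (fun x => x.2.2) D1 (fun x => id).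
    have H1 := ptime_fst b (ptime_fst b (ptime_id b)).
    have C n (D2 : I * (seq nat * data) -> Prop) (HD : forall x, D2 x -> D1 x) :=
      ptime_cst n (pbd_sub b HD).
    have H3 := ptime_if b H1 (C 1 _ (fun x => @proj1 _ _)) (C 0 _ (fun x => @proj1 _ _)).
    by apply: eq_ptime H3 => x _; case: (x.2.1).
  - pose D1 (x : I * (nat * seq nat * data)) :=
      D x.1 /\ Inv x.1 (x.2.1.1 :: x.2.1.2) x.2.2.
    have b := stb1 _ fst (fun x => x.2.1.1 :: x.2.1.2) (fun x => x.2.2) D1 (fun x => id).
    have Hid := ptime_id b.
    have Hn := ptime_fst b (ptime_fst b Hid); have Hs := ptime_snd b (ptime_fst b Hid).
    have Henv := ptime_snd b Hid.
    have Hv := ptime_arith OpSub b Hn (ptime_cst 1 b).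
    have HD1 x : D1 x -> [/\ D0 (x.1, x.2.1.1), x.2.1.1 = size x.2.1.2
        & size (x.2.1.1 :: x.2.1.2) - 1 = x.2.1.1].
      case: x => i [[v r] s] [Di [[|q] [Er qN sB]]] //.
      move: Er; rewrite rev_iotaS /= => -[-> ->].
      by rewrite subn1 /= size_rev size_iota.
    have HD0 x : D1 x -> D0 (x.1, x.2.1.1) by case/HD1.
    have Hv1 : dptime (fun x => sz x.1) D1 (fun x => st x.1 (x.2.1.1 :: x.2.1.2) x.2.2)
        (fun x => DNum x.2.1.1).
      by apply: eq_ptime Hv => x /HD1 [_ _ /= ->].
    have Hr : dptime (fun x => sz x.1) D1 (fun x => st x.1 (x.2.1.1 :: x.2.1.2) x.2.2)
        (fun x => DNum (size x.2.1.2)).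
      by apply: eq_ptime Hv1 => x /HD1 [_ <-].
    have Hf1 := ptime_reindex (h := fun x => (x.1, x.2.1.1)) HD0 Hf0.
    have Hf2 := ptime_dseq (ptime_pair b Hv1 Henv) b Hf1.
    exact (ptime_pair b (ptime_pair b Hr (ptime_pair b Hf2 Hs)) Henv).
have Efold i : dmap (st i [::]) (foldD (F i) (DNum 0) (ls i)) =
    Ret (DPair (DPair (DNum 0) (elist (mkseq (f i) (N i)))) (env i)).
  rewrite (foldD_Ret (f := fun s j => DPair (f i j) s)) // -[LHS]/(Ret (st i [::] _)).
  by rewrite foldl_rev /elist /mkseq foldr_map.
have Hfold' := eq_ptime (fun i _ => Efold i) Hfold.
have stb0 := dptime_bounded Hst; have H1 := ptime_fst stb0 Hfold'.
exact: ptime_snd stb0 H1.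
Qed.

End Folds.

(** * Arithmetic of finite metrics *)

Definition nlist (s : seq nat) : data := elist (map DNum s).
Definition enc_mx (M : seq (seq nat)) : data := elist (map nlist M).
Definition mget (M : seq (seq nat)) (x y : nat) : nat := nth 0 (nth [::] M x) y.

Definition mind (M : seq (seq nat)) (x : nat) (s : seq nat) : nat :=
  foldl (fun m a => minn m (mget M x a)) (mget M x (head 0 s)) s.

Definition mcost (M : seq (seq nat)) (n : nat) (s : seq nat) : nat :=
  foldl (fun m x => m + mind M x s) 0 (iota 0 n).

(* The second component is the number of points still to be added. *)
Definition pad_step (s : seq nat * nat) (v : nat) : seq nat * nat :=
  if (v \in s.1) || (s.2 == 0) then s else (v :: s.1, s.2.-1).

(** A configuration may repeat locations, while a k-median solution has [k] distinct points. The
    points of [s] are inserted before the filler points, so none of them is lost when [s] has at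
    most [k] entries. *)
Definition pad (n k : nat) (s : seq nat) : seq nat :=
  (foldl pad_step (foldl pad_step ([::], k) s) (iota 0 n)).1.

(** In the algorithm [M] is the given matrix, not a truncated one, so that candidates found at
    different truncation levels are comparable. *)
Definition improve M n k (best : seq nat) (s : seq nat) : seq nat :=
  let c := pad n k s in if mcost M n best <= mcost M n c then best else c.

Section Derived.
Variables (I : Type) (sz : I -> nat) (D : I -> Prop) (env : I -> data).
Hypothesis envb : bounded sz D env.
Notation ok f := (dptime sz D env f).
Notation okn a := (dptime sz D env (fun i => DNum (a i))).

Lemma ptime_minn a b : okn a -> okn b -> okn (fun i => minn (a i) (b i)).
Proof.
move=> Ha Hb; have H := ptime_arith OpSub envb Ha (ptime_arith OpSub envb Ha Hb).
by apply: eq_ptime H => i _; rewrite /= minnE.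
Qed.

Lemma ptime_bool (t : I -> nat) : okn t -> okn (fun i => t i == 0).
Proof.
move=> Ht.
have C n (D2 : I -> Prop) (HD : forall i, D2 i -> D i) := ptime_cst n (pbd_sub envb HD).
have := ptime_if envb Ht (C 0 _ (fun x => @proj1 _ _)) (C 1 _ (fun x => @proj1 _ _)).
by apply: eq_ptime => i _; case: eqP.
Qed.

Lemma ptime_leq a b : okn a -> okn b -> okn (fun i => a i <= b i).
Proof. by move=> Ha Hb; apply: ptime_bool; apply: (ptime_arith OpSub). Qed.

Lemma ptime_eqn a b : okn a -> okn b -> okn (fun i => a i == b i).
Proof.
move=> Ha Hb; have H := ptime_bool (ptime_arith OpAdd envb
  (ptime_arith OpSub envb Ha Hb) (ptime_arith OpSub envb Hb Ha)).
apply: eq_ptime H => i _; congr (Ret (DNum (nat_of_bool _))).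
by rewrite /= addn_eq0 [RHS]eqn_leq.
Qed.

Lemma ptime_ite (t : I -> bool) (f g : I -> data) :
  okn t -> ok f -> ok g -> ok (fun i => if t i then f i else g i).
Proof.
move=> Ht Hf Hg.
have Hs u (P : I -> Prop) (H : ok u) : dptime sz (fun i => D i /\ P i) env u.
  by apply: ptime_sub H => i [].
have := ptime_if envb Ht (Hs _ _ Hf) (Hs _ _ Hg).
by apply: eq_ptime => i _; case: (t i).
Qed.

Lemma ptime_modn a b : okn a -> okn b -> okn (fun i => a i %% b i).
Proof.
move=> Ha Hb; have H := ptime_arith OpMul envb (ptime_arith OpDiv envb Ha Hb) Hb.
have H' := ptime_arith OpSub envb Ha H.
apply: eq_ptime H' => i _ /=.
by rewrite {1}(divn_eq (a i) (b i)) addKn.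
Qed.

Lemma ptime_expc a k : okn a -> okn (fun i => a i ^ k).
Proof.
move=> Ha; elim: k => [|k IHk]; first exact: ptime_cst.
by have H := ptime_arith OpMul envb Ha IHk; apply: eq_ptime H => i _; rewrite expnS.
Qed.

Lemma ptime_iota N : okn N -> pbd sz D N -> ok (fun i => nlist (iota 0 (N i))).
Proof.
move=> HN Nb.
have H : ok (fun i => elist (mkseq DNum (N i))).
  by apply: (ptime_mkseq envb (f := fun _ => DNum) HN Nb) => D' _ env' b; apply: ptime_var1.
exact: H.
Qed.

Lemma elist_suffix (q : nat) (s : seq data) : dsize (elist (drop q s)) <= dsize (elist s).
Proof. by rewrite -{2}(cat_take_drop q s); apply: dsize_elist_suffix. Qed.

Lemma ptime_nth (l : I -> seq data) (j : I -> nat) :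
  ok (fun i => elist (l i)) -> okn j -> pbd sz D j ->
  ok (fun i => nth (DNum 0) (l i) (j i)).
Proof.
move=> Hl Hj jb.
have H : ok (fun i => elist (foldl (fun s _ => behead s) (l i) (iota 0 (j i)))).
  apply: (ptime_foldl envb (g := DNum) (h := elist) (ls := fun i => iota 0 (j i))
    (f := fun _ s _ => behead s) (Inv := fun i _ s => exists q, s = drop q (l i))
    (B := fun i => dsize (elist (l i)))).
  - exact: ptime_iota.
  - exact: Hl.
  - by move=> i _; exists 0; rewrite drop0.
  - by move=> i _ _ _ _ [q ->]; exists q.+1; rewrite -drop1 drop_drop add1n.
  - exact: dptime_bounded Hl.
  - by move=> i _ _ _ [q ->]; apply: elist_suffix.
  - move=> D' HD' env' b.
    have := ptime_dsnd b (ptime_var2' (a := fun x : I * (nat * seq data) => DNum x.2.1) b).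
    by apply: eq_ptime => x _; case: (x.2.2).
apply: eq_ptime (ptime_dfst envb H) => i _; congr Ret.
have -> : foldl (fun s _ => behead s) (l i) (iota 0 (j i)) = drop (j i) (l i).
  elim: (j i) (l i) 0 => [|q IHq] s t /=; first by rewrite drop0.
  by rewrite IHq -drop1 drop_drop addn1.
by rewrite -[j i in RHS]addn0 -nth_drop; case: (drop _ _).
Qed.

Lemma ptime_mget (M : I -> seq (seq nat)) a b :
  ok (fun i => enc_mx (M i)) -> okn a -> okn b -> pbd sz D a -> pbd sz D b ->
  okn (fun i => mget (M i) (a i) (b i)).
Proof.
move=> HM Ha Hb ab bb; have H := ptime_nth HM Ha ab.
have H1 : ok (fun i => elist (map DNum (nth [::] (M i) (a i)))).
  apply: eq_ptime H => i _; case: (ltnP (a i) (size (M i))) => sa.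
    by rewrite (nth_map [::]).
  by rewrite !nth_default ?size_map.
apply: eq_ptime (ptime_nth H1 Hb bb) => i _; rewrite /mget.
case: (ltnP (b i) (size (nth [::] (M i) (a i)))) => sa; first by rewrite (nth_map 0).
by rewrite nth_default ?size_map // nth_default.
Qed.

End Derived.

Lemma dsize_nth (s : seq data) j : dsize (nth (DNum 0) s j) <= dsize (elist s).
Proof.
elim: s j => [|a s IHs] [|j] //=; first by lia.
exact: leq_trans (IHs j) (leq_trans (leq_addl _ _) (leqnSn _)).
Qed.

Lemma mget_dsize M x y : dsize (DNum (mget M x y)) <= dsize (enc_mx M).
Proof.
apply: (@leq_trans (dsize (nlist (nth [::] M x)))).
  rewrite /mget; case: (ltnP y (size (nth [::] M x))) => sy.
    by rewrite -(nth_map _ (DNum 0)) //; apply: dsize_nth.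
  by rewrite [X in DNum X]nth_default //= /nlist; case: (map _ _).
case: (ltnP x (size M)) => sx; first by rewrite -(nth_map _ (DNum 0)) //; apply: dsize_nth.
by rewrite nth_default //= /enc_mx; case: (map _ _).
Qed.

Lemma mind_le_head M x s : mind M x s <= mget M x (head 0 s).
Proof.
rewrite /mind; move: (mget M x (head 0 s)) => m.
by elim: s m => //= a s IHs m; apply: leq_trans (IHs _) (geq_minl _ _).
Qed.

Lemma dsize_num_le a b : a <= b -> dsize (DNum a) <= dsize (DNum b).
Proof. by move=> ab; rewrite /= ltnS leq_trunc_log. Qed.

Lemma mind_dsize M x s : dsize (DNum (mind M x s)) <= dsize (enc_mx M).
Proof. exact: leq_trans (dsize_num_le (mind_le_head _ _ _)) (mget_dsize _ _ _). Qed.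

Lemma dsize_nlist N s : all (fun a => a <= N) s ->
  dsize (nlist s) <= size s * (dsize (DNum N)).+1 + 1.
Proof.
elim: s => //= a s IHs /andP[aN /IHs].
by have := dsize_num_le aN; rewrite /= /nlist; lia.
Qed.

Section Search.
Variables (I : Type) (sz : I -> nat) (D : I -> Prop) (env : I -> data).
Hypothesis envb : bounded sz D env.
Notation ok f := (dptime sz D env f).
Notation okn a := (dptime sz D env (fun i => DNum (a i))).

Lemma ptime_mem (x : I -> nat) (s : I -> seq nat) :
  okn x -> ok (fun i => nlist (s i)) -> okn (fun i => x i \in s i).
Proof.
move=> Hx Hs.
have H : okn (fun i => foldl (fun b v => if v == x i then 1 else b) 0 (s i)).
  apply: (ptime_foldl envb (g := DNum) (h := DNum) (s0 := fun=> 0)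
    (f := fun i b v => if v == x i then 1 else b) (Inv := fun i _ b => b <= 1)
    (B := fun=> 1) Hs) => //.
  - exact: ptime_cst.
  - by move=> i v r b _ b1 /=; case: eqP.
  - exact: pbd_cst.
  - by move=> i _ [|[|b]].
  - move=> D' HD' env' b.
    have L f (H : dptime sz D env f) := ptime_lift H b (fun y Dy => proj1 (HD' y Dy)).
    have Hv := ptime_var2 (a := fun y : I * (nat * nat) => DNum y.2.1) b.
    have Ht := ptime_ite b (ptime_eqn b Hv (L _ Hx)) (ptime_cst 1 b)
      (ptime_var2' (a := fun y : I * (nat * nat) => DNum y.2.1) b).
    by apply: eq_ptime Ht => y _; case: ifP.
apply: eq_ptime H => i _; congr (Ret (DNum _)).
suff E b : foldl (fun b v => if v == x i then 1 else b) b (s i) =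
    if x i \in s i then 1 else b by rewrite E; case: ifP.
elim: (s i) b => //= a l IHl b; rewrite IHl inE eq_sym.
by case: eqP; case: ifP.
Qed.

Lemma ptime_mind (M : I -> seq (seq nat)) (x n : I -> nat) (s : I -> seq nat) :
  ok (fun i => enc_mx (M i)) -> okn x -> pbd sz D x ->
  pbd sz D n -> ok (fun i => nlist (s i)) ->
  (forall i, D i -> all (fun a => a <= n i) (s i)) ->
  okn (fun i => mind (M i) (x i) (s i)).
Proof.
move=> HM Hx xb nb Hs sn.
have Hh : okn (fun i => head 0 (s i)).
  by have := ptime_dfst envb Hs; apply: eq_ptime => i _; case: (s i).
have hb : pbd sz D (fun i => head 0 (s i)).
  by apply: pbd_le nb _ => i /sn; case: (s i) => //= a l /andP[].
apply: (ptime_foldl envb (g := DNum) (h := DNum) (s0 := fun i => mget (M i) (x i) (head 0 (s i)))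
    (f := fun i m a => minn m (mget (M i) (x i) a))
    (Inv := fun i r m => dsize (DNum m) <= dsize (enc_mx (M i)) /\ all (fun a => a <= n i) r)
    (B := fun i => dsize (enc_mx (M i))) Hs).
- exact: ptime_mget.
- by move=> i Di; split; [apply: mget_dsize|apply: sn].
- move=> i v r m Di [mB /= /andP[vn rn]]; split=> //.
  exact: leq_trans (dsize_num_le (geq_minl _ _)) mB.
- exact: dptime_bounded HM.
- by move=> i r m _ [].
- move=> D' HD' env' b; have DD y : D' y -> D y.1 by case/HD'.
  have L f (H : dptime sz D env f) := ptime_lift H b DD.
  apply: ptime_minn => //.
    exact: (ptime_var2' (a := fun y : I * (nat * nat) => DNum y.2.1) b).
  apply: ptime_mget => //; first exact: (L _ HM).
  + exact: (L _ Hx).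
  + exact: (ptime_var2 (a := fun y : I * (nat * nat) => DNum y.2.1) b).
  + exact: pbd_lift xb DD.
  + by apply: pbd_le (pbd_lift nb DD) _ => y /HD' [_ [_ [r [_ [_ /= /andP[]]]]]].
Qed.

End Search.

Section Cost.
Variables (I : Type) (sz : I -> nat) (D : I -> Prop) (env : I -> data).
Hypothesis envb : bounded sz D env.
Notation ok f := (dptime sz D env f).
Notation okn a := (dptime sz D env (fun i => DNum (a i))).

Lemma ptime_mcost (M : I -> seq (seq nat)) (n : I -> nat) (s : I -> seq nat) :
  ok (fun i => enc_mx (M i)) -> okn n -> pbd sz D n -> ok (fun i => nlist (s i)) ->
  (forall i, D i -> all (fun a => a <= n i) (s i)) ->
  okn (fun i => mcost (M i) (n i) (s i)).
Proof.
move=> HM Hn nb Hs sn.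
pose B i := dsize (enc_mx (M i)).
(* After [q] points the sum is at most [q * 2 ^ B], with [B] the size of the encoded matrix, hence
   below [2 ^ (n + B)] throughout. *)
apply: (ptime_foldl envb (g := DNum) (h := DNum) (ls := fun i => iota 0 (n i))
    (s0 := fun=> 0) (f := fun i m a => m + mind (M i) a (s i))
    (Inv := fun i r m => exists q, [/\ r = iota q (size r), q + size r = n i
       & m <= q * 2 ^ B i])
    (B := fun i => (n i + B i).+1)).
- exact: ptime_iota.
- exact: ptime_cst.
- by move=> i Di; exists 0; rewrite size_iota.
- move=> i v r m Di [q [/= [-> Er] Eq mB]]; exists q.+1; split=> //; first by lia.
  by have /= := mind_dsize (M i) q (s i) => /log_pbd; rewrite -/(B i); nia.
- by apply/pbdS/pbdD => //; apply: dptime_bounded HM.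
- move=> i r m _ [q [_ Eq mB]]; rewrite /= ltnS; apply: trunc_log_lt2.
  apply: leq_ltn_trans mB _; rewrite expnD ltn_mul2r expn_gt0 /=.
  by apply: leq_ltn_trans (ltn_expl _ (isT : 1 < 2)); lia.
- move=> D' HD' env' b; have DD y : D' y -> D y.1 by case/HD'.
  have L f (H : dptime sz D env f) := ptime_lift H b DD.
  apply: (ptime_arith OpAdd) => //.
    exact: (ptime_var2' (a := fun y : I * (nat * nat) => DNum y.2.1) b).
  have vn y : D' y -> y.2.1 < n y.1.
    by case/HD' => _ [_ [r [_ [q [/= [-> _] <- _]]]]]; lia.
  apply: (ptime_mind b (M := fun y => M y.1) (n := fun y => n y.1) (s := fun y => s y.1)).
  + exact: (L _ HM).
  + exact: (ptime_var2 (a := fun y : I * (nat * nat) => DNum y.2.1) b).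
  + by apply: pbd_le (pbd_lift nb DD) _ => y /vn /ltnW.
  + exact: pbd_lift nb DD.
  + exact: (L _ Hs).
  + by move=> y /DD; apply: sn.
Qed.

(** The conserved quantity, length plus number of points still to be added, is [k]; it keeps the
    accumulator polynomial. *)
Lemma ptime_pad_fold (k : I -> nat) (n : I -> nat) (s0 : I -> seq nat * nat) (s : I -> seq nat) :
  pbd sz D n -> pbd sz D k ->
  ok (fun i => DPair (nlist (s0 i).1) (DNum (s0 i).2)) ->
  ok (fun i => nlist (s i)) ->
  (forall i, D i -> all (fun a => a <= n i) (s i)) ->
  (forall i, D i -> all (fun a => a <= n i) (s0 i).1 /\ size (s0 i).1 + (s0 i).2 = k i) ->
  ok (fun i => let s' := foldl pad_step (s0 i) (s i) in DPair (nlist s'.1) (DNum s'.2)).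
Proof.
move=> nb kb Hs0 Hs sn s0k.
pose h (s : seq nat * nat) := DPair (nlist s.1) (DNum s.2).
apply: (ptime_foldl envb (g := DNum) (h := h) (ls := s) (s0 := s0) (f := fun _ => pad_step)
    (Inv := fun i r s => [/\ all (fun a => a <= n i) r, all (fun a => a <= n i) s.1
       & size s.1 + s.2 = k i])
    (B := fun i => (k i * (n i).+2 + 1 + (k i).+1).+1)) => //.
- by move=> i Di; have [] := s0k i Di; split=> //; apply: sn.
- move=> i v r [l m] Di [/= /andP[vn rn] ln lm]; rewrite /pad_step /=.
  case: ifP; first by split.
  by case: m lm => [|m] lm; rewrite ?orbT //=; split=> //=; [rewrite vn|lia].
- by apply/pbdS/pbdD/pbdS/kb/pbdD/pbd_cst/pbdM/pbdS/pbdS.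
- move=> i r [l m] Di [_ /= ln lm]; rewrite ltnS.
  have ll a : trunc_log 2 a <= a by apply: trunc_log_lt2 (ltn_expl _ _).
  by have := dsize_nlist ln; have := ll (n i); have := ll m; rewrite /=; nia.
- move=> D' HD' env' b; have DD y : D' y -> D y.1 by case/HD'.
  have Hv := ptime_var2 (a := fun y : I * (nat * (seq nat * nat)) => DNum y.2.1) b.
  have Hst := ptime_var2' (a := fun y : I * (nat * (seq nat * nat)) => DNum y.2.1) b.
  have Hl := ptime_fst b Hst; have Hm := ptime_snd b Hst.
  have H := ptime_ite b (ptime_mem b Hv Hl) Hst (ptime_ite b (ptime_eqn b Hm (ptime_cst 0 b))
     Hst (ptime_pair b (ptime_pair b Hv Hl) (ptime_arith OpSub b Hm (ptime_cst 1 b)))).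
  apply: eq_ptime H => -[i [v [l m]]] _; rewrite /pad_step /h /=.
  by case: ifP => //= _; case: ifP => //= _; rewrite subn1.
Qed.

Lemma ptime_pad n k s :
  okn n -> pbd sz D n -> okn k -> pbd sz D k -> ok (fun i => nlist (s i)) ->
  (forall i, D i -> all (fun a => a <= n i) (s i)) ->
  ok (fun i => nlist (pad (n i) (k i) (s i))).
Proof.
move=> Hn nb Hk kb Hs sn.
have H0 : ok (fun i => DPair (nlist ([::] : seq nat, k i).1) (DNum (k i))).
  by apply: ptime_pair => //; apply: ptime_cst.
have H1 := ptime_pad_fold (s0 := fun i => ([::], k i)) nb kb H0 Hs sn (fun i _ => conj isT erefl).
have inv i r (st : seq nat * nat) : all (fun a => a <= n i) r ->
    all (fun a => a <= n i) st.1 /\ size st.1 + st.2 = k i ->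
    let st' := foldl pad_step st r in
    all (fun a => a <= n i) st'.1 /\ size st'.1 + st'.2 = k i.
  elim: r st => [|v r IHr] st //= /andP[vn rn] [ln lm]; apply: IHr => //.
  rewrite /pad_step; case: ifP => // /norP[_]; rewrite /= vn ln; split=> //; lia.
have H2 := ptime_pad_fold nb kb H1 (ptime_iota envb Hn nb).
have io i : D i -> all (fun a => a <= n i) (iota 0 (n i)).
  by move=> _; apply/allP => a; rewrite mem_iota add0n => /ltnW.
have {}H2 := H2 io (fun i Di => inv i (s i) ([::], k i) (sn i Di) (conj isT erefl)).
exact: (ptime_fst (f := fun i => nlist (pad (n i) (k i) (s i))) envb H2).
Qed.

End Cost.

(** * Padding to exactly [k] points *)

Lemma pad_step_sub st v : {subset st.1 <= (pad_step st v).1}.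
Proof. by rewrite /pad_step; case: ifP => _ a //= ast; rewrite inE ast orbT. Qed.

Lemma pad_step_mem st v : (0 < st.2) -> v \in (pad_step st v).1.
Proof.
rewrite lt0n /pad_step => /negPf ->; rewrite orbF; case: ifP => //= _.
exact: mem_head.
Qed.

Lemma pad_fold_sub st r : {subset st.1 <= (foldl pad_step st r).1}.
Proof. by elim: r st => [|v r IHr] st a //= ast; apply/IHr/pad_step_sub. Qed.

Lemma pad_fold_le st r : (foldl pad_step st r).2 <= st.2.
Proof.
elim: r st => //= v r IHr st; apply: leq_trans (IHr _) _.
by rewrite /pad_step; case: ifP => //= _; apply: leq_pred.
Qed.

Lemma pad_fold_mem st r : size r <= st.2 -> {subset r <= (foldl pad_step st r).1}.
Proof.
elim: r st => //= v r IHr st sr a; rewrite inE => /orP[/eqP->|ar].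
  by apply: pad_fold_sub; apply: pad_step_mem; lia.
by apply: IHr => //; rewrite /pad_step; case: ifP => _ /=; lia.
Qed.

(** Applied to all [n] points, this makes padding reach length [k]: in the second case the list
    contains all [n >= k] points. *)
Lemma pad_fold_full st r :
  (foldl pad_step st r).2 = 0 \/ {subset r <= (foldl pad_step st r).1}.
Proof.
elim: r st => [|v r IHr] st /=; first by right.
case: (IHr (pad_step st v)) => H; [by left|].
case: (posnP st.2) => st2.
  left; apply/eqP; rewrite -leqn0; apply: leq_trans (pad_fold_le _ _) _.
  by rewrite /pad_step st2 orbT st2.
right=> a; rewrite inE => /orP[/eqP->|/H //].
exact/pad_fold_sub/pad_step_mem.
Qed.

Lemma pad_props n k s : k <= n -> all (fun a => a < n) s ->
  [/\ uniq (pad n k s), size (pad n k s) = k, all (fun a => a < n) (pad n k s)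
    & size s <= k -> {subset s <= pad n k s}].
Proof.
move=> kn sn.
pose P (st : seq nat * nat) := [/\ uniq st.1, size st.1 + st.2 = k & all (fun a => a < n) st.1].
have inv r st : all (fun a => a < n) r -> P st -> P (foldl pad_step st r).
  elim: r st => [|v r IHr] st //= /andP[vn rn] [us sz ln]; apply: IHr => //.
  rewrite /pad_step; case: ifP => // /norP[vs s0].
  by split=> /=; [rewrite vs|lia|rewrite vn].
have io : all (fun a => a < n) (iota 0 n).
  by apply/allP => a; rewrite mem_iota.
have P0 : P ([::], k) by [].
have P1 := inv _ _ sn P0.
have [u sz ln] := inv _ _ io P1; rewrite /pad.
split=> //; last first.
  by move=> sk a /(pad_fold_mem (st := ([::], k)) sk); apply: pad_fold_sub.
case: (pad_fold_full (foldl pad_step ([::], k) s) (iota 0 n)) => H.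
  by rewrite H addn0 in sz.
have := uniq_leq_size (iota_uniq 0 n) H; rewrite size_iota => nle.
by apply/eqP; rewrite eqn_leq -{2}sz leq_addr; apply: leq_trans kn nle.
Qed.

Section Improve.
Variables (I : Type) (sz : I -> nat) (D : I -> Prop) (env : I -> data).
Hypothesis envb : bounded sz D env.
Notation ok f := (dptime sz D env f).
Notation okn a := (dptime sz D env (fun i => DNum (a i))).

Lemma ptime_improve M n k best s :
  ok (fun i => enc_mx (M i)) -> okn n -> pbd sz D n -> okn k ->
  ok (fun i => nlist (best i)) -> ok (fun i => nlist (s i)) ->
  (forall i, D i -> [/\ k i <= n i, all (fun a => a < n i) (best i) &
     all (fun a => a < n i) (s i)]) ->
  ok (fun i => nlist (improve (M i) (n i) (k i) (best i) (s i))).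
Proof.
move=> HM Hn nb Hk Hbest Hs HD.
have kb : pbd sz D k by apply: pbd_le nb _ => i /HD[].
have W m l : all (fun a => a < m) l -> all (fun a => a <= m) l.
  by move=> /allP H; apply/allP => a /H /ltnW.
have Hpad : ok (fun i => nlist (pad (n i) (k i) (s i))).
  by apply: ptime_pad => // i /HD[_ _ /W].
have H : okn (fun i => mcost (M i) (n i) (best i) <= mcost (M i) (n i) (pad (n i) (k i) (s i))).
  apply: ptime_leq => //; apply: ptime_mcost => // i /HD[kn bn sn]; apply: W => //.
  by case: (pad_props kn sn).
by apply: eq_ptime (ptime_ite envb H Hbest Hpad) => i _; rewrite /improve; case: ifP.
Qed.

End Improve.

(** * The algorithm *)

Definition coin : rdist nat := Flip (Ret 0) (Ret 1).

Definition draw_bits (b : nat) : rdist nat :=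
  foldD (fun u _ => dbind coin (fun c => Ret (c + (u + u)))) 0 (iota 0 b).

Definition draw (n b : nat) : rdist nat := dmap (fun u => u %% n) (draw_bits b).

Definition draws (n b T : nat) : rdist (seq nat) :=
  foldD (fun s _ => dmap (fun x => x :: s) (draw n b)) [::] (iota 0 T).

Lemma draw_lt n b : 0 < n -> always (fun x => x < n) (draw n b).
Proof.
by move=> n0; apply/always_dmap; apply: always_true => u; rewrite ltn_mod.
Qed.

Lemma draws_inv n b T : 0 < n ->
  always (fun s => size s = T /\ all (fun x => x < n) s) (draws n b T).
Proof.
move=> n0.
apply: (@always_imp _ (fun s => size s + 0 = T /\ all (fun x => x < n) s)).
  apply: (foldD_always (Inv := fun r s => size s + size r = T /\ all (fun x => x < n) s)).
    move=> v r s [/= sr sn]; apply/always_dmap.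
    apply: always_imp (draw_lt b n0) _ => x xn /=; rewrite xn sn; split=> //; lia.
  by rewrite size_iota.
by move=> s []; rewrite addn0.
Qed.

(** Decodes to plain numbers, which keeps the algorithm free of the dependent types of [dec_config];
    both agree on the outputs that occur in a legal play. *)
Fixpoint decn (y : data) : seq nat :=
  match y with
  | DNum _ => [::]
  | DPair (DNum a) y' => a :: decn y'
  | DPair _ y' => decn y'
  end.

Lemma decn_nlist s : decn (nlist s) = s.
Proof. by elim: s => //= a s ->. Qed.

Lemma dec_points_nlist n (s : seq 'I_n) : dec_points n (nlist (map val s)) = Some s.
Proof.
elim: s => //= a s IHs; rewrite insubT //= => a_lt; rewrite /nlist /= in IHs *.
by rewrite IHs /=; congr (Some (_ :: _)); apply: val_inj.
Qed.

Lemma dec_pointsE n y s : dec_points n y = Some s -> y = nlist (map val s).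
Proof.
elim: y s => [[|m]|a _ b IHb] s //=; first by case=> <-.
case: a => // m; case: insubP => //= x _ <-.
by case E : (dec_points n b) => [s'|] //= -[<-]; rewrite (IHb _ E).
Qed.

Lemma dec_configE n k y (C : config n k) : dec_config n k y = Some C ->
  y = nlist (map val C).
Proof.
rewrite /dec_config; case E : (dec_points n y) => [s|] //= H.
by rewrite (dec_pointsE E); case: insubP H => //= u _ <- [->].
Qed.

Definition play_step (A : prog) (tau : nat) M n k (st : data * seq nat) (x : nat) :
    rdist (data * seq nat) :=
  dbind (exec tau A (DPair st.1 (DNum x))) (fun o =>
    if o is Some (DPair m' y) then Ret (m', improve M n k st.2 (decn y)) else Ret st).

Definition alg_horizon (a b n : nat) : nat := a * n ^ b.

Definition truncate M n (L : nat) : seq (seq nat) :=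
  mkseq (fun x => mkseq (fun y => minn (mget M x y) L) n) n.

(* A guess for the truncation level, from the [s]-th ordered pair of points; the summand [1 - d]
   keeps it positive on the diagonal. *)
Definition scale c M n s : nat :=
  let d := mget M ((s %/ n) %% n) (s %% n) in c * n * d + (1 - d).

Definition trial_input a b n k (L : nat) M' : data :=
  DPair (DNum n) (DPair (DNum k) (DPair (DNum (alg_horizon a b n)) (DPair (DNum L) (enc_mx M')))).

(** All requests are drawn before the first is served, as befits an oblivious adversary. The online
    program sees the truncated matrix [M'], while candidates are judged by [M]; [tau] is the time
    that [server_run] grants per step on this instance. *)
Definition trial (A : prog) (p : {poly nat}) (c kappa a b : nat) M n k
    (best : seq nat) (s : nat) : rdist (seq nat) :=
  let L := scale c M n s in
  let M' := truncate M n L in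
  let T := alg_horizon a b n in
  let tau := (p.[n + T + dsize (DPair (DNum L) (enc_mx M'))])%R in
  dbind (draws n (n + kappa) T) (fun xs =>
    dmap snd (foldD (play_step A tau M n k) (trial_input a b n k L M', best) xs)).

(** The index [s] stands for a pair of points through its residue modulo [n * n], so each pair is
    tried [m] times. The starting solution is the padding of the empty list. *)
Definition median_alg A p c kappa a b m M n k : rdist (seq nat) :=
  foldD (trial A p c kappa a b M n k) (pad n k [::]) (iota 0 (n * n * m)).

Lemma dbind_Ret_id (X : Type) (m : rdist X) : dbind m (@Ret X) = m.
Proof. exact: dmap_id. Qed.

Section Draw.
Variables (I : Type) (sz : I -> nat) (D : I -> Prop) (env : I -> data).
Hypothesis envb : bounded sz D env.
Notation ok f := (dptime sz D env f).
Notation okn a := (dptime sz D env (fun i => DNum (a i))).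

Lemma ptime_draw_bits b : okn b -> pbd sz D b ->
  ptime sz D env (fun i => dmap DNum (draw_bits (b i))).
Proof.
move=> Hb bb.
apply: (ptime_foldD envb (g := DNum) (h := DNum) (ls := fun i => iota 0 (b i))
    (s0 := fun=> 0) (F := fun _ u _ => dbind coin (fun c => Ret (c + (u + u))))
    (Inv := fun i r u => size r <= b i /\ u < 2 ^ (b i - size r))
    (B := fun i => (b i).+1)).
- exact: ptime_iota.
- exact: ptime_cst.
- by move=> i _; rewrite size_iota subnn.
- move=> i v r u _ [/= rb ub]; have -> : b i - size r = (b i - (size r).+1).+1 by lia.
  by rewrite expnS; split; split; lia.
- exact: pbdS.
- move=> i r u _ [rb ub]; rewrite /= ltnS; apply: leq_trans (trunc_log_lt2 ub) _.
  exact: leq_subr.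
- move=> D' HD' env' b'.
  apply: (@ptime_bind _ nat _ _ _ (fun _ _ => True) (fun _ => DNum) (fun=> coin)
     (fun x c => Ret (DNum (c + (x.2.2 + x.2.2))))) => //.
  + exact: ptime_coin.
  + move=> D2 HD2 env2 b2.
    have Hc := ptime_var1 (a := fun x : I * (nat * nat) * nat => DNum x.2) b2.
    have Hu := ptime_lift (ptime_var2' (a := fun x : I * (nat * nat) => DNum x.2.1) b') b2
      (fun x Dx => proj1 (HD2 x Dx)).
    exact: (ptime_arith OpAdd b2 Hc (ptime_arith OpAdd b2 Hu Hu)).
Qed.

Lemma ptime_draw n b : okn n -> okn b -> pbd sz D b ->
  ptime sz D env (fun i => dmap DNum (draw (n i) (b i))).
Proof.
move=> Hn Hb bb.
have H : ptime sz D env (fun i => dbind (draw_bits (b i)) (fun u => Ret (DNum (u %% n i)))).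
  apply: (@ptime_bind _ nat _ _ _ (fun _ _ => True) (fun _ => DNum)
    (fun i => draw_bits (b i)) (fun i u => Ret (DNum (u %% n i)))) => //.
  - exact: ptime_draw_bits.
  - by move=> i _; apply: always_true.
  - move=> D2 HD2 env2 b2.
    have Hu := ptime_var1 (a := fun x : I * nat => DNum x.2) b2.
    have Hn2 := ptime_lift Hn b2 (fun x Dx => proj1 (HD2 x Dx)).
    exact: (ptime_modn b2 Hu Hn2).
by apply: eq_ptime H => i _; rewrite dmap_comp.
Qed.

End Draw.

Section Draws.
Variables (I : Type) (sz : I -> nat) (D : I -> Prop) (env : I -> data).
Hypothesis envb : bounded sz D env.
Notation ok f := (dptime sz D env f).
Notation okn a := (dptime sz D env (fun i => DNum (a i))).

Lemma ptime_draws n b T : okn n -> pbd sz D n -> okn b -> pbd sz D b -> okn T -> pbd sz D T ->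
  (forall i, D i -> 0 < n i) ->
  ptime sz D env (fun i => dmap nlist (draws (n i) (b i) (T i))).
Proof.
move=> Hn nb Hb bb HT Tb n0.
apply: (ptime_foldD envb (g := DNum) (h := nlist) (ls := fun i => iota 0 (T i))
    (s0 := fun=> [::]) (F := fun i s _ => dmap (fun x => x :: s) (draw (n i) (b i)))
    (Inv := fun i r s => size s + size r = T i /\ all (fun x => x < n i) s)
    (B := fun i => T i * (n i).+2 + 1)).
- exact: ptime_iota.
- exact: ptime_cst.
- by move=> i _; rewrite size_iota.
- move=> i v r s Di [/= sr sn]; apply/always_dmap.
  apply: always_imp (draw_lt (b i) (n0 i Di)) _ => x xn /=; rewrite xn sn; split=> //; lia.
- by apply/pbdD/pbd_cst/pbdM/pbdS/pbdS.
- move=> i r s _ [sr /allP sn].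
  have ll a : trunc_log 2 a <= a by apply: trunc_log_lt2 (ltn_expl _ _).
  have sn' : all (fun x => x <= n i) s by apply/allP => x /sn /ltnW.
  by have := dsize_nlist sn'; have := ll (n i); rewrite /=; nia.
- move=> D' HD' env' b'; have DD y : D' y -> D y.1 by case/HD'.
  have L f (H : dptime sz D env f) := ptime_lift H b' DD.
  have Hd : ptime (fun x : I * (nat * seq nat) => sz x.1) D' env'
      (fun x => dmap DNum (draw (n x.1) (b x.1))).
    apply: (ptime_draw b' (n := fun x => n x.1) (b := fun x => b x.1)).
    + exact: (L _ Hn).
    + exact: (L _ Hb).
    + exact: pbd_lift bb DD.
  have Hs := ptime_var2' (a := fun x : I * (nat * seq nat) => DNum x.2.1) b'.
  have := ptime_pairr Hd b' Hs.
  by apply: eq_ptime => x _; rewrite dmap_comp.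
Qed.

End Draws.

Definition points n k (s : seq nat) : bool := [&& uniq s, size s == k & all (fun x => x < n) s].

Lemma improve_points M n k best s : k <= n ->
  points n k best -> all (fun x => x < n) s -> points n k (improve M n k best s).
Proof.
move=> kn bp sn; rewrite /improve; case: ifP => // _; rewrite /points.
by case: (pad_props kn sn) => -> -> -> _; rewrite eqxx.
Qed.

Definition step_output n (o : option data) : Prop :=
  exists m s, o = Some (DPair m (nlist s)) /\ all (fun x => x < n) s.

(** The new memory is part of an output produced within time [tau], so its size is at most [tau]
    regardless of how many steps came before. *)
Lemma always_play_step (n k tau : nat) A M m best x (xs : seq 'I_n) :
  k <= n -> points n k best ->
  always (@isSome _) (play k tau A m (x :: xs)) ->
  always (step_output n) (exec tau A (DPair m (DNum x))) /\
  always (fun st => [/\ points n k st.2, dsize st.1 <= tau &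
     always (@isSome _) (play k tau A st.1 xs)])
   (play_step A tau M n k (m, best) x).
Proof.
move=> kn bp /always_dbind H.
have He : always (@isSome _) (exec tau A (DPair m (DNum x))).
  by apply: always_imp H _ => -[].
have Cn y (C : config n k) : dec_config n k y = Some C -> all (fun x => x < n) (decn y).
  by move=> E; rewrite (dec_configE E) decn_nlist; apply/allP => _ /mapP[z _ ->]; apply: ltn_ord.
split.
  apply: always_imp H _ => -[[z|m' y]|] //=.
  case E : (dec_config n k y) => [C|] //= _.
  exists m', (decn y); split; last exact: Cn E.
  by rewrite {1}(dec_configE E) (dec_configE E) decn_nlist.
apply/always_dbind; have Hs := proj1 (always_dmap _ _ _) (runs_size (exec_runs He)).
apply: always_imp (always_and H Hs) _ => -[[z|m' y]|] [] //=.
case E : (dec_config n k y) => [C|] //= /always_dmap HC szm.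
have ip := improve_points M kn bp (Cn _ _ E).
by split=> //; [lia|apply: always_imp HC _ => -[]].
Qed.

Section Trial.
Variables (A : prog) (p : {poly nat}) (c kappa a b : nat).
Variables (I : Type) (sz : I -> nat) (D : I -> Prop) (env : I -> data).
Hypothesis envb : bounded sz D env.
Notation ok f := (dptime sz D env f).
Notation okn a := (dptime sz D env (fun i => DNum (a i))).
Variables (M : I -> seq (seq nat)) (n k : I -> nat).

Lemma ptime_truncate L : ok (fun i => enc_mx (M i)) -> okn n -> pbd sz D n -> okn L ->
  ok (fun i => enc_mx (truncate (M i) (n i) (L i))).
Proof.
move=> HM Hn nb HL.
suff H : ok (fun i => elist (mkseq (fun x => elist (mkseq (fun y =>
    DNum (minn (mget (M i) x y) (L i))) (n i))) (n i))).
  apply: eq_ptime H => i _; congr Ret.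
  rewrite /enc_mx /truncate /mkseq -map_comp; congr elist; apply: eq_map => x /=.
  by rewrite /nlist -map_comp.
apply: ptime_mkseq => // D1 HD1 env1 b1; have DD1 x : D1 x -> D x.1 by case/HD1.
have L1 f (H : ok f) := ptime_lift H b1 DD1.
apply: (ptime_mkseq b1 (N := fun x => n x.1)
   (f := fun x y => DNum (minn (mget (M x.1) x.2 y) (L x.1)))).
- exact: (L1 _ Hn).
- exact: pbd_lift nb DD1.
move=> D2 HD2 env2 b2; have DD2 x : D2 x -> D1 x.1 by case/HD2.
have L2 f (H : dptime (fun x => sz x.1) D1 env1 f) :=
  @ptime_lift _ nat _ _ D2 _ (fun y => Ret (f y)) (fun x => DNum x.2) H b2 DD2.
apply: ptime_minn => //; last exact: (L2 _ (L1 _ HL)).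
apply: (ptime_mget b2 (M := fun x => M x.1.1) (a := fun x => x.1.2) (b := fun x => x.2)).
- exact: (L2 _ (L1 _ HM)).
- exact: (L2 _ (ptime_var1 (a := fun x : I * nat => DNum x.2) b1)).
- exact: (ptime_var1 (a := fun x : I * nat * nat => DNum x.2) b2).
- by apply: pbd_le (pbd_lift (pbd_lift nb DD1) DD2) _ => x /DD2 /HD1 [_ /ltnW].
- by apply: pbd_le (pbd_lift (pbd_lift nb DD1) DD2) _ => x /HD2 [_ /ltnW].
Qed.

Lemma ptime_scale s : ok (fun i => enc_mx (M i)) -> okn n -> pbd sz D n -> okn s ->
  pbd sz D s -> okn (fun i => scale c (M i) (n i) (s i)).
Proof.
move=> HM Hn nb Hs sb.
have Hd : okn (fun i => mget (M i) ((s i %/ n i) %% n i) (s i %% n i)).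
  apply: ptime_mget => //.
  - by apply: ptime_modn => //; apply: (ptime_arith OpDiv).
  - exact: ptime_modn.
  - by apply: pbd_le sb _ => i _; apply: leq_trans (leq_mod _ _) (leq_div _ _).
  - by apply: pbd_le sb _ => i _; apply: leq_mod.
have H1 := ptime_arith OpSub envb (ptime_cst 1 envb) Hd.
have H2 := ptime_arith OpMul envb (ptime_arith OpMul envb (ptime_cst c envb) Hn) Hd.
exact: (ptime_arith OpAdd envb H2 H1).
Qed.

Lemma ptime_trial (best : I -> seq nat) (s : I -> nat) :
  ok (fun i => enc_mx (M i)) -> okn n -> pbd sz D n -> okn k ->
  ok (fun i => nlist (best i)) -> okn s -> pbd sz D s ->
  (forall i, D i -> [/\ 0 < n i, k i <= n i & points (n i) (k i) (best i)]) ->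
  (forall i, D i ->
    let L := scale c (M i) (n i) (s i) in
    let M' := truncate (M i) (n i) L in
    let T := alg_horizon a b (n i) in
    let tau := (p.[n i + T + dsize (DPair (DNum L) (enc_mx M'))])%R in
    forall xs : T.-tuple 'I_(n i),
     always (@isSome _) (play (k i) tau A (trial_input a b (n i) (k i) L M') xs)) ->
  ptime sz D env
   (fun i => dmap nlist (trial A p c kappa a b (M i) (n i) (k i) (best i) (s i))).
Proof.
move=> HM Hn nb Hk Hbest Hs sb HD safe.
pose L i := scale c (M i) (n i) (s i).
pose M' i := truncate (M i) (n i) (L i).
pose T i := alg_horizon a b (n i).
pose enc i := DPair (DNum (L i)) (enc_mx (M' i)).
pose tau i := (p.[n i + T i + dsize (enc i)])%R.
pose mem0 i := trial_input a b (n i) (k i) (L i) (M' i).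
have HL : okn L by apply: ptime_scale.
have HM' : ok (fun i => enc_mx (M' i)) by apply: ptime_truncate.
have HT : okn T by apply: (ptime_arith OpMul) (ptime_cst a envb) (ptime_expc envb b Hn).
have Tb : pbd sz D T by apply: pbdM (pbd_cst _ _ _) (pbdX _ nb).
have Henc : ok enc by apply: ptime_pair.
have taub : pbd sz D tau.
  by apply/pbd_horner/pbdD/(dptime_bounded Henc)/pbdD.
have Hmem0 : ok mem0 by do 3 apply: ptime_pair => //.
have Hdraws : ptime sz D env (fun i => dmap nlist (draws (n i) (n i + kappa) (T i))).
  apply: ptime_draws => //; last by move=> i /HD[].
  - exact: (ptime_arith OpAdd envb Hn (ptime_cst _ envb)).
  - by apply: pbdD (pbd_cst _ _ _).
suff H : ptime sz D env (fun i => dbind (draws (n i) (n i + kappa) (T i)) (fun xs =>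
    dbind (foldD (play_step A (tau i) (M i) (n i) (k i)) (mem0 i, best i) xs)
      (fun st => Ret (nlist st.2)))).
  apply: eq_ptime H => i _; rewrite /trial dmap_dbind; apply: eq_dbind => xs.
  by rewrite dmap_comp.
pose h (st : data * seq nat) := DPair st.1 (nlist st.2).
apply: (@ptime_bind _ _ _ _ _ (fun i xs => size xs = T i /\ all (fun x => x < n i) xs)
   (fun _ => nlist) _ _ Hdraws envb).
  by move=> i /HD[n0 _ _]; apply: draws_inv.
move=> D1 HD1 env1 b1; have DD1 x : D1 x -> D x.1 by case/HD1.
have L1 f (H : ok f) := ptime_lift H b1 DD1.
have bl (f : I -> nat) (H : pbd sz D f) := pbd_lift H DD1.
have Hxs := ptime_var1 (a := fun x : I * seq nat => nlist x.2) b1.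
(* The time guarantee of [A] covers only memories reached in a legal play; hence the clause that
   play can continue on the remaining requests. The size bound covers both the initial memory and
   the later ones. *)
pose Inv (x : I * seq nat) (r : seq nat) (st : data * seq nat) :=
  [/\ points (n x.1) (k x.1) st.2,
    dsize st.1 <= dsize (mem0 x.1) + tau x.1 &
    exists2 xs : seq 'I_(n x.1), r = map val xs &
       always (@isSome _) (play (k x.1) (tau x.1) A st.1 xs)].
have Inv0 x : D1 x -> Inv x x.2 (mem0 x.1, best x.1).
  move=> /[dup] /DD1 Dx /HD1 [_ [sx ax]]; have [n0 kn bp] := HD _ Dx.
  split=> //; first exact: leq_addr.
  have [xs E] : exists xs : seq 'I_(n x.1), x.2 = map val xs.
    elim: (x.2) ax => [|y l IHl] /=; first by exists [::].
    by case/andP=> yn /IHl [l' ->]; exists (Ordinal yn :: l').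
  have sxs : size xs == T x.1 by rewrite -sx E size_map.
  by exists xs => //; apply: (safe _ Dx (Tuple sxs)).
have InvF x v r st : D1 x -> Inv x (v :: r) st ->
    always (step_output (n x.1)) (exec (tau x.1) A (DPair st.1 (DNum v))) /\
    always (Inv x r) (play_step A (tau x.1) (M x.1) (n x.1) (k x.1) st v).
  case: st => m0 bst; move=> /DD1 /HD [n0 kn _] [/= bp mB [[|y xs] // [-> ->]]] Hpl.
  have [He Hp] := always_play_step (M x.1) kn bp Hpl.
  split=> //; apply: always_imp Hp _ => -[m1 b2] [/= ? ? ?]; split=> //=; first by lia.
  by exists xs.
have kb : pbd sz D k by apply: pbd_le nb _ => i /HD[].
have hB x r st : D1 x -> Inv x r st ->
    dsize (h st) <= (dsize (mem0 x.1) + tau x.1 + (k x.1 * (n x.1).+2 + 1)).+1.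
  move=> _ [/and3P[_ /eqP bk /allP bn] mB _].
  have ll m : trunc_log 2 m <= m by apply: trunc_log_lt2 (ltn_expl _ _).
  have bn' : all (fun y => y <= n x.1) st.2 by apply/allP => y /bn /ltnW.
  rewrite [dsize _]/= ltnS; apply: leq_add mB (leq_trans (dsize_nlist bn') _).
  by rewrite bk leq_add2r leq_mul2l /= !ltnS ll orbT.
have Hfold : ptime (fun x => sz x.1) D1 env1 (fun x => dmap h
    (foldD (play_step A (tau x.1) (M x.1) (n x.1) (k x.1)) (mem0 x.1, best x.1) x.2)).
  apply: (ptime_foldD b1 (g := DNum) (ls := fun x => x.2)
    (s0 := fun x => (mem0 x.1, best x.1)) Hxs _ Inv0 _ _ hB).
  - apply: ptime_pair => //; [exact: (L1 _ Hmem0)|exact: (L1 _ Hbest)].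
  - by move=> x v r st Dx /(InvF _ _ _ _ Dx) [].
  - apply/pbdS/pbdD; first exact: (pbdD (bl _ (dptime_bounded Hmem0)) (bl _ taub)).
    exact: (pbdD (pbdM (bl _ kb) (pbdS (pbdS (bl _ nb)))) (pbd_cst _ _ 1)).
  move=> D2 HD2 env2 b2; have DD2 x : D2 x -> D1 x.1 by case/HD2.
  have L2 f (H : dptime (fun x => sz x.1) D1 env1 f) :=
    @ptime_lift _ (nat * (data * seq nat)) _ _ D2 _ (fun y => Ret (f y))
     (fun x => DPair (DNum x.2.1) (h x.2.2)) H b2 DD2.
  have Hv := ptime_var2 (a := fun x : I * seq nat * (nat * (data * seq nat)) => DNum x.2.1) b2.
  have Hst := ptime_var2' (a := fun x : I * seq nat * (nat * (data * seq nat)) => DNum x.2.1) b2.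
  have Harg := ptime_pair b2 (ptime_fst b2 Hst) Hv.
  have argb := dptime_bounded Harg.
  pose G (x : I * seq nat * (nat * (data * seq nat))) :=
    exec (tau x.1.1) A (DPair x.2.2.1 (DNum x.2.1)).
  have HG x : D2 x -> always (step_output (n x.1.1)) (G x).
    by case/HD2 => Dx [_ [r [_ Ix]]]; case: (InvF _ _ _ _ Dx Ix).
  (* The given online program enters here as a subroutine, with its own per-step limit as running
     time. *)
  have HA : ptime (fun x => sz x.1.1) D2
      (fun x => DPair x.2.2.1 (DNum x.2.1)) (fun x => dmap (odflt (DNum 0)) (G x)).
    exists A, (fun x => tau x.1.1); split; first exact: pbd_lift (bl _ taub) DD2.
    by move=> x /HG H; apply: exec_runs; apply: always_imp H _ => _ [m [l [-> _]]].
  have HA2 := ptime_dseq Harg b2 HA.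
  suff H : ptime (fun x => sz x.1.1) D2 env2 (fun x => dbind (G x) (fun o => dmap h
      (if o is Some (DPair m' y) then
        Ret (m', improve (M x.1.1) (n x.1.1) (k x.1.1) x.2.2.2 (decn y)) else Ret x.2.2))).
    by apply: eq_ptime H => x _; rewrite /play_step dmap_dbind.
  apply: (@ptime_bind _ _ _ _ _ (fun x => step_output (n x.1.1))
     (fun _ => odflt (DNum 0)) _ _ HA2 b2 HG).
  move=> D3 HD3 env3 b3; have DD3 x : D3 x -> D2 x.1 by case/HD3.
  have L3 f (H : dptime (fun x => sz x.1.1) D2 env2 f) :=
    @ptime_lift _ (option data) _ _ D3 _ (fun y => Ret (f y))
     (fun x => odflt (DNum 0) x.2) H b3 DD3.
  pose fst3 (o : option data) := if odflt (DNum 0) o is DPair m _ then m else DNum 0.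
  pose snd3 (o : option data) := if odflt (DNum 0) o is DPair _ y then y else DNum 0.
  have Ho := ptime_var1 (a := fun x : I * seq nat * (nat * (data * seq nat)) * option data =>
    odflt (DNum 0) x.2) b3.
  have Hm' : dptime (fun x => sz x.1.1.1) D3 env3 (fun x => fst3 x.2) := ptime_dfst b3 Ho.
  have Hy : dptime (fun x => sz x.1.1.1) D3 env3 (fun x => snd3 x.2) := ptime_dsnd b3 Ho.
  have {}Hy : dptime (fun x => sz x.1.1.1) D3 env3 (fun x => nlist (decn (snd3 x.2))).
    by apply: eq_ptime Hy => x /HD3[_ [m [l [-> _]]]]; rewrite /snd3 /= decn_nlist.
  have Himp : dptime (fun x => sz x.1.1.1) D3 env3 (fun x => nlist
      (improve (M x.1.1.1) (n x.1.1.1) (k x.1.1.1) x.1.2.2.2 (decn (snd3 x.2)))).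
    apply: (ptime_improve b3 (M := fun x => M x.1.1.1) (n := fun x => n x.1.1.1)
      (k := fun x => k x.1.1.1) (best := fun x => x.1.2.2.2)
      (s := fun x => decn (snd3 x.2))) => //.
    - exact: (L3 _ (L2 _ (L1 _ HM))).
    - exact: (L3 _ (L2 _ (L1 _ Hn))).
    - exact: (pbd_lift (pbd_lift (bl _ nb) DD2) DD3).
    - exact: (L3 _ (L2 _ (L1 _ Hk))).
    - exact: (L3 _ (ptime_snd b2 Hst)).
    - move=> x /HD3[/HD2[/DD1 /HD [_ kn _] [_ [r [_ [/and3P[_ _ bn] _ _]]]]] [m [l [-> ln]]]].
      by split=> //; rewrite /snd3 /= decn_nlist.
  have := ptime_pair b3 Hm' Himp.
  by apply: eq_ptime => x /HD3[_ [m [l [-> _]]]].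
apply: (@ptime_bind _ _ _ _ _ (fun _ _ => True) (fun _ => h) _
  (fun _ st => Ret (nlist st.2)) Hfold b1) => [x _|]; first exact: always_true.
move=> D2 HD2 env2 b2.
have H := ptime_var1 (a := fun x : I * seq nat * (data * seq nat) => h x.2) b2.
exact: (ptime_snd b2 H).
Qed.

End Trial.

(** The algorithm interleaves serving and comparing. Since the best solution has no influence on the
    memory, the result is that of a complete play followed by a fold over its configurations, and
    the regret bound speaks of that play. *)
Lemma foldD_play (n k tau : nat) A M m best (xs : seq 'I_n) :
  always (@isSome _) (play k tau A m xs) ->
  dmap snd (foldD (play_step A tau M n k) (m, best) (map val xs)) =
  dmap (fun o => foldl (improve M n k) best [seq map val (tval C) | C <- odflt [::] o])
    (play k tau A m xs).
Proof.
elim: xs m best => [|x xs IHxs] m best //= /always_dbind H.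
rewrite !dmap_dbind /play_step dbindA; apply: eq_dbind_in H _ => -[[z|m' y]|] //=.
case E : (dec_config n k y) => [C|] //= /always_dmap HC.
rewrite -[LHS]/(dmap _ _) IHxs; last by apply: always_imp HC _ => -[].
rewrite dmap_comp (dec_configE E) decn_nlist.
by apply: (eq_dbind_in HC) => -[Cs|].
Qed.

Lemma foldl_improve_points M n k best (Cs : seq (config n k)) : k <= n -> points n k best ->
  points n k (foldl (improve M n k) best [seq map val (tval C) | C <- Cs]).
Proof.
move=> kn; elim: Cs best => [|C Cs IHCs] best //= bp.
have Cn : all (fun x => x < n) (map val C) by apply/allP => _ /mapP[z _ ->]; apply: ltn_ord.
by apply: IHCs; apply: improve_points.
Qed.

Lemma nats_to_ords n (s : seq nat) : all (fun x => x < n) s ->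
  exists xs : seq 'I_n, s = map val xs.
Proof.
elim: s => [|y l IHl] /=; first by exists [::].
by case/andP=> yn /IHl [l' ->]; exists (Ordinal yn :: l').
Qed.

Lemma pad_nil_points n k : k <= n -> points n k (pad n k [::]).
Proof.
by move=> kn; case: (@pad_props n k [::] kn isT); rewrite /points => -> -> ->; rewrite eqxx.
Qed.

Section TrialProps.
Variables (A : prog) (p : {poly nat}) (c kappa a b : nat).

Definition trial_tau M n s :=
  (p.[n + alg_horizon a b n + dsize (DPair (DNum (scale c M n s))
       (enc_mx (truncate M n (scale c M n s))))])%R.

Definition trial_mem M n k s :=
  trial_input a b n k (scale c M n s) (truncate M n (scale c M n s)).

(** Demanded for every guess [s], since the whole algorithm must halt in time even at useless
    truncation levels. *)
Definition safe M n k := forall s (xs : (alg_horizon a b n).-tuple 'I_n),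
  always (@isSome _) (play k (trial_tau M n s) A (trial_mem M n k s) xs).

Lemma trial_play M n k best s : 0 < n -> safe M n k ->
  always (fun xs => exists ys : (alg_horizon a b n).-tuple 'I_n, xs = map val ys /\
    dmap snd (foldD (play_step A (trial_tau M n s) M n k) (trial_mem M n k s, best) xs) =
    dmap (fun o => foldl (improve M n k) best [seq map val (tval C) | C <- odflt [::] o])
     (play k (trial_tau M n s) A (trial_mem M n k s) ys))
   (draws n (n + kappa) (alg_horizon a b n)).
Proof.
move=> n0 sf; apply: always_imp (draws_inv _ _ n0) _ => xs [sx /nats_to_ords[ys E]].
have sy : size ys == alg_horizon a b n by rewrite -sx E size_map.
exists (Tuple sy); split=> //; rewrite E.
exact: foldD_play (sf s (Tuple sy)).
Qed.

Lemma trial_points M n k best s : 0 < n -> k <= n -> safe M n k ->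
  points n k best ->
  always (points n k) (trial A p c kappa a b M n k best s).
Proof.
move=> n0 kn sf bp; apply/always_dbind.
apply: always_imp (trial_play best s n0 sf) _ => _ [ys [-> ->]].
by apply/always_dmap; apply: always_true => o; apply: foldl_improve_points.
Qed.

Lemma median_alg_points m M n k : 0 < n -> k <= n -> safe M n k ->
  always (points n k) (median_alg A p c kappa a b m M n k).
Proof.
move=> n0 kn sf.
apply: (foldD_always (Inv := fun _ => points n k)).
  by move=> s _ bst bp; apply: trial_points.
exact: pad_nil_points.
Qed.

End TrialProps.

Section MedianAlg.
Variables (A : prog) (p : {poly nat}) (c kappa a b m : nat).
Variables (I : Type) (sz : I -> nat) (D : I -> Prop) (env : I -> data).
Hypothesis envb : bounded sz D env.
Notation ok f := (dptime sz D env f).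
Notation okn a := (dptime sz D env (fun i => DNum (a i))).
Variables (M : I -> seq (seq nat)) (n k : I -> nat).

Lemma ptime_median_alg :
  ok (fun i => enc_mx (M i)) -> okn n -> pbd sz D n -> okn k ->
  (forall i, D i -> [/\ 0 < n i, k i <= n i & safe A p c a b (M i) (n i) (k i)]) ->
  ptime sz D env
   (fun i => dmap nlist (median_alg A p c kappa a b m (M i) (n i) (k i))).
Proof.
move=> HM Hn nb Hk HD.
have kb : pbd sz D k by apply: pbd_le nb _ => i /HD[].
have Nb : pbd sz D (fun i => n i * n i * m) by apply: pbdM (pbdM nb nb) (pbd_cst _ _ _).
have HN : okn (fun i => n i * n i * m).
  exact: (ptime_arith OpMul envb (ptime_arith OpMul envb Hn Hn) (ptime_cst m envb)).
apply: (ptime_foldD envb (g := DNum) (h := nlist) (ls := fun i => iota 0 (n i * n i * m))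
    (s0 := fun i => pad (n i) (k i) [::])
    (F := fun i => trial A p c kappa a b (M i) (n i) (k i))
    (Inv := fun i r bst => all (fun s => s < n i * n i * m) r /\ points (n i) (k i) bst)
    (B := fun i => k i * (n i).+2 + 1)).
- exact: ptime_iota.
- by apply: ptime_pad => //; apply: ptime_cst.
- move=> i /HD[_ kn _]; split; last exact: pad_nil_points.
  by apply/allP => s; rewrite mem_iota.
- move=> i s r bst /HD[n0 kn sf] [/= /andP[_ rn] bp].
  by apply: always_imp (trial_points kappa s n0 kn sf bp) _ => bst'.
- exact: (pbdD (pbdM kb (pbdS (pbdS nb))) (pbd_cst _ _ 1)).
- move=> i r bst _ [_ /and3P[_ /eqP bk /allP bn]].
  have bn' : all (fun y => y <= n i) bst by apply/allP => y /bn /ltnW.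
  apply: leq_trans (dsize_nlist bn') _.
  have ll x : trunc_log 2 x <= x by apply: trunc_log_lt2 (ltn_expl _ _).
  by rewrite bk leq_add2r leq_mul2l /= !ltnS ll orbT.
- move=> D1 HD1 env1 b1; have DD1 x : D1 x -> D x.1 by case/HD1.
  have L1 f (H : ok f) := ptime_lift H b1 DD1.
  apply: (ptime_trial _ b1 (M := fun x => M x.1) (n := fun x => n x.1) (k := fun x => k x.1)
    (best := fun x => x.2.2) (s := fun x => x.2.1)).
  + exact: (L1 _ HM).
  + exact: (L1 _ Hn).
  + exact: pbd_lift nb DD1.
  + exact: (L1 _ Hk).
  + exact: (ptime_var2' (a := fun x : I * (nat * seq nat) => DNum x.2.1) b1).
  + exact: (ptime_var2 (a := fun x : I * (nat * seq nat) => DNum x.2.1) b1).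
  + apply: pbd_le (pbd_lift Nb DD1) _ => x /HD1[_ [_ [r [_ [/= /andP[/ltnW]]]]]].
    by [].
  + by move=> x /HD1[/HD[n0 kn _] [_ [r [_ [_ bp]]]]].
  + by move=> x /DD1 /HD[_ _ sf] L M' T tau xs; apply: sf.
Qed.

End MedianAlg.

(** * Expectations *)

Local Open Scope ring_scope.

Lemma always_forall (A K : Type) (P : K -> A -> Prop) (m : rdist A) :
  (forall x, always (P x) m) -> always (fun a => forall x, P x a) m.
Proof.
elim: m => [a|m0 IH0 m1 IH1] //= H.
by split; [apply: IH0|apply: IH1] => x; have [] := H x.
Qed.

Section Expect.
Variable R : realType.

Lemma expect_dbind A B (f : B -> R) (m : rdist A) (g : A -> rdist B) :
  expect f (dbind m g) = expect (fun a => expect f (g a)) m.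
Proof. by elim: m => [a|m0 IH0 m1 IH1] //=; rewrite IH0 IH1. Qed.

Lemma expect_dmap A B (f : B -> R) (m : rdist A) (g : A -> B) :
  expect f (dmap g m) = expect (fun a => f (g a)) m.
Proof. exact: expect_dbind. Qed.

Lemma expect_le A (P : A -> Prop) (f g : A -> R) (m : rdist A) :
  always P m -> (forall a, P a -> f a <= g a) -> expect f m <= expect g m.
Proof.
move=> + fg; elim: m => [a|m0 IH0 m1 IH1] /=; first exact: fg.
by case=> /IH0 ? /IH1 ?; rewrite ler_pM2r ?invr_gt0 ?ltr0n // lerD.
Qed.

Lemma eq_expect_in A (P : A -> Prop) (f g : A -> R) (m : rdist A) :
  always P m -> (forall a, P a -> f a = g a) -> expect f m = expect g m.
Proof.
move=> + fg; elim: m => [a|m0 IH0 m1 IH1] /=; first exact: fg.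
by case=> /IH0 -> /IH1 ->.
Qed.

Lemma eq_expect A (f g : A -> R) (m : rdist A) : f =1 g -> expect f m = expect g m.
Proof. by move=> fg; apply: (@eq_expect_in _ (fun=> True)) => //; apply: always_true. Qed.

Lemma expect_cst A (v : R) (m : rdist A) : expect (fun=> v) m = v.
Proof. by elim: m => [a|m0 IH0 m1 IH1] //=; rewrite IH0 IH1; field. Qed.

Lemma expectD A (f g : A -> R) (m : rdist A) :
  expect (fun a => f a + g a) m = expect f m + expect g m.
Proof. by elim: m => [a|m0 IH0 m1 IH1] //=; rewrite IH0 IH1; field. Qed.

Lemma expectZ A (v : R) (f : A -> R) (m : rdist A) :
  expect (fun a => v * f a) m = v * expect f m.
Proof. by elim: m => [a|m0 IH0 m1 IH1] //=; rewrite IH0 IH1; field. Qed.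

Lemma expect_swap A B (f : A -> B -> R) (m1 : rdist A) (m2 : rdist B) :
  expect (fun a => expect (fun b => f a b) m2) m1 =
  expect (fun b => expect (fun a => f a b) m1) m2.
Proof.
elim: m1 => [a|m0 IH0 m1 IH1] //=; rewrite IH0 IH1 -expectD mulrC -expectZ.
by apply: eq_expect => b; rewrite mulrC.
Qed.

Lemma expect_draw_bits (f : nat -> R) b :
  expect f (draw_bits b) = (\sum_(0 <= u < (2 ^ b)%N) f u) / (2 ^ b)%:R.
Proof.
rewrite /draw_bits -{2 3}(size_iota 0 b).
(* After leading bits of value [u], the result is uniform on the block of length [2 ^ size l] that
   starts at [u * 2 ^ size l]. *)
suff H u l : expect f (foldD (fun u (_ : nat) => dbind coin (fun c => Ret (c + (u + u))%N)) u l)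
    = (\sum_(0 <= v < (2 ^ size l)%N) f (u * 2 ^ size l + v)%N) / (2 ^ size l)%:R.
  by rewrite H; congr (_ / _); apply: eq_bigr => v _; rewrite mul0n.
elim: l u => [|x l IHl] u /=; first by rewrite big_nat1 muln1 addn0 divr1.
rewrite !IHl expnS mul2n -addnn.
set s := (2 ^ size l)%N.
have shift (G : nat -> R) : \sum_(s <= i < s + s) G i = \sum_(0 <= i < s) G (i + s)%N.
  by rewrite -{1}[s]add0n big_addn addnK.
rewrite [in RHS](@big_cat_nat _ _ _ s) ?leq_addr //= shift.
have s0 : s%:R != 0 :> R by rewrite pnatr_eq0 -lt0n expn_gt0.
have -> : \sum_(0 <= i < s) f (u * (s + s) + i)%N = \sum_(0 <= i < s) f ((0 + (u + u)) * s + i)%N.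
  by apply: eq_bigr => i _; congr f; lia.
have -> : \sum_(0 <= i < s) f (u * (s + s) + (i + s))%N =
    \sum_(0 <= i < s) f ((1 + (u + u)) * s + i)%N.
  by apply: eq_bigr => i _; congr f; lia.
rewrite natrD; field; rewrite s0 /=.
by rewrite -mulr2n mulrn_eq0 negb_or s0.
Qed.

Lemma sum_mod (f : nat -> R) n q :
  \sum_(0 <= u < q * n) f (u %% n)%N = q%:R * \sum_(0 <= x < n) f x.
Proof.
elim: q => [|q IHq]; first by rewrite mul0n big_geq // mul0r.
rewrite mulSn addnC (@big_cat_nat _ _ _ (q * n)%N) ?leq_addr //= IHq.
have shift (G : nat -> R) :
    \sum_(q * n <= i < q * n + n) G i = \sum_(0 <= i < n) G (i + q * n)%N.
  by rewrite -{1}[(q * n)%N]add0n big_addn addKn.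
rewrite shift -[q.+1]addn1 natrD mulrDl mul1r; congr (_ + _).
by apply: eq_big_nat => x /andP[_ xn]; rewrite addnC modnMDl modn_small.
Qed.

(** With [q = 2 ^ b %/ n], the range [2 ^ b] lies between [q * n] and [q.+1 * n], so each residue is
    hit [q] or [q.+1] times. *)
Lemma expect_draw (f : nat -> R) n b : (0 < n)%N -> (forall x, 0 <= f x) ->
  (2 ^ b %/ n)%:R * \sum_(0 <= x < n) f x <= (2 ^ b)%:R * expect f (draw n b)
    <= (2 ^ b %/ n).+1%:R * \sum_(0 <= x < n) f x.
Proof.
move=> n0 f0; set q := (2 ^ b %/ n)%N; rewrite expect_dmap expect_draw_bits.
rewrite mulrCA mulfV ?mulr1; last first.
  by rewrite pnatr_eq0 -lt0n expn_gt0.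
have Eb : (q * n <= 2 ^ b)%N by apply: leq_divM.
have Eb' : (2 ^ b <= q.+1 * n)%N by rewrite ltnW // ltn_ceil.
rewrite -!sum_mod; apply/andP; split.
  by rewrite [leRHS](@big_cat_nat _ _ _ (q * n)%N) //= lerDl sumr_ge0.
by rewrite [leRHS](@big_cat_nat _ _ _ (2 ^ b)%N) //= lerDl sumr_ge0.
Qed.

Lemma foldD_rcons A B (F : A -> B -> rdist A) s l v :
  foldD F s (rcons l v) = dbind (foldD F s l) (fun s' => F s' v).
Proof.
elim: l s => [|u l IHl] s /=; first by rewrite dbind_Ret_id.
by rewrite dbindA; apply: eq_dbind => s'; apply: IHl.
Qed.

(** The head of the list is the value drawn last; independence allows it to be treated as drawn
    first, which is the order in which requests are served. *)
Lemma expect_drawsS (f : seq nat -> R) n b T :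
  expect f (draws n b T.+1) =
  expect (fun x => expect (fun xs => f (x :: xs)) (draws n b T)) (draw n b).
Proof.
rewrite /draws -[T.+1]addn1 iotaD cats1 foldD_rcons expect_dbind.
rewrite expect_swap; apply: eq_expect => xs.
by rewrite expect_dmap.
Qed.

End Expect.

(** * From regret to average cost *)

Section Minover.
Variables (R : realType) (I : eqType).
Implicit Types (s : seq I) (f : I -> R).

Lemma minover_le s f b : b \in s -> minover s f <= f b.
Proof.
case: s => //= a s; rewrite inE; elim: s => [|c s IHs] /=.
  by rewrite orbF => /eqP->; rewrite big_nil.
rewrite inE big_cons ge_min => /orP[/eqP ba|/orP[/eqP<-|bs]].
- by rewrite IHs ?orbT // ba eqxx.
- by rewrite lexx.
- by rewrite IHs ?orbT // bs orbT.
Qed.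

Lemma minover_attained s f : s != [::] -> exists2 b, b \in s & minover s f = f b.
Proof.
case: s => //= a s _; elim: s => [|c s [b bs E]].
  by exists a; rewrite ?mem_head ?big_nil.
rewrite big_cons E; case: leP => _; first by exists c; rewrite // !inE eqxx orbT.
by exists b => //; move: bs; rewrite !inE => /orP[->|->] //; rewrite !orbT.
Qed.

Lemma le_minover s f v : s != [::] -> (forall b, b \in s -> v <= f b) -> v <= minover s f.
Proof. by move=> /minover_attained - /(_ f) [b bs ->]; apply. Qed.

End Minover.

Section Regret.
Variables (R : realType) (n k : nat) (X : metric R n) (A : prog) (tau b : nat) (x0 : 'I_n).
Hypothesis k0 : (0 < k)%N.

Definition nearest (x : 'I_n) (C : config n k) : R := minover C (fun y => mdist X y x).

Definition toord (x : nat) : 'I_n := insubd x0 x.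

Lemma toordK (xs : seq 'I_n) : map toord (map val xs) = xs.
Proof. by rewrite -map_comp -[RHS]map_id; apply: eq_map => x; rewrite /= /toord valKd. Qed.

Definition average (C : config n k) : R := expect (fun x => nearest (toord x) C) (draw n b).

Let n0 : (0 < n)%N. Proof. exact: leq_ltn_trans (ltn_ord x0). Qed.

Lemma config_neq0 (C : config n k) : tval C != [::].
Proof. by rewrite -size_eq0 size_tuple -lt0n. Qed.

Lemma mdist_ge0 x y : 0 <= mdist X x y.
Proof. by have [H _ _ _] := metricP X; apply: H. Qed.

Lemma nearest_ge0 x C : 0 <= nearest x C.
Proof.
by rewrite /nearest; have [y _ ->] := minover_attained (fun y => mdist X y x) (config_neq0 C);
  apply: mdist_ge0.
Qed.

(** From [x], go to the nearest server of [C'] and on to the server of [C] matched with it. *)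
Lemma nearest_move x (C C' : config n k) : nearest x C <= nearest x C' + config_dist X C' C.
Proof.
have [_ _ _ tri] := metricP X; have [_ _ sym _] := metricP X.
rewrite /nearest; have [y yC' ->] := minover_attained (fun y => mdist X y x) (config_neq0 C').
rewrite -lerBlDl; apply: le_minover => [|s _].
  by rewrite -size_eq0 -cardE card_Sn -lt0n fact_gt0.
have /tnthP[i Ei] := yC'.
apply: (@le_trans _ _ (mdist X y (tnth C (s i)))).
  rewrite lerBlDl; apply: le_trans (minover_le _ (mem_tnth (s i) C)) _.
  by rewrite addrC; apply: le_trans (tri _ y _) _; rewrite lerD2r sym.
by rewrite Ei (bigD1 i) //= lerDl sumr_ge0 // => j _; apply: mdist_ge0.
Qed.

Lemma online_cost_ge xs (Cs : seq (config n k)) C : size Cs = size xs ->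
  \sum_(r <- zip xs (C :: Cs)) nearest r.1 r.2 <=
  \sum_(r <- zip xs Cs) loss X r.1 r.2 + \sum_(r <- zip Cs (C :: Cs)) config_dist X r.1 r.2.
Proof.
elim: xs Cs C => [|x xs IHxs] [|C1 Cs] C //=; first by rewrite !big_nil addr0.
case=> E; rewrite !big_cons /=; have := IHxs Cs C1 E.
have := nearest_move x C C1; have := nearest_ge0 x C1.
rewrite /loss -/(nearest x C1); lra.
Qed.

Lemma play_size m (xs : seq 'I_n) :
  always (fun o => size (odflt [::] o) = size xs \/ o = None) (play k tau A m xs).
Proof.
elim: xs m => [|x xs IHxs] m /=; first by left.
apply/always_dbind; apply: always_true => -[[z|m' y]|] /=; try by right.
case: dec_config => [C|] /=; last by right.
apply/always_dmap; apply: always_imp (IHxs m') _ => -[Cs|] /=; last by right.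
by case=> // ->; left.
Qed.

(** The first step does not see later requests, so its outcome must be good for all continuations at
    once; this is where [always_forall] serves. *)
Lemma play_ok_step T m :
  (forall xs : seq 'I_n, size xs = T.+1 -> always (@isSome _) (play k tau A m xs)) ->
  forall x : 'I_n, always (fun o => exists m' y (C : config n k), 
     [/\ o = Some (DPair m' y), dec_config n k y = Some C &
     forall xs : seq 'I_n, size xs = T -> always (@isSome _) (play k tau A m' xs)])
    (exec tau A (DPair m (DNum x))).
Proof.
move=> H x.
have H1 : always (fun o => forall xs : seq 'I_n, size xs = T ->
    exists m' y (C : config n k), [/\ o = Some (DPair m' y), dec_config n k y = Some C
       & always (@isSome _) (play k tau A m' xs)]) (exec tau A (DPair m (DNum x))).
  apply: always_forall => xs.
  case: (size xs =P T) => [sx|sx]; last by apply: always_true.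
  have /always_dbind := H (x :: xs) (congr1 S sx).
  move=> H'; apply: always_imp H' _ => -[[z|m' y]|] //=.
  case E : (dec_config n k y) => [C|] //= /always_dmap HC _.
  by exists m', y, C; split=> //; apply: always_imp HC _ => -[].
apply: always_imp H1 _ => o Ho.
have [m' [y [C [Eo EC _]]]] := Ho (nseq T x0) (size_nseq _ _).
exists m', y, C; split=> // xs /Ho [m1 [y1 [C1 [Eo1 _]]]].
by move: Eo1; rewrite Eo => -[<- _].
Qed.

Lemma expect_play_cons (f : option (seq (config n k)) -> R) m x (xs : seq 'I_n) :
  expect f (play k tau A m (x :: xs)) =
  expect (fun o => if o is Some (DPair m' y) then
        if dec_config n k y is Some C then
          expect (fun o => f (omap (cons C) o)) (play k tau A m' xs)
        else f None else f None) (exec tau A (DPair m (DNum x))).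
Proof.
rewrite /= expect_dbind; apply: eq_expect => -[[z|m' y]|] //=.
by case: dec_config => // C; rewrite expect_dmap.
Qed.

Definition Eseq T (f : seq 'I_n -> R) : R := expect (fun xs => f (map toord xs)) (draws n b T).

Lemma EseqS T f : Eseq T.+1 f =
  expect (fun x => Eseq T (fun xs => f (toord x :: xs))) (draw n b).
Proof. exact: expect_drawsS. Qed.

Lemma Eseq_le T f g : (forall xs : seq 'I_n, size xs = T -> f xs <= g xs) ->
  Eseq T f <= Eseq T g.
Proof.
move=> fg; apply: expect_le (draws_inv b T n0) _ => xs [sx _].
by apply: fg; rewrite size_map.
Qed.

(* Each configuration is chosen before the request that follows it is drawn, so its expected
   distance to that request is its average cost. *)
Lemma expect_nearest T m (C0 : config n k) :
  (forall xs : seq 'I_n, size xs = T -> always (@isSome _) (play k tau A m xs)) ->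
  Eseq T (fun xs => expect (fun o => \sum_(r <- zip xs (C0 :: odflt [::] o)) nearest r.1 r.2)
     (play k tau A m xs)) =
  Eseq T (fun xs => expect (fun o => \sum_(C <- take T (C0 :: odflt [::] o)) average C)
     (play k tau A m xs)).
Proof.
elim: T m C0 => [|T IHT] m C0 H.
  by rewrite /Eseq /draws /= !big_nil.
have Hs := play_ok_step H.
(* Both sides lose their first summand in the same way: it depends on the first request at most, and
   its expectation is [average C0] on either side. *)
have split1 (g : 'I_n -> R) (F G : seq 'I_n -> option (seq (config n k)) -> R) :
    (forall x xs C Cs, F (x :: xs) (Some (C :: Cs)) = g x + G xs (Some (C :: Cs))) ->
    Eseq T.+1 (fun xs => expect (F xs) (play k tau A m xs)) =
    expect (fun x => g (toord x)) (draw n b) +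
    expect (fun x => expect (fun o => if o is Some (DPair m' y) then
        if dec_config n k y is Some C then
          Eseq T (fun xs => expect (fun o => G xs (omap (cons C) o)) (play k tau A m' xs))
        else 0 else 0) (exec tau A (DPair m (DNum (toord x))))) (draw n b).
  move=> FG; rewrite EseqS -expectD; apply: eq_expect => x; rewrite /Eseq.
  under eq_expect do rewrite expect_play_cons.
  (* The coin flips of this step are independent of the requests still to come, so the expectations
     are exchanged and the outcome of the step is fixed first. *)
  rewrite expect_swap -[X in X + _](expect_cst _ (exec tau A (DPair m (DNum (toord x))))).
  rewrite -expectD; apply: eq_expect_in (Hs (toord x)) _ => _ [m' [y [C [-> EC Hm']]]].
  rewrite EC -[X in X + _](expect_cst _ (draws n b T)) -expectD.
  apply: eq_expect_in (draws_inv b T n0) _ => xs [sx _].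
  rewrite -[X in X + _](expect_cst _ (play k tau A m' (map toord xs))) -expectD.
  have := Hm' (map toord xs); rewrite size_map => /(_ sx) Hp.
  by apply: eq_expect_in Hp _ => -[Cs|] //= _; apply: FG.
rewrite (split1 (fun x => nearest x C0) _
   (fun xs o => \sum_(r <- zip xs (odflt [::] o)) nearest r.1 r.2)); last first.
  by move=> x xs C Cs /=; rewrite big_cons.
rewrite (split1 (fun x => average C0) _
   (fun xs o => \sum_(C <- take T (odflt [::] o)) average C)); last first.
  by move=> x xs C Cs /=; rewrite big_cons.
rewrite expect_cst; congr (_ + _).
apply: eq_expect => x; apply: eq_expect_in (Hs (toord x)) _ => _ [m' [y [C [-> EC Hm']]]].
rewrite EC; have := IHT m' C Hm'; rewrite /Eseq.
set l := expect _ _; set r := expect _ _ => lr.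
transitivity l; last (rewrite lr; symmetry).
- apply: eq_expect_in (draws_inv b T n0) _ => xs [sx _].
  have := Hm' (map toord xs); rewrite size_map => /(_ sx) Hp.
  by apply: eq_expect_in Hp _ => -[Cs|].
- apply: eq_expect_in (draws_inv b T n0) _ => xs [sx _].
  have := Hm' (map toord xs); rewrite size_map => /(_ sx) Hp.
  by apply: eq_expect_in Hp _ => -[Cs|].
Qed.

Lemma average_ge0 C : 0 <= average C.
Proof.
rewrite -(expect_cst 0 (draw n b)); apply: (expect_le (P := fun=> True)) => [|x _].
  exact: always_true.
exact: nearest_ge0.
Qed.

Lemma EseqD T f g : Eseq T (fun xs => f xs + g xs) = Eseq T f + Eseq T g.
Proof. exact: expectD. Qed.

Lemma EseqZ T v f : Eseq T (fun xs => v * f xs) = v * Eseq T f.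
Proof. exact: expectZ. Qed.

Lemma Eseq_cst T v : Eseq T (fun=> v) = v.
Proof. exact: expect_cst. Qed.

Lemma Eseq_loss T C : Eseq T (fun xs => \sum_(x <- xs) loss X x C) = T%:R * (2 * average C).
Proof.
elim: T => [|T IHT]; first by rewrite /Eseq /draws /= big_nil mul0r.
rewrite EseqS; transitivity (expect (fun x => 2 * nearest (toord x) C +
    Eseq T (fun xs => \sum_(x <- xs) loss X x C)) (draw n b)).
  apply: eq_expect => x; rewrite -[2 * _](Eseq_cst T) -EseqD.
  by apply: eq_expect => xs /=; rewrite big_cons.
by rewrite expectD expectZ expect_cst IHT -/(average C) -[T.+1]addn1 natrD; ring.
Qed.

(** The online cost contains no move into the first configuration, so the distance of the first
    request to the fictitious start [C] is charged separately. *)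
Lemma online_cost_next x xs (Cs : seq (config n k)) C : size Cs = (size xs).+1 ->
  \sum_(r <- zip (x :: xs) (C :: Cs)) nearest r.1 r.2 <= nearest x C + online_cost X (x :: xs) Cs.
Proof.
case: Cs => //= C1 Cs [E]; rewrite /online_cost /= !big_cons /= lerD2l.
apply: le_trans (online_cost_ge C1 E) _.
by rewrite -addrA lerDr mulr_ge0 ?ler0n //; apply: nearest_ge0.
Qed.

(** Markov's inequality for the sum of the averages of the configurations visited. No request
    follows the last one, hence [T] out of [T.+1]. [Cs0] is both the offline competitor and the
    fictitious start; as a start it contributes [average Cs0] to both sides, which cancels. *)
Lemma regret_markov T m (r v : R) (Cs0 : config n k) : 0 <= v ->
  (forall xs : seq 'I_n, size xs = T.+1 -> always (@isSome _) (play k tau A m xs)) ->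
  (forall xs : seq 'I_n, size xs = T.+1 ->
     expect (fun o => if o is Some Cs then online_cost X xs Cs else 0) (play k tau A m xs)
     <= offline_opt k X xs + r) ->
  T%:R * v * Eseq T.+1 (fun xs => prob R (fun o => all (fun C => v <= average C) (odflt [::] o))
     (play k tau A m xs)) <= T.+1%:R * (2 * average Cs0) + r.
Proof.
move=> v0 Hp Hr.
pose S (Cs : option (seq (config n k))) := \sum_(C <- take T.+1 (Cs0 :: odflt [::] Cs)) average C.
have psz (xs : seq 'I_n) : size xs = T.+1 ->
    always (fun o => isSome o /\ size (odflt [::] o) = T.+1) (play k tau A m xs).
  move=> sx; have := always_and (Hp _ sx) (play_size m xs).
  by move=> H; apply: always_imp H _ => -[Cs|] //= [_ []] // ->; rewrite sx.
rewrite -(lerD2l (average Cs0)).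
apply: (@le_trans _ _ (Eseq T.+1 (fun xs => expect S (play k tau A m xs)))).
  rewrite -{1}[average Cs0](Eseq_cst T.+1) -EseqZ -EseqD; apply: Eseq_le => xs sx.
  rewrite -{1}[average Cs0](expect_cst _ (play k tau A m xs)) -expectZ -expectD.
  apply: expect_le (psz _ sx) _ => -[Cs|] [] //= _ sC.
  rewrite /S /= big_cons lerD2l.
  case: allP => H; last by rewrite mulr0 sumr_ge0 // => C _; apply: average_ge0.
  rewrite mulr1; have {1}-> : T = size (take T Cs) by rewrite size_takel // sC.
  have : {subset take T Cs <= Cs} by apply: mem_take.
  elim: (take T Cs) => [|C l IHl] sub; first by rewrite big_nil mul0r.
  rewrite big_cons /= -[(size l).+1]addn1 natrD mulrDl mul1r addrC lerD //.
    by apply: H; apply: sub; apply: mem_head.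
  by apply: IHl => D Dl; apply: sub; rewrite inE Dl orbT.
rewrite -(expect_nearest Cs0 Hp).
apply: (@le_trans _ _ (Eseq T.+1 (fun xs => nearest (head x0 xs) Cs0 +
    (\sum_(x <- xs) loss X x Cs0 + r)))).
  apply: Eseq_le => -[|x xs] // sx.
  apply: (@le_trans _ _ (nearest x Cs0 + expect (fun o => if o is Some Cs then
       online_cost X (x :: xs) Cs else 0) (play k tau A m (x :: xs)))).
    rewrite -[X in X + _](expect_cst _ (play k tau A m (x :: xs))) -expectD.
    apply: expect_le (psz _ sx) _ => -[Cs|] [] //= _ sC.
    by apply: online_cost_next; rewrite sC -sx.
  rewrite /= lerD2l; apply: le_trans (Hr _ sx) _; rewrite lerD2r.
  exact: minover_le (mem_enum _ _).
rewrite EseqD (EseqD _ (fun xs => \sum_(x <- xs) _)) Eseq_loss Eseq_cst.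
rewrite EseqS /=; under eq_expect do rewrite Eseq_cst.
by [].
Qed.

End Regret.

(** * Truncated metrics and median costs *)

Lemma mind_le M x (s : seq nat) a : a \in s -> (mind M x s <= mget M x a)%N.
Proof.
rewrite /mind; move: (mget M x (head 0%N s)) => m.
have mono l : forall m', (foldl (fun m a => minn m (mget M x a)) m' l <= m')%N.
  by elim: l => //= c l IHl m'; apply: leq_trans (IHl _) (geq_minl _ _).
elim: s m => //= c s IHs m; rewrite inE => /orP[/eqP->|/IHs //].
exact: leq_trans (mono _ _) (geq_minr _ _).
Qed.

Lemma mind_attained M x (s : seq nat) : s != [::] ->
  exists2 a, a \in s & mind M x s = mget M x a.
Proof.
case: s => // c s _; rewrite /mind /= minnn.
suff H l c' : exists2 a, a \in c' :: l &
   foldl (fun m a => minn m (mget M x a)) (mget M x c') l = mget M x a by apply: H.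
elim: l c' => [|d l IHl] c' /=; first by exists c'; rewrite ?mem_head.
rewrite /minn; case: ifP => _.
  by have [a al ->] := IHl c'; exists a => //;
    move: al; rewrite !inE => /orP[->|->] //; rewrite !orbT.
by have [a al ->] := IHl d; exists a => //; rewrite inE al orbT.
Qed.

Lemma mind_subset M x (s t : seq nat) : s != [::] -> {subset s <= t} ->
  (mind M x t <= mind M x s)%N.
Proof. by move=> s0 st; have [a /st /(mind_le M x) at_ ->] := mind_attained M x s0. Qed.

Lemma mcostE M n s : mcost M n s = (\sum_(0 <= x < n) mind M x s)%N.
Proof.
suff H l z : foldl (fun m x => m + mind M x s)%N z l = (z + \sum_(x <- l) mind M x s)%N.
  by rewrite /mcost H /index_iota subn0.
elim: l z => [|x l IHl] z /=; first by rewrite big_nil addn0.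
by rewrite IHl big_cons addnA.
Qed.

Lemma mcost_subset M n s t : s != [::] -> {subset s <= t} -> (mcost M n t <= mcost M n s)%N.
Proof. by move=> s0 st; rewrite !mcostE leq_sum // => x _; apply: mind_subset. Qed.

Lemma improve_le M n k best s : (mcost M n (improve M n k best s) <= mcost M n best)%N.
Proof. by rewrite /improve; case: (leqP (mcost M n best)) => // /ltnW. Qed.

Lemma improve_le_pad M n k best s :
  (mcost M n (improve M n k best s) <= mcost M n (pad n k s))%N.
Proof. by rewrite /improve; case: (leqP (mcost M n best)). Qed.

Lemma foldl_improve_le M n k best l :
  (mcost M n (foldl (improve M n k) best l) <= mcost M n best)%N.
Proof. by elim: l best => //= s l IHl best; apply: leq_trans (IHl _) (improve_le _ _ _ _ _). Qed.

(** Padding only adds centres to [s], and the cost of the best solution never increases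
    afterwards. *)
Lemma foldl_improve_le_mem M n k best l s : (0 < k <= n)%N -> s \in l -> size s = k ->
  all (fun x => x < n)%N s ->
  (mcost M n (foldl (improve M n k) best l) <= mcost M n s)%N.
Proof.
move=> /andP[k0 kn] + sk sn; elim: l best => //= t l IHl best.
rewrite inE => /orP[/eqP<-|/IHl //].
apply: leq_trans (foldl_improve_le _ _ _ _ _) (leq_trans (improve_le_pad _ _ _ _ _) _).
have [_ _ _ H] := pad_props kn sn.
apply: mcost_subset; first by rewrite -size_eq0 sk -lt0n.
by apply: H; rewrite sk.
Qed.

Lemma map_enum_mkseq (T : Type) n (f : nat -> T) : [seq f (val x) | x <- enum 'I_n] = mkseq f n.
Proof. by rewrite /mkseq -val_enum_ord -map_comp. Qed.

Section Metric.
Variables (R : realType) (n : nat) (X : metric R n).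

Definition rows : seq (seq nat) := [seq [seq mnum X x y | y <- enum 'I_n] | x <- enum 'I_n].

Lemma enc_metricE : enc_metric X = DPair (DNum (mden X)) (enc_mx rows).
Proof.
congr DPair; rewrite /enc_mx /rows -map_comp; congr elist; apply: eq_map => x.
by rewrite /= /nlist -map_comp.
Qed.

Lemma mget_rows (x y : 'I_n) : mget rows x y = mnum X x y.
Proof.
by rewrite /mget /rows (nth_map x) ?size_enum_ord // nth_ord_enum (nth_map y) ?size_enum_ord //
  nth_ord_enum.
Qed.

Let den_gt0 : 0 < (mden X)%:R :> R.
Proof. by rewrite ltr0n mden_gt0. Qed.

Lemma mnum_metric : [/\ forall x y : 'I_n, mnum X x y = 0%N <-> x = y,
  forall x y : 'I_n, mnum X x y = mnum X y x &
  forall x y z : 'I_n, (mnum X x z <= mnum X x y + mnum X y z)%N].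
Proof.
have [_ H0 Hs Ht] := metricP X; split=> x y.
- rewrite -H0 /fracdist; split=> [->|/eqP]; first by rewrite mul0r.
  by rewrite mulf_eq0 invr_eq0 !pnatr_eq0 => /orP[/eqP //|/eqP E]; have := mden_gt0 X; rewrite E.
- by have := Hs x y; rewrite /fracdist => /(mulIf (invr_neq0 (lt0r_neq0 den_gt0))) /eqP;
    rewrite eqr_nat => /eqP.
- by move=> z; have := Ht x y z; rewrite /fracdist -mulrDl ler_pM2r ?invr_gt0 // -natrD ler_nat.
Qed.

Section Truncated.
Variables (L : nat) (L0 : (0 < L)%N).

(** Numerators of the truncated metric; [L] itself serves as the denominator, which rescales the
    diameter to at most one. *)
Definition trunc_num : 'M[nat]_n := \matrix_(x, y) minn (mnum X x y) L.

Lemma trunc_metricP : is_metric (fracdist R trunc_num L).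
Proof.
have [H0 Hs Ht] := mnum_metric.
have Lp : 0 < L%:R^-1 :> R by rewrite invr_gt0 ltr0n.
split=> x y; rewrite /fracdist.
- by rewrite mulr_ge0 // ltW.
- rewrite mxE -H0; split=> [/eqP|->]; last by rewrite min0n mul0r.
  rewrite mulf_eq0 invr_eq0 !pnatr_eq0; lia.
- by rewrite !mxE Hs.
- move=> z; rewrite !mxE -mulrDl ler_pM2r // -natrD ler_nat.
  by have := Ht x y z; lia.
Qed.

Definition trunc_metric : metric R n := Metric L0 trunc_metricP.

Lemma enc_trunc_metric :
  enc_metric trunc_metric = DPair (DNum L) (enc_mx (truncate rows n L)).
Proof.
congr DPair; rewrite /enc_mx /truncate -map_enum_mkseq -map_comp; congr elist.
apply: eq_map => x; rewrite /= /nlist -map_enum_mkseq -map_comp; congr elist.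
by apply: eq_map => y; rewrite /= mxE mget_rows.
Qed.

Lemma trunc_metric_le1 x y : mdist trunc_metric x y <= 1.
Proof.
by rewrite /mdist /fracdist mxE ler_pdivrMr ?ltr0n // mul1r ler_nat geq_minr.
Qed.

Lemma trunc_nearest k (x : 'I_n) (C : config n k) : (0 < k)%N ->
  nearest trunc_metric x C = (minn (mind rows x (map val C)) L)%:R / L%:R.
Proof.
move=> k0; have C0 := config_neq0 k0 C; have [_ Hs _] := mnum_metric.
have mC0 : map val C != [::] :> seq nat by case: (tval C) C0.
apply/eqP; rewrite eq_le; apply/andP; split.
  have [a /mapP[y yC ->] ->] := mind_attained rows x mC0.
  apply: le_trans (minover_le _ yC) _.
  by rewrite mget_rows /mdist /fracdist mxE Hs.
apply: le_minover => // y yC; rewrite /mdist /fracdist mxE Hs -mget_rows.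
rewrite ler_pM2r ?invr_gt0 ?ltr0n // ler_nat.
have := mind_le rows x (map_f val yC); rewrite leq_min geq_minr andbT => H.
exact: leq_trans (geq_minl _ _) H.
Qed.

End Truncated.

Lemma median_costE (s : seq 'I_n) : s != [::] ->
  median_cost X [set x in s] = (mcost rows n (map val s))%:R / (mden X)%:R.
Proof.
move=> s0; have ms0 : map val s != [::] :> seq nat by case: (s) s0.
rewrite mcostE big_mkord natr_sum mulr_suml; apply: eq_bigr => x _.
have es0 : enum [set y in s] != [::].
  case: s s0 {ms0} => // y s _; rewrite -size_eq0 -cardE cards_eq0.
  by apply/set0Pn; exists y; rewrite inE mem_head.
apply/eqP; rewrite eq_le; apply/andP; split.
  have [a /mapP[y ys ->] ->] := mind_attained rows x ms0.
  rewrite mget_rows; apply: (@minover_le _ _ (enum [set y in s]) (fun a => mdist X x a) y).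
  by rewrite mem_enum inE.
apply: le_minover => // y; rewrite mem_enum inE => ys.
rewrite /mdist /fracdist ler_pM2r ?invr_gt0 // ler_nat -mget_rows.
exact: mind_le (map_f val ys).
Qed.

Lemma median_optE k : (0 < k <= n)%N -> exists C : config n k,
  [/\ uniq C & median_opt k X = (mcost rows n (map val C))%:R / (mden X)%:R].
Proof.
move=> /andP[k0 kn].
have : enum [set B : {set 'I_n} | #|B| == k] != [::].
  rewrite -size_eq0 -cardE cards_eq0; apply/set0Pn.
  have : (0 < #|[set B : {set 'I_n} | #|B| == k]|)%N by rewrite card_draws card_ord bin_gt0.
  by rewrite card_gt0 => /set0Pn.
move=> /minover_attained - /(_ _ (median_cost X)) [B]; rewrite mem_enum inE => /eqP cB EB.
have sB : size (enum B) == k by rewrite -cardE cB.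
exists (Tuple sB); split; first exact: enum_uniq.
rewrite /median_opt EB -median_costE; last by rewrite -size_eq0 -cardE cB -lt0n.
by congr median_cost; apply/setP => x; rewrite inE mem_enum.
Qed.

End Metric.

(** * Failure probability *)

Lemma scale_gt0 c M n s : (0 < c)%N -> (0 < n)%N -> (0 < scale c M n s)%N.
Proof.
move=> c0 n0; rewrite /scale; case: (mget _ _ _) => [|d]; first by rewrite muln0.
by rewrite addn_gt0 !muln_gt0 c0 n0.
Qed.

Section Failure.
Variables (R : realType) (A : prog) (p : {poly nat}) (c kappa a b n k : nat) (X : metric R n).
Hypotheses (c0 : (0 < c)%N) (k0 : (0 < k)%N) (kn : (k <= n)%N).
Let n0 : (0 < n)%N := leq_trans k0 kn.
Let T := alg_horizon a b n.
Hypothesis T0 : (0 < T)%N.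
Let M := rows X.
Let L s := scale c M n s.
Let X' s : metric R n := trunc_metric X (scale_gt0 M s c0 n0).

Lemma server_run_trunc s (xs : T.-tuple 'I_n) :
  server_run A p k T (X' s) xs =
  play k (trial_tau p c a b M n s) A (trial_mem c a b M n k s) xs.
Proof. by rewrite /server_run /server_input enc_trunc_metric. Qed.

Lemma trunc_instance s : server_instance k T (X' s).
Proof. by split; rewrite ?k0 //; apply: trunc_metric_le1. Qed.

Lemma efficient_safe : efficient_online R A p -> safe A p c a b M n k.
Proof.
by move=> H s xs; have := H _ _ _ _ xs (trunc_instance s); rewrite server_run_trunc.
Qed.

Variables (r eps : R) (x0 : 'I_n) (C0 : config n k) (s : nat).
Let d := mget M ((s %/ n) %% n) (s %% n).
Let O := mcost M n (map val C0).
Let W := (2 ^ (n + kappa))%N.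
Let q := (W %/ n)%N.
Hypotheses (Heff : efficient_online R A p) (d0 : (0 < d)%N) (dO : (d <= O <= n * d)%N).
Hypothesis Hreg : forall xs : T.-tuple 'I_n,
  expect (fun o => if o is Some Cs then online_cost (X' s) xs Cs else 0)
           (server_run A p k T (X' s) xs) <= offline_opt k (X' s) xs + r.
Hypotheses (eps0 : 0 < eps) (epsc : 2 + eps <= c%:R) (q0 : (0 < q)%N).

Lemma scaleE : L s = (c * n * d)%N.
Proof. by rewrite /L /scale -/d; lia. Qed.

Lemma sum_nearest (C : config n k) : \sum_(0 <= x < n) nearest (X' s) (toord x0 x) C =
  (\sum_(0 <= x < n) minn (mind M x (map val C)) (L s))%:R / (L s)%:R.
Proof.
rewrite !big_mkord natr_sum mulr_suml; apply: eq_bigr => x _.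
by rewrite /toord valKd trunc_nearest.
Qed.

Let Lp : 0 < (L s)%:R :> R. Proof. by rewrite ltr0n scale_gt0. Qed.
Let Wp : 0 < W%:R :> R. Proof. by rewrite ltr0n expn_gt0. Qed.
Let Op : 0 < O%:R :> R. Proof. by rewrite ltr0n; case/andP: dO => H _; apply: leq_trans d0 H. Qed.
Let qp : 0 < q%:R :> R. Proof. by rewrite ltr0n. Qed.

Definition bad (t : seq nat) : bool := (2 + eps) * O%:R < (mcost M n t)%:R.

(** The rescaled cost at which a solution becomes bad, weighted by [q / W], the least probability of
    a point under [draw]. *)
Definition level : R := q%:R * ((2 + eps) * O%:R / (L s)%:R) / W%:R.

(** If some point is farther than [L] from [C], that point alone contributes
    [L = c n d >= (2 + eps) O] after truncation; otherwise truncation does not change the cost of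
    [C]. *)
Lemma bad_average (C : config n k) : bad (map val C) ->
  level <= average (X' s) (n + kappa) x0 C.
Proof.
move=> badC; rewrite /level ler_pdivrMr // mulrC [leRHS]mulrC.
have f0 x : 0 <= nearest (X' s) (toord x0 x) C by apply: nearest_ge0.
have /andP[H _] := expect_draw (n + kappa) n0 f0.
rewrite mulrC; apply: le_trans H; rewrite -/W -/q ler_pM2l // sum_nearest ler_pM2r ?invr_gt0 //.
have LO : (2 + eps) * O%:R <= (L s)%:R.
  apply: (@le_trans _ _ (c%:R * O%:R)); first by rewrite ler_pM2r.
  rewrite -natrM ler_nat scaleE -mulnA leq_mul2l.
  by case/andP: dO => _ ->; rewrite orbT.
case: (boolP [exists x : 'I_n, (L s < mind M x (map val C))%N]) => [/existsP[x Hx]|].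
  apply: le_trans LO _; rewrite ler_nat big_mkord (bigD1 x) //=.
  by apply: leq_trans (leq_addr _ _); rewrite leq_min leqnn ltnW.
move=> /existsPn H1; apply: le_trans (ltW badC) _; rewrite ler_nat mcostE !big_mkord.
by apply: leq_sum => x _; rewrite leq_min leqnn leqNgt H1.
Qed.

Lemma average_opt : W%:R * average (X' s) (n + kappa) x0 C0 <= q.+1%:R * (O%:R / (L s)%:R).
Proof.
have f0 x : 0 <= nearest (X' s) (toord x0 x) C0 by apply: nearest_ge0.
have /andP[_ H] := expect_draw (n + kappa) n0 f0.
apply: le_trans H _; rewrite -/W -/q ler_pM2l ?ltr0n // sum_nearest ler_pM2r ?invr_gt0 //.
rewrite ler_nat /O mcostE; apply: leq_sum => x _; exact: geq_minl.
Qed.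

(** A failed trial has visited bad configurations only, because each of them is a candidate for the
    best solution; [regret_markov] bounds the probability of this. *)
Lemma trial_failure best : (0 <= r) -> points n k best ->
  T.-1%:R * (2 + eps) * expect (fun t => (bad t)%:R) (trial A p c kappa a b M n k best s)
  <= 2 * T%:R * (1 + q%:R^-1) + 2 * c%:R * n%:R ^+ 2 * r.
Proof.
move=> r0 bp; have sf := efficient_safe Heff.
set P := expect _ _.
pose tau := trial_tau p c a b M n s; pose mem := trial_mem c a b M n k s.
have ET : T = T.-1.+1 by rewrite prednK.
have level0 : 0 <= level.
  by rewrite /level !mulr_ge0 ?invr_ge0 ?ler0n // addr_ge0 // ltW.
have PE : P <= Eseq (n + kappa) x0 T.-1.+1 (fun xs => prob R (fun o =>
     all (fun C => level <= average (X' s) (n + kappa) x0 C) (odflt [::] o)) (play k tau A mem xs)).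
  rewrite -ET /P /trial expect_dbind; apply: expect_le (trial_play _ best s n0 sf) _.
  move=> _ [ys [-> ->]]; rewrite expect_dmap toordK.
  apply: (expect_le (P := fun=> True)) => [|o _]; first exact: always_true.
  rewrite ler_nat; case: (boolP (bad _)) => // bd.
  suff -> : all (fun C => level <= average (X' s) (n + kappa) x0 C) (odflt [::] o) by [].
  apply/allP => C Co; apply: bad_average; apply: lt_le_trans bd _; rewrite ler_nat.
  apply: foldl_improve_le_mem (_ : (0 < k <= n)%N) _ _ _; rewrite ?k0 //.
  - exact: map_f.
  - by rewrite size_map size_tuple.
  - by apply/allP => _ /mapP[z _ ->]; apply: ltn_ord.
have Hp (xs : seq 'I_n) : size xs = T.-1.+1 -> always (@isSome _) (play k tau A mem xs).
  by rewrite -ET => sx; apply: (sf s (Tuple (introT eqP sx))).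
have Hr (xs : seq 'I_n) : size xs = T.-1.+1 ->
     expect (fun o => if o is Some Cs then online_cost (X' s) xs Cs else 0) (play k tau A mem xs)
     <= offline_opt k (X' s) xs + r.
  rewrite -ET => sx.
  by have := Hreg (Tuple (introT eqP sx)); rewrite server_run_trunc.
have := regret_markov (X := X' s) (n + kappa) x0 k0 C0 level0 Hp Hr.
rewrite -ET => H.
have {}H : T.-1%:R * level * P <= T%:R * (2 * average (X' s) (n + kappa) x0 C0) + r.
  by apply: le_trans H; apply: ler_wpM2l; [exact: mulr_ge0|rewrite [X in Eseq _ _ X]ET].
have Ha : average (X' s) (n + kappa) x0 C0 <= q.+1%:R * (O%:R / (L s)%:R) / W%:R.
  by rewrite ler_pdivlMr // mulrC; apply: average_opt.
(* The unit of cost: [level] is [(2 + eps) * u], and the average of the optimum is at most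
   [u * (1 + q^-1)]. Dividing by [u] removes the optimum from the inequality. *)
pose u := q%:R * O%:R / ((L s)%:R * W%:R) : R.
have u0 : 0 < u by rewrite divr_gt0 ?mulr_gt0.
rewrite -(ler_pM2l u0).
have E1 : u * (T.-1%:R * (2 + eps) * P) = T.-1%:R * level * P.
  by rewrite /u /level; field; rewrite !lt0r_neq0.
have E2 : q.+1%:R * (O%:R / (L s)%:R) / W%:R = u * (1 + q%:R^-1).
  by rewrite /u -[q.+1]addn1 natrD; field; rewrite !lt0r_neq0.
rewrite E1; apply: le_trans H _; rewrite mulrDr; apply: lerD.
  rewrite E2 in Ha.
  have T0' : 0 <= T%:R :> R by rewrite ler0n.
  have := ler_wpM2l T0' Ha; lra.
rewrite mulrA -[leLHS]mul1r; apply: ler_wpM2r => //.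
(* The regret is divided by [u] as well, which costs at most a factor [2 c n ^ 2]: [W <= 2 q n]
   because [q >= 1], and [L <= c n O] because [d <= O]. *)
have HW : (W <= 2 * (q * n))%N.
  have : (W < q.+1 * n)%N by apply: ltn_ceil.
  move/ltnW/leq_trans; apply; rewrite mulnA leq_mul2r; apply/orP; right.
  by have := leq_add q0 (leqnn q); rewrite add1n addnn -mul2n.
have HL : (L s <= c * n * O)%N by rewrite scaleE leq_mul2l; case/andP: dO => -> _; rewrite orbT.
have H2 : (L s * W <= q * O * (2 * c * n ^ 2))%N.
  by apply: leq_trans (leq_mul HL HW) _; rewrite leq_eqVlt; apply/orP; left; apply/eqP; ring.
rewrite /u mulrAC ler_pdivlMr ?mulr_gt0 // mul1r -natrX -!natrM ler_nat.
by apply: leq_trans H2 _; rewrite leq_eqVlt; apply/orP; left; apply/eqP; ring.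
Qed.

End Failure.

(** Success is permanent, and a good item fails with probability at most [eta] from every valid
    state, so failure probabilities multiply although the trials share their accumulator. *)
Lemma expect_foldD_bad (R : realType) (S J : Type) (F : S -> J -> rdist S)
    (valid fails : pred S) (good : pred J) (eta : R) (s : S) (l : seq J) :
  0 <= eta <= 1 ->
  (forall s v, valid s -> always valid (F s v)) ->
  (forall s v, valid s -> ~~ fails s -> always (fun s' => ~~ fails s') (F s v)) ->
  (forall s v, valid s -> good v -> expect (fun s' => (fails s')%:R) (F s v) <= eta) ->
  valid s -> expect (fun s' => (fails s')%:R) (foldD F s l) <= eta ^+ count good l.
Proof.
move=> /andP[eta0 eta1] Hv Hb Hg.
have ok0 s1 l1 : valid s1 -> ~~ fails s1 ->
    expect (fun s' => (fails s')%:R) (foldD F s1 l1) = 0 :> R.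
  move=> vs bs; rewrite -(expect_cst 0 (foldD F s1 l1)).
  apply: (eq_expect_in (P := fun s' => ~~ fails s')) => [|s' /negPf -> //].
  apply: (@always_imp _ (fun s' => valid s' /\ ~~ fails s')) => [|s' [] //].
  apply: (foldD_always (Inv := fun _ s' => valid s' /\ ~~ fails s')) => // v r s' [v' b'].
  by apply: always_and; [apply: Hv|apply: Hb].
elim: l s => [|v l IHl] s vs /=; first by rewrite expr0; case: (fails s).
rewrite expect_dbind.
have e0 j : 0 <= eta ^+ j by rewrite exprn_ge0.
case: (boolP (good v)) => gv; last first.
  rewrite add0n -[leRHS](expect_cst _ (F s v)).
  by apply: expect_le (Hv s v vs) _ => s'; apply: IHl.
rewrite add1n exprS; apply: le_trans (ler_wpM2r (e0 _) (Hg s v vs gv)).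
rewrite mulrC -expectZ; apply: expect_le (Hv s v vs) _ => s' vs'.
case: (boolP (fails s')) => bs; first by rewrite mulr1; apply: IHl.
by rewrite ok0 // mulr0.
Qed.

Lemma count_mod (N m z : nat) : (z < N)%N ->
  (m <= count (fun s => s %% N == z) (iota 0 (N * m)))%N.
Proof.
move=> zN; elim: m => [|m IHm] //; rewrite mulnSr iotaD count_cat -addn1 leq_add //.
rewrite -has_count; apply/hasP; exists (N * m + z)%N.
  by rewrite mem_iota add0n leq_addr ltn_add2l.
by rewrite mulnC modnMDl modn_small.
Qed.

(** Turns the polynomial factor of the regret into a monomial, whose degree enters the exponent of
    the horizon. *)
Lemma horner_le_monomial (R : realType) (q : {poly R}) :
  exists (alpha : R) (beta : nat), 0 < alpha /\
    forall n, (0 < n)%N -> q.[n%:R] <= alpha * n%:R ^+ beta.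
Proof.
elim/poly_ind: q => [|q v [al [be [al0 H]]]].
  by exists 1, 0%N; split=> // n _; rewrite horner0 expr0 mulr1.
exists (al + `|v|), be.+1; split=> [|n n0]; first by rewrite ltr_wpDr.
have n1 : 1 <= n%:R :> R by rewrite ler1n.
rewrite hornerMXaddC mulrDl; apply: lerD.
  by rewrite exprSr mulrA ler_pM2r ?H // ltr0n.
by apply: le_trans (ler_norm v) _; rewrite ler_peMr // exprn_ege1.
Qed.

Lemma nat_ge (R : realType) (v : R) : exists N : nat, v <= N%:R.
Proof.
exists (Num.bound `|v|).
exact: le_trans (ler_norm v) (ltW (archi_boundP (normr_ge0 v))).
Qed.

Lemma exists_small_power (R : realType) (eta delta : R) : 0 <= eta < 1 -> 0 < delta ->
  exists m : nat, eta ^+ m <= delta.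
Proof.
move=> /andP[e0 e1] d0; case: (ltrgtP eta 0) => [|ep|->]; first by rewrite ltNge e0.
  (* Bernoulli's inequality for [1 + h = eta^-1], with [m] at least [1 / (delta * h)]. *)
  pose h := eta^-1 - 1; have h0 : 0 < h by rewrite subr_gt0 invf_gt1.
  have [m Hm] := nat_ge ((delta * h)^-1); exists m.
  have bern : m%:R * h <= (1 + h) ^+ m.
    elim: m {Hm} => [|m IHm]; first by rewrite mul0r.
    have p1 : 1 <= (1 + h) ^+ m by rewrite exprn_ege1 // lerDl ltW.
    rewrite exprS -[m.+1]addn1 natrD mulrDl mul1r mulrDl mul1r lerD //.
    by rewrite ler_peMr // ltW.
  have : delta^-1 <= (1 + h) ^+ m.
    apply: le_trans bern; move: Hm; rewrite invfM mulrC => Hm.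
    by rewrite -ler_pdivrMr // mulrC.
  have -> : 1 + h = eta^-1 by rewrite /h addrC subrK.
  by rewrite exprVn lef_pV2 // posrE exprn_gt0.
by exists 1%N; rewrite expr1 ltW.
Qed.

(** * Choice of the horizon and of the constants *)

Section Choice.
Variables (R : realType) (mu alpha eps : R) (beta c kappa N e : nat).
Hypotheses (mu0 : 0 < mu) (alpha0 : 0 < alpha) (eps0 : 0 < eps).
(** Both error terms are to stay below [eps / 4] times [T - 1]. With [h = 1 / kappa <= 1],
    [2 (1 + h) ^ 2 <= 2 + 6 h], whence the [24]. The regret term becomes [4 c alpha / N], whence the
    [16]. The bound [kappa.+2 <= N] gives [T - 1 >= kappa]. *)
Hypotheses (kappaP : 24 / eps <= kappa%:R) (kappa0 : (0 < kappa)%N).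
Hypotheses (NP : 16 * c%:R * alpha / eps <= N%:R) (Nkappa : (kappa.+2 <= N)%N).
Hypotheses (eP : mu^-1 <= e%:R) (e0 : (0 < e)%N).

Let a := (N ^ e)%N.
Let b := ((beta + 2) * e)%N.

Lemma alg_horizonE n : alg_horizon a b n = ((N * n ^ (beta + 2)) ^ e)%N.
Proof. by rewrite /alg_horizon /a /b expnMn expnM. Qed.

Lemma alg_horizon_ge n : (0 < n)%N -> (kappa.+2 <= alg_horizon a b n)%N.
Proof.
move=> n0; rewrite alg_horizonE; apply: leq_trans Nkappa _.
have nb : (0 < n ^ (beta + 2))%N by rewrite expn_gt0 n0.
apply: (@leq_trans (N * n ^ (beta + 2))); first by rewrite leq_pmulr.
have : (0 < N * n ^ (beta + 2))%N by rewrite muln_gt0 nb andbT; apply: leq_trans Nkappa.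
move: (N * _)%N => B B0; case: e e0 => // e' _; rewrite expnS leq_pmulr // expn_gt0 B0.
by [].
Qed.

Lemma draw_ratio n : (0 < n)%N -> (kappa <= 2 ^ (n + kappa) %/ n)%N.
Proof.
move=> n0; rewrite leq_divRL // expnD mulnC; apply: leq_mul; apply: ltnW; exact: ltn_expl.
Qed.

(* With [h = 1 / kappa], the first summand is at most [2 (1 + h)^2 (T - 1)]; the second is small
   because [T `^ mu >= N n^(beta + 2)]. *)
Lemma horizon_choice n (T := alg_horizon a b n) (q := (2 ^ (n + kappa) %/ n)%N) : (0 < n)%N ->
  2 * T%:R * (1 + q%:R^-1) + 2 * c%:R * n%:R ^+ 2 * (alpha * n%:R ^+ beta * T%:R `^ (1 - mu))
  <= T.-1%:R * (2 + eps / 2).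
Proof.
move=> n0.
have HT : (kappa.+2 <= T)%N := alg_horizon_ge n0.
pose t : R := T.-1%:R; have tE : T%:R = t + 1 by rewrite /t natr1 prednK //; apply: leq_trans HT.
have kp : 0 < kappa%:R :> R by rewrite ltr0n.
have tk : kappa%:R <= t by rewrite /t ler_nat; case: (T) HT => //= ?; apply: ltnW.
have t0 : 0 < t by apply: lt_le_trans tk.
pose h : R := kappa%:R^-1.
have h0 : 0 < h by rewrite invr_gt0.
have h1 : h <= 1 by rewrite invf_le1 // ler1n.
have he : h <= eps / 24.
  by rewrite /h -[eps / 24]invrK invf_div lef_pV2 // posrE divr_gt0.
have Hq : q%:R^-1 <= h.
  have := draw_ratio n0; rewrite -/q => kq.
  by rewrite lef_pV2 ?posrE ?ltr0n ?ler_nat //; apply: leq_trans kq.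
have Ht : t^-1 <= h by rewrite lef_pV2 ?posrE.
have Tt : T%:R <= t * (1 + h).
  by rewrite tE mulrDr mulr1 lerD2l -ler_pdivrMl // mulr1.
have P1 : 2 * T%:R * (1 + q%:R^-1) <= t * (2 + eps / 4).
  apply: (@le_trans _ _ (2 * (t * (1 + h)) * (1 + h))).
    rewrite ler_pM ?mulr_ge0 ?ler0n ?addr_ge0 ?invr_ge0 ?ler0n //.
      by rewrite ler_pM2l.
    by rewrite lerD2l.
  have hh : h * h <= h by rewrite ler_piMr // ltW.
  have -> : 2 * (t * (1 + h)) * (1 + h) = t * (2 * (1 + h) * (1 + h)) by ring.
  rewrite ler_pM2l //; lra.
have P2 : 2 * c%:R * n%:R ^+ 2 * (alpha * n%:R ^+ beta * T%:R `^ (1 - mu)) <= t * (eps / 4).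
  pose B : R := (N * n ^ (beta + 2))%N%:R.
  have BE : T%:R = B ^+ e by rewrite /T alg_horizonE natrX.
  have nb : (0 < n ^ (beta + 2))%N by rewrite expn_gt0 n0.
  have N0 : (0 < N)%N by apply: leq_trans Nkappa.
  have B1 : 1 <= B by rewrite ler1n muln_gt0 N0.
  have Bp : 0 < B by apply: lt_le_trans B1.
  (* [T] is [B ^ e] with [B >= 1] and [e * mu >= 1], hence its power [mu] is at least [B]. *)
  have TB : T%:R `^ (1 - mu) <= T%:R / B.
    have Tp : T%:R != 0 :> R by rewrite BE expf_neq0 // lt0r_neq0.
    rewrite powRB ?Tp ?implybT // powRr1 ?ler0n //; rewrite ler_wpM2l ?ler0n //.
    rewrite lef_pV2 ?posrE ?powR_gt0 // ?lt0r_neq0 ?BE ?exprn_gt0 //.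
    rewrite -powR_mulrn ?(ltW Bp) // -powRrM -[leLHS]powRr1 ?(ltW Bp) //.
    by apply: ler_powR => //; rewrite -ler_pdivrMr // mul1r.
  have T2 : T%:R <= 2 * t.
    by apply: le_trans Tt _; rewrite mulrC ler_pM2r //; lra.
  have C0 : 0 <= 2 * c%:R * n%:R ^+ 2 * (alpha * n%:R ^+ beta) :> R.
    by rewrite !mulr_ge0 ?exprn_ge0 ?ler0n ?ltW.
  rewrite mulrA; apply: le_trans (ler_wpM2l C0 TB) _.
  apply: le_trans (ler_wpM2l C0 (ler_wpM2r _ T2)) _; first by rewrite invr_ge0 ltW.
  rewrite /B natrM natrX exprD.
  have np : 0 < n%:R :> R by rewrite ltr0n.
  have Np : 0 < N%:R :> R by rewrite ltr0n.
  have nbp : 0 < n%:R ^+ beta :> R by rewrite exprn_gt0.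
  have -> : 2 * c%:R * n%:R ^+ 2 * (alpha * n%:R ^+ beta) *
      (2 * t / (N%:R * (n%:R ^+ beta * n%:R ^+ 2))) = t * (4 * c%:R * alpha / N%:R).
    by field; rewrite !lt0r_neq0.
  rewrite ler_pM2l // ler_pdivrMr //.
  by move: NP; rewrite ler_pdivrMr // => NP'; lra.
by rewrite -/t; lra.
Qed.

End Choice.

Lemma points_output n k (s : seq nat) : points n k s -> exists ys : seq 'I_n,
  s = map val ys /\ median_output n k (Some (nlist s)) = Some [set x in ys].
Proof.
case/and3P=> us /eqP sk /nats_to_ords[ys E]; exists ys; split=> //.
rewrite /median_output /= E dec_points_nlist.
have uy : uniq ys by move: us; rewrite E => /map_uniq.
by rewrite cardsE (card_uniqP uy) -sk E size_map eqxx.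
Qed.

Lemma trial_mcost_le A p c kappa a b M n k best s v : (0 < n)%N -> safe A p c a b M n k ->
  (mcost M n best <= v)%N ->
  always (fun t => (mcost M n t <= v)%N) (trial A p c kappa a b M n k best s).
Proof.
move=> n0 sf bv; apply/always_dbind.
apply: always_imp (trial_play _ best s n0 sf) _ => _ [ys [-> ->]].
apply/always_dmap; apply: always_true => o.
exact: leq_trans (foldl_improve_le _ _ _ _ _) bv.
Qed.

(** The ratio of the bound [T.-1 * (2 + eps / 2)] from [horizon_choice] to the factor
    [T.-1 * (2 + eps)] in [trial_failure]. *)
Lemma failure_rate (R : realType) (eps : R) : 0 < eps -> 0 <= (2 + eps / 2) / (2 + eps) < 1.
Proof.
move=> e0; rewrite divr_ge0 /=; [|lra|lra].
by rewrite ltr_pdivrMr ?mul1r; lra.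
Qed.

(** * Failure probability of the whole algorithm *)

Section Success.
Variables (R : realType) (A : prog) (p : {poly nat}) (c kappa a b m n k : nat) (X : metric R n).
Variables (r eps : R) (C0 : config n k).
Hypotheses (c0 : (0 < c)%N) (k0 : (0 < k)%N) (kn : (k <= n)%N).
Hypotheses (eps0 : 0 < eps) (epsc : 2 + eps <= c%:R) (r0 : 0 <= r).
Hypothesis Heff : efficient_online R A p.
Let T := alg_horizon a b n.
Let q := (2 ^ (n + kappa) %/ n)%N.
Hypotheses (T1 : (1 < T)%N) (q0 : (0 < q)%N).
Hypothesis Hreg : forall (X' : metric R n) (xs : T.-tuple 'I_n), server_instance k T X' ->
  expect (fun o => if o is Some Cs then online_cost X' xs Cs else 0)
           (server_run A p k T X' xs) <= offline_opt k X' xs + r.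
Hypothesis Hnum : 2 * T%:R * (1 + q%:R^-1) + 2 * c%:R * n%:R ^+ 2 * r
  <= T.-1%:R * (2 + eps / 2).
Hypothesis uC0 : uniq C0.
Let M := rows X.
Let O := mcost M n (map val C0).
Let fails := bad X eps C0.
Let eta : R := (2 + eps / 2) / (2 + eps).
Let n0 : (0 < n)%N := leq_trans k0 kn.
Let T0 : (0 < T)%N := ltnW T1.

Lemma median_alg_failure :
  expect (fun t => (fails t)%:R) (median_alg A p c kappa a b m M n k) <= eta ^+ m.
Proof.
have sf : safe A p c a b M n k by apply: efficient_safe Heff.
have ep2 : 0 < 2 + eps by rewrite addr_gt0.
have eta01 : 0 <= eta <= 1.
  by have /andP[-> /ltW] := failure_rate eps0.
have Hv s v : points n k s -> always (points n k) (trial A p c kappa a b M n k s v).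
  exact: trial_points.
have Hb s v : points n k s -> ~~ fails s ->
    always (fun s' => ~~ fails s') (trial A p c kappa a b M n k s v).
  move=> _ bs; apply: always_imp (trial_mcost_le kappa v n0 sf (leqnn _)) _ => t.
  by move: bs; rewrite /fails /bad -!leNgt => bs H; apply: le_trans bs; rewrite ler_nat.
have vp : points n k (pad n k [::]) := pad_nil_points kn.
(* With optimum zero no pair of points has a distance [d] with [0 < d <= O]. But then every point is
   a median, so [k = n], and the starting solution already consists of all points. *)
have O0case : O = 0%N -> ~~ fails (pad n k [::]).
  move=> OE; rewrite /fails /bad -/M -/O OE mulr0 -leNgt lern0 -leqn0 -OE.
  have [H0 _ _] := mnum_metric X.
  have all0 (x : 'I_n) : val x \in map val C0.
    move/eqP: OE; rewrite /O mcostE big_mkord sum_nat_eq0 => /forallP /(_ x) /eqP Hx.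
    have mC0 : map val C0 != [::] by rewrite -size_eq0 size_map size_tuple -lt0n.
    have [_ /mapP[y yC ->] E] := mind_attained M x mC0.
    by move: Hx; rewrite E mget_rows => /H0 ->; apply: map_f.
  apply: mcost_subset; first by rewrite -size_eq0 size_map size_tuple -lt0n.
  have nk : (n <= k)%N.
    rewrite -[n]card_ord -(size_tuple C0) -(card_uniqP uC0); apply/subset_leq_card/subsetP.
    by move=> x _; have := all0 x; rewrite mem_map //; apply: val_inj.
  case/and3P: vp => us /eqP sk /allP ln.
  have sub : {subset pad n k [::] <= iota 0 n} by move=> x /ln; rewrite mem_iota.
  have le_size : (size (iota 0 n) <= size (pad n k [::]))%N by rewrite size_iota sk.
  have [_ E] := uniq_min_size us sub le_size.
  by move=> _ /mapP[x _ ->]; rewrite E mem_iota add0n; apply: ltn_ord.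
have Hs best s : points n k best -> (0 < mget M ((s %/ n) %% n) (s %% n))%N ->
    (mget M ((s %/ n) %% n) (s %% n) <= O <= n * mget M ((s %/ n) %% n) (s %% n))%N ->
    expect (fun t => (fails t)%:R) (trial A p c kappa a b M n k best s) <= eta.
  move=> bp d0 dO; have x0 : 'I_n := Ordinal n0.
  have Hr (xs : T.-tuple 'I_n) := Hreg xs (trunc_instance X c0 k0 kn T0 s).
  have H := trial_failure T0 x0 Heff d0 dO Hr eps0 epsc q0 r0 bp.
  have T1p : 0 < T.-1%:R :> R by rewrite ltr0n -subn1 subn_gt0.
  rewrite /eta ler_pdivlMr // mulrC -(ler_pM2l T1p) mulrA.
  exact: le_trans H Hnum.
case: (posnP O) => [/O0case bs|Opos].
  apply: le_trans (_ : 0 <= _); last by rewrite exprn_ge0 //; case/andP: eta01.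
  rewrite -(expect_cst 0 (median_alg A p c kappa a b m M n k)).
  apply: le_trans (_ : expect (fun=> 0) _ <= _); last by [].
  apply: (expect_le (P := fun t => ~~ fails t)) => [|t /negPf -> //].
  apply: (@always_imp _ (fun t => points n k t /\ ~~ fails t)) => [|t [] //].
  apply: (foldD_always (Inv := fun _ t => points n k t /\ ~~ fails t)) => // v l t [v' b'].
  by apply: always_and; [apply: Hv|apply: Hb].
have [H0 _ _] := mnum_metric X.
pose i0 : 'I_n := Ordinal n0.
(* The right pair: [x] is a point farthest from the optimal medians, and [y] below is a median
   nearest to it. *)
have [x _ xmax] := @arg_maxnP _ i0 predT (fun x : 'I_n => mind M x (map val C0)) isT.
have mC0 : map val C0 != [::] by rewrite -size_eq0 size_map size_tuple -lt0n.
have [_ /mapP[y yC ->] Exy] := mind_attained M x mC0.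
have dO : (mget M x y <= O <= n * mget M x y)%N.
  rewrite -Exy /O mcostE big_mkord; apply/andP; split.
    by rewrite (bigD1 x) //= leq_addr.
  apply: (@leq_trans (\sum_(i < n) mind M x (map val C0))%N).
    by apply: leq_sum => i _; apply: xmax.
  by rewrite sum_nat_const card_ord.
have d0 : (0 < mget M x y)%N.
  by move: dO => /andP[_]; case: (mget M x y) => //; rewrite muln0 leqNgt Opos.
have zN : (x * n + y < n * n)%N.
  apply: (@leq_trans (x.+1 * n)); first by rewrite mulSn addnC ltn_add2r.
  by rewrite leq_mul2r ltn_ord orbT.
pose good s := (s %% (n * n) == x * n + y)%N.
have Hg best s : points n k best -> good s ->
    expect (fun t => (fails t)%:R) (trial A p c kappa a b M n k best s) <= eta.
  move=> bp /eqP Es.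
  have Ey : (s %% n)%N = y.
    by rewrite -(modn_dvdm s (dvdn_mulr n (dvdnn n))) Es modnMDl modn_small.
  have Ex : ((s %/ n) %% n)%N = x.
    have [t ->] : exists t, s = ((t * n + x) * n + y)%N.
      by exists (s %/ (n * n))%N; rewrite {1}(divn_eq s (n * n)) Es; ring.
    by rewrite divnMDl // divn_small // addn0 modnMDl modn_small.
  by apply: Hs => //; rewrite Ex Ey.
apply: le_trans (expect_foldD_bad (iota 0 (n * n * m)) eta01 Hv Hb Hg vp) _.
apply: ler_wiXn2l; [by case/andP: eta01|by case/andP: eta01|exact: count_mod].
Qed.

End Success.

(** * The k-median program and the final estimate *)

Lemma median_inputE (R : realType) n k (X : metric R n) : median_input k X =
  DPair (DNum n) (DPair (DNum k) (DPair (DNum (mden X)) (enc_mx (rows X)))).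
Proof. by rewrite /median_input enc_metricE. Qed.

Lemma median_program (R : realType) (A : prog) (p : {poly nat}) (c kappa a b m : nat) :
  (0 < c)%N -> (forall n, (0 < n)%N -> (0 < alg_horizon a b n)%N) ->
  efficient_online R A p ->
  exists (B : prog) (pB : {poly nat}), forall n k (X : metric R n), (0 < k <= n)%N ->
    exec pB.[dsize (median_input k X)] B (median_input k X) =
    dmap Some (dmap nlist (median_alg A p c kappa a b m (rows X) n k)).
Proof.
move=> c0 T0 Heff.
pose I := {n : nat & (nat * metric R n)%type}.
pose nn (i : I) := tag i; pose kk (i : I) := (tagged i).1.
pose MM (i : I) := rows (tagged i).2.
pose env (i : I) := median_input (kk i) (tagged i).2.
pose sz i := dsize (env i).
pose D (i : I) : Prop := (0 < kk i <= nn i)%N.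
have envb : bounded sz D env by apply: pbd_sz.
have H0 : dptime sz D env (fun i => DPair (DNum (nn i)) (DPair (DNum (kk i))
    (DPair (DNum (mden (tagged i).2)) (enc_mx (MM i))))).
  by apply: eq_ptime (ptime_id envb) => i _; rewrite /env median_inputE.
have Hn := ptime_fst envb H0.
have H1 := ptime_snd envb H0; have Hk := ptime_fst envb H1.
have HM := ptime_snd envb (ptime_snd envb H1).
(* [n] is written in binary, yet the matrix in the input has [n] rows; so loops of length polynomial
   in [n] are polynomial in the input size. *)
have nb : pbd sz D nn.
  apply: pbd_le (dptime_bounded HM) _ => i _.
  have := size_elist (map nlist (MM i)).
  by rewrite size_map /MM /rows size_map size_enum_ord => /ltnW.
have HD i : D i -> [/\ (0 < nn i)%N, (kk i <= nn i)%N & safe A p c a b (MM i) (nn i) (kk i)].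
  move=> /andP[k0 kn]; have n0 := leq_trans k0 kn.
  by split=> //; apply: efficient_safe Heff => //; apply: T0.
have [B [cost [[e He] HB]]] := ptime_median_alg kappa m envb HM Hn nb Hk HD.
(* The polynomial form of the bound [(sz i).+2 ^ e] provided by [pbd]. *)
exists B, (('X + 2%:P) ^+ e) => n k X kn.
pose i : I := Tagged (fun n => (nat * metric R n)%type) (k, X).
have -> : (('X + 2%:P) ^+ e).[dsize (median_input k X)] = ((sz i).+2 ^ e)%N.
  elim: e {He} => [|e IHe]; first by rewrite expr0 hornerC.
  rewrite exprS hornerM IHe hornerD hornerX hornerC expnS; congr (_ * _)%N.
  exact: addn2.
exact: runs_exec (runs_le (He i kn) (HB i kn)).
Qed.

Theorem theorem2p9 (R : realType)
  (kserver : exists (mu : R) (A : prog) (p : {poly nat}) (q : {poly R}),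
     [/\ 0 < mu,
         efficient_online R A p &
         has_regret A p (fun n T => q.[n%:R] * T%:R `^ (1 - mu))]) :
  forall eps : R, 0 < eps ->
  forall delta : R, 0 < delta ->
  exists (B : prog) (p : {poly nat}),
    polytime_median R B p /\ achieves_approx B p (2 + eps) delta.
Proof.
case: kserver => mu [A [p [q [mu0 Heff Hreg]]]] eps eps0 delta delta0.
have [alpha [beta [alpha0 Hq]]] := horner_le_monomial q.
have [c epsc] := nat_ge (2 + eps).
have c0 : (0 < c)%N by rewrite -(ltr0n R); apply: lt_le_trans epsc; rewrite addr_gt0.
have [kappa1 Hkappa1] := nat_ge (24 / eps); pose kappa := kappa1.+1.
have kappaP : 24 / eps <= kappa%:R by apply: le_trans Hkappa1 _; rewrite ler_nat.
have [N1 HN1] := nat_ge (16 * c%:R * alpha / eps); pose N := (N1 + kappa.+2)%N.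
have NP : 16 * c%:R * alpha / eps <= N%:R by apply: le_trans HN1 _; rewrite ler_nat leq_addr.
have Nkappa : (kappa.+2 <= N)%N by apply: leq_addl.
have [e1 He1] := nat_ge mu^-1; pose e := e1.+1.
have eP : mu^-1 <= e%:R by apply: le_trans He1 _; rewrite ler_nat.
have [m Hm] := exists_small_power (failure_rate eps0) delta0.
pose a := (N ^ e)%N; pose b := ((beta + 2) * e)%N.
have T2 n : (0 < n)%N -> (1 < alg_horizon a b n)%N.
  by move=> n0; apply: leq_trans (alg_horizon_ge beta Nkappa _ n0).
have T0 n : (0 < n)%N -> (0 < alg_horizon a b n)%N by move/T2/ltnW.
have [B [pB HB]] := median_program kappa m c0 T0 Heff.
exists B, pB.
have sf n k (X : metric R n) : (0 < k <= n)%N -> safe A p c a b (rows X) n k.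
  move=> /andP[k0 kn]; apply: efficient_safe Heff => //; apply: T0; exact: leq_trans kn.
have Hpts n k (X : metric R n) : (0 < k <= n)%N ->
    always (points n k) (median_alg A p c kappa a b m (rows X) n k).
  move=> /[dup] /sf sX /andP[k0 kn]; apply: median_alg_points => //; exact: leq_trans kn.
split=> n k X kn.
  rewrite /median_run HB // !dmap_comp; apply/always_dmap.
  by apply: always_imp (Hpts _ _ X kn) _ => s /points_output [ys [_ ->]].
have [C0 [uC0 optE]] := median_optE X kn.
have /andP[k0 kn'] := kn; have n0 : (0 < n)%N := leq_trans k0 kn'.
pose r := alpha * n%:R ^+ beta * (alg_horizon a b n)%:R `^ (1 - mu).
have r0 : 0 <= r by rewrite !mulr_ge0 ?exprn_ge0 ?powR_ge0 // ltW.
have Hr (X' : metric R n) (xs : (alg_horizon a b n).-tuple 'I_n) :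
    server_instance k (alg_horizon a b n) X' ->
    expect (fun o => if o is Some Cs then online_cost X' xs Cs else 0)
      (server_run A p k (alg_horizon a b n) X' xs) <= offline_opt k X' xs + r.
  move=> /(Hreg _ _ _ _ xs) H; apply: le_trans H _.
  by rewrite lerD2l ler_wpM2r ?powR_ge0 // Hq.
have Hnum := horizon_choice beta mu0 alpha0 eps0 kappaP (ltn0Sn _) NP Nkappa eP (ltn0Sn _) n0.
have q0 : (0 < 2 ^ (n + kappa) %/ n)%N by apply: leq_trans (draw_ratio kappa n0).
have Hfail := median_alg_failure m X c0 k0 kn' eps0 epsc r0 Heff (T2 n n0) q0 Hr
   Hnum uC0.
have {}Hfail := le_trans Hfail Hm.
rewrite /prob /median_run HB // !dmap_comp expect_dmap.
set D := median_alg _ _ _ _ _ _ _ _ _ _.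
apply: (@le_trans _ _ (expect (fun t => 1 + -1 * (bad X eps C0 t)%:R) D)).
  by rewrite expectD expect_cst expectZ mulN1r lerD2l lerN2.
apply: expect_le (Hpts _ _ X kn) _ => s sp; have [ys [E ->]] := points_output sp.
have ys0 : ys != [::].
  by case/and3P: sp => _ /eqP sk _; rewrite -size_eq0 -(size_map val) -E sk -lt0n.
rewrite median_costE // optE -E mulN1r /bad ltNge.
have -> : ((mcost (rows X) n s)%:R / (mden X)%:R <=
    (2 + eps) * ((mcost (rows X) n [seq val i | i <- C0])%:R / (mden X)%:R) :> R) =
   ((mcost (rows X) n s)%:R <= (2 + eps) * (mcost (rows X) n [seq val i | i <- C0])%:R :> R).
  by rewrite mulrA ler_pM2r // invr_gt0 ltr0n mden_gt0.
suff H (g g' : bool) : g = g' -> 1 - (~~ g)%:R <= g'%:R :> R by apply: H.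
by move=> ->; case: g'; rewrite /= ?subr0 ?subrr.
Qed.
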